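(* Let $\mathsf f\in\mathcal E'(\mathbb R)$ and suppose that $\mathsf f=\mathsf F'$, where $\mathsf F$ is a Łojasiewicz distribution. Let $E\subset\mathbb R$ be a countable set. Suppose that for every $\phi\in\mathcal T_1$ $$\mathsf f^{+}_{\phi,0}(x)\ge0\quad\text{for almost every }x\in\mathbb R,$$ and $$\mathsf f^{-}_{\phi,0}(x)\ge -M_x>-\infty\quad\text{for every }x\in\mathbb R\setminus E .$$ Then $\mathsf f$ is a measure in $\mathbb R$.
   Context: Distributions are real; $\mathcal E'(\mathbb R)$ is the space of compactly supported distributions. $\mathcal T_0$ is the class of functions $\phi\in C^\infty(\mathbb R)$ with $\phi\ge0$, $\int_{-\infty}^\infty\phi(x)\,dx=1$, for which there exists $\alpha<-1$ such that $\phi^{(m)}(x)=O(|x|^{\alpha-m})$ as $|x|\to\infty$ for every $m\in\{0,1,2,\dots\}$. $\mathcal T_1$ is the class of those $\phi\in\mathcal T_0$ that also satisfy $x\phi'(x)\le0$ for all $x\in\mathbb R$. For $\mathsf f\in\mathcal E'(\mathbb R)$, $\phi\in\mathcal T_0$, $x\in\mathbb R$, put $F(x,t)=\langle\mathsf f(x+ty),\phi(y)\rangle:=t^{-1}\langle \mathsf f(y),\phi((y-x)/t)\rangle$ for $t>0$ and $$\mathsf f^{+}_{\phi,0}(x)=\limsup_{t\to0^+}F(x,t),\qquad \mathsf f^{-}_{\phi,0}(x)=\liminf_{t\to0^+}F(x,t).$$ The constants $M_x$ are real numbers (they may depend on $x$). For $\mathsf g\in\mathcal D'(\mathbb R)$,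 the distributional (Łojasiewicz) point value $\mathsf g(x_0)$ exists and equals $\gamma\in\mathbb R$ if $\lim_{\varepsilon\to0}|\varepsilon|^{-1}\langle \mathsf g(y),\phi((y-x_0)/\varepsilon)\rangle=\gamma\int_{-\infty}^\infty\phi(y)\,dy$ for every $\phi\in\mathcal D(\mathbb R)$. A Łojasiewicz distribution is a distribution having a distributional point value at every point of $\mathbb R$. ''Measure'' means positive Radon measure. *)

(* Defs.v *)
From HB Require Import structures.
From mathcomp Require Import all_boot all_order all_algebra.
From mathcomp Require Import all_classical all_reals all_analysis.

Set Implicit Arguments.
Unset Strict Implicit.
Unset Printing Implicit Defensive.

Import Order.TTheory GRing.Theory Num.Theory.
Import numFieldNormedType.Exports.

Local Open Scope ring_scope.
Local Open Scope classical_set_scope.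

Definition smooth (R : realType) (phi : R -> R) : Prop :=
  forall (m : nat) (x : R), derivable (phi^`(m)) x 1.

Definition supp (R : realType) (phi : R -> R) : set R :=
  closure [set x | phi x != 0].

Definition test_function (R : realType) (phi : R -> R) : Prop :=
  smooth phi /\ compact (supp phi).

(* Only the values on test functions are meaningful. The map is total, so two
   distributions are equal when they agree on test functions. *)
Record Dprime (R : realType) := MkDprime {
  Dprime_apply :> (R -> R) -> R ;
  Dprime_linear : forall (a : R) (phi psi : R -> R),
    test_function phi -> test_function psi ->
    Dprime_apply (fun x => a * phi x + psi x) =
    a * Dprime_apply phi + Dprime_apply psi ;
  Dprime_continuous : forall K : set R, compact K ->
    exists (C : R) (N : nat), forall phi : R -> R,
      test_function phi -> supp phi `<=` K ->
      `|Dprime_apply phi| <=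
        C * \sum_(m < N.+1) sup (range (fun x => `|phi^`(m)%classic x|)) }.

Definition is_derivative_of (R : realType) (f F : Dprime R) : Prop :=
  forall phi : R -> R, test_function phi -> f phi = - F phi^`().

Definition vanishes_off (R : realType) (f : Dprime R) (K : set R) : Prop :=
  forall phi : R -> R, test_function phi -> supp phi `<=` ~` K -> f phi = 0.

Definition compactly_supported (R : realType) (f : Dprime R) : Prop :=
  exists2 K : set R, compact K & vanishes_off f K.

Definition cutoff (R : realType) (f : Dprime R) (chi : R -> R) : Prop :=
  test_function chi /\
  exists K U : set R,
    [/\ compact K, vanishes_off f K, open U, K `<=` U &
        forall x, U x -> chi x = 1].

(* <f, psi> for f compactly supported and psi smooth: the value f (chi psi),
   which is the same for all cutoffs chi (see epairingE). *)
Definition epairing (R : realType) (f : Dprime R) (psi : R -> R) : R :=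
  xget 0 [set f (fun x => chi x * psi x) | chi in cutoff f].

Definition has_point_value (R : realType) (g : Dprime R) (x0 gamma : R) :
    Prop :=
  forall phi : R -> R, test_function phi ->
    `|e|^-1 * g (fun y => phi ((y - x0) / e)) @[e --> 0^'] -->
      gamma * (\int[lebesgue_measure]_y phi y)%R.

Definition lojasiewicz (R : realType) (g : Dprime R) : Prop :=
  forall x0 : R, exists gamma : R, has_point_value g x0 gamma.

Definition class_T0 (R : realType) (phi : R -> R) : Prop :=
  [/\ smooth phi,
      forall x, 0 <= phi x,
      (\int[lebesgue_measure]_x (phi x)%:E = 1)%E &
      exists2 alpha : R, alpha < -1 & forall m : nat,
        exists C A : R, forall x : R, A <= `|x| ->
          `|phi^`(m)%classic x| <= C * `|x| `^ (alpha - m%:R)].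

Definition class_T1 (R : realType) (phi : R -> R) : Prop :=
  class_T0 phi /\ forall x, x * phi^`()%classic x <= 0.

Definition phi_transform (R : realType) (f : Dprime R) (phi : R -> R)
    (x t : R) : R :=
  t^-1 * epairing f (fun y => phi ((y - x) / t)).

Definition radial_upper (R : realType) (f : Dprime R) (phi : R -> R)
    (x : R) : \bar R :=
  limf_esup (fun t => (phi_transform f phi x t)%:E) 0^'+.

Definition radial_lower (R : realType) (f : Dprime R) (phi : R -> R)
    (x : R) : \bar R :=
  limf_einf (fun t => (phi_transform f phi x t)%:E) 0^'+.

Definition radon (R : realType)
    (mu : {measure set (measurableTypeR R) -> \bar R}) : Prop :=
  (forall K : set R, compact K -> (mu K < +oo)%E) /\
  (forall A : set (measurableTypeR R), measurable A ->
    mu A = ereal_sup [set mu K | K in [set K : set R | compact K /\ K `<=` A]]).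

Definition is_measure (R : realType) (f : Dprime R) : Prop :=
  exists2 mu : {measure set (measurableTypeR R) -> \bar R}, radon mu &
    forall phi : R -> R, test_function phi ->
      (f phi)%:E = (\int[mu]_x (phi x)%:E)%E.

Section epairing_facts.
Variable R : realType.
Implicit Types (f g phi psi chi : R -> R) (u : Dprime R).

Let smooth_upto (m : nat) f :=
  forall k x, (k <= m)%N -> derivable (f^`(k)) x 1.

Let smooth_uptoS m f : smooth_upto m.+1 f <->
  (forall x, derivable f x 1) /\ smooth_upto m f^`()%classic.
Proof.
split=> [sf|[f1 sf] [|k] x km]; last first.
- by rewrite derive1Sn; exact: sf.
- exact: f1.
split=> [x|k x km]; first exact: (sf 0%N).
by rewrite -derive1Sn; exact: sf.
Qed.

Let smooth_uptoD m f g : smooth_upto m f -> smooth_upto m g ->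
  smooth_upto m (fun x => f x + g x).
Proof.
elim: m f g => [|m IH] f g.
  move=> sf sg [|//] x _.
  by apply: derivableD; [exact: (sf 0%N)|exact: (sg 0%N)].
move=> /smooth_uptoS[f1 sf] /smooth_uptoS[g1 sg]; apply/smooth_uptoS; split.
  by move=> x; exact: derivableD.
suff -> : (fun x => f x + g x)^`()%classic =
    (fun x => f^`()%classic x + g^`()%classic x) by exact: IH.
by apply/funext => x; rewrite !derive1E; exact: deriveD.
Qed.

Let smooth_upto_le m f : smooth_upto m.+1 f -> smooth_upto m f.
Proof. by move=> sf k x km; apply: sf; exact: leqW. Qed.

Let smooth_uptoM m f g : smooth_upto m f -> smooth_upto m g ->
  smooth_upto m (fun x => f x * g x).
Proof.
elim: m f g => [|m IH] f g.
  move=> sf sg [|//] x _.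
  by apply: derivableM; [exact: (sf 0%N)|exact: (sg 0%N)].
move=> sf' sg'; move: (sf') (sg').
move=> /smooth_uptoS[f1 sf] /smooth_uptoS[g1 sg]; apply/smooth_uptoS; split.
  by move=> x; exact: derivableM.
suff -> : (fun x => f x * g x)^`()%classic =
    (fun x => f x * g^`()%classic x + g x * f^`()%classic x).
  by apply: smooth_uptoD; apply: IH => //; exact: smooth_upto_le.
by apply/funext => x; rewrite !derive1E; exact: deriveM.
Qed.

Lemma smoothM f g : smooth f -> smooth g -> smooth (fun x => f x * g x).
Proof.
move=> sf sg m x; apply: (@smooth_uptoM m f g _ _ m x (leqnn m)).
  by move=> k y _; exact: sf.
by move=> k y _; exact: sg.
Qed.

Lemma smoothB f g : smooth f -> smooth g -> smooth (fun x => f x - g x).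
Proof.
have smooth_cst (c : R) : smooth (fun=> c).
  move=> [|m] x; first exact: derivable_cst.
  rewrite derive1Sn.
  have d0 (b : R) : (fun=> b)^`()%classic = (fun=> 0 : R).
    by apply/funext => y; rewrite derive1E derive_cst.
  by rewrite d0; elim: m => [|m]; [exact: derivable_cst|rewrite derive1Sn d0].
move=> sf sg m x.
have -> : (fun x => f x - g x) = (fun x => f x + -1 * g x).
  by apply/funext => y; rewrite mulN1r.
have sNg := smoothM (smooth_cst (-1)) sg.
apply: (@smooth_uptoD m f (fun x => -1 * g x) _ _ m x (leqnn m)).
  by move=> k y _; exact: sf.
by move=> k y _; exact: sNg.
Qed.

Lemma test_functionM phi psi : test_function phi -> smooth psi ->
  test_function (fun x => phi x * psi x).
Proof.
move=> [sphi cphi] spsi; split; first exact: smoothM.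
apply: subclosed_compact cphi _; first exact: closed_closure.
apply: closureS => x /=; apply: contra_neq => ->; exact: mul0r.
Qed.

Let epairing_cutoff2 u psi chi1 chi2 : smooth psi ->
  cutoff u chi1 -> cutoff u chi2 ->
  u (fun x => chi1 x * psi x) = u (fun x => chi1 x * (chi2 x * psi x)).
Proof.
move=> spsi [t1 _] [t2 [K [U [_ uK oU KU chi2U]]]].
have tA := test_functionM t1 spsi.
have tB : test_function (fun x => chi1 x * (chi2 x * psi x)).
  by apply: test_functionM => //; apply: smoothM => //; case: t2.
pose d x := chi1 x * (psi x - chi2 x * psi x).
have td : test_function d.
  apply: test_functionM => //; apply: smoothB => //.
  by apply: smoothM => //; case: t2.
have ud : u d = 0.
  apply: uK => //; apply: (@subset_trans _ (~` U)); last exact: subsetC.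
  rewrite /supp; have /closure_id -> : closed (~` U) by exact: open_closedC.
  apply: closureS.
  by move=> x /= /[swap] Ux; rewrite /d chi2U// mul1r subrr mulr0 eqxx.
have := Dprime_linear u 1 td tB.
rewrite ud mulr0 add0r => <-; congr (u _); apply/funext => x.
by rewrite mul1r /d mulrBr subrK.
Qed.

Lemma epairingE u psi chi : smooth psi -> cutoff u chi ->
  epairing u psi = u (fun x => chi x * psi x).
Proof.
move=> spsi cchi; rewrite /epairing; apply: xget_unique; first by exists chi.
move=> _ [chi' cchi' <-].
rewrite (epairing_cutoff2 spsi cchi' cchi) (epairing_cutoff2 spsi cchi cchi').
by congr (u _); apply/funext => x; rewrite mulrCA.
Qed.

End epairing_facts.

(* Main.v *)
(* The hypotheses are used for a single [phi], compactly supported and with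
   [phi' x = - x w x] for an even bump [w].  Let [K] be the closed set of points
   with no neighbourhood on which [f] is nonnegative.  If [K] is not empty, the
   Baire category theorem, applied to the points where the means of [F] over cones
   and the lower bounds for the means of [f] are uniform in the scale, yields an
   open interval meeting [K] on which these bounds hold at every point of [K],
   except perhaps at one.  As the means of [F] are monotone off [K], they are
   bounded on the whole interval, so [F = G'] there with [G] Lipschitz.  The
   identity relating [phi] and [w] makes [t] times the mean of [f] a mean of
   [F] against the odd kernel [z w z], so the lower bounds forbid interior maxima
   of [G + A x^2 / 2]; hence [G] is semiconvex and [f >= - C].  A Vitali covering by
   balls on which the mean of [f] is almost nonnegative improves [- C] to
   [- (1 - kappa) C] with a fixed [kappa > 0], so [f >= 0] on the interval, which
   contradicts the choice of [K].  Thus [f >= 0]; the point values of [F] form a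
   continuous nondecreasing function, and its Stieltjes measure represents [f]. *)
From HB Require Import structures.
Require Import Defs.
From mathcomp Require Import all_boot all_order all_algebra.
From mathcomp Require Import all_classical all_reals all_analysis.
From mathcomp Require Import measurable_realfun.
From mathcomp Require Import ring lra.

Set Implicit Arguments.
Unset Strict Implicit.
Unset Printing Implicit Defensive.

Import Order.TTheory GRing.Theory Num.Theory.
Import numFieldNormedType.Exports.

Local Open Scope ring_scope.
Local Open Scope classical_set_scope.

(** The two kinds of exceptional points are treated differently. A condition almost everywhere
    cannot exclude mass on a null set, so the upper limits enter only after a bound [f >= - C] is
    known: the part of a test function left over by a Vitali covering then costs at most [C] times
    its integral. The pointwise lower bounds serve to reach such a [C]; they must hold off isolated
    points, since a single point can carry a negative atom. At the one point that remains, such an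
    atom would be a jump of [F], and the point value of [F] excludes it: a maximum of the perturbed
    [G] there determines the slope of the perturbation. The category argument takes place in [K] and
    not on the line, because only an interval meeting [K] gives a contradiction; off [K] the missing
    bounds come from positivity of [f]. Cones are used because a point [x] at distance at most [t]
    from some [k] in [K] has the form [k + c * t] with [c] in [-1, 1], so one bound over the cones
    at [K] controls all balls that meet [K]. *)

Ltac lin := repeat match goal with H : forall _ : _, _ |- _ => clear H end; lra.

(** * Smooth functions *)

Section smooth_functions.
Variable R : realType.
Implicit Types (f g : R -> R) (a b c x : R).

Lemma is_derive1E f x l : is_derive x (1 : R) f l -> f^`()%classic x = l.
Proof. by move=> h; rewrite derive1E; apply: derive_val. Qed.

Lemma derive1_funE f g : (forall x, is_derive x (1 : R) f (g x)) ->
  f^`()%classic = g.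
Proof. by move=> h; apply/funext => x; exact: is_derive1E. Qed.

Lemma is_derive1_continuous f x l : is_derive x (1 : R) f l ->
  {for x, continuous f}.
Proof.
move=> h; apply: differentiable_continuous; apply/derivable1_diffP.
exact: ex_derive.
Qed.

(** A coinductive proof principle: a class of differentiable functions that is stable under
    derivation consists of smooth functions, and no iterated derivative has to be computed. *)
Lemma smooth_invariant (P : (R -> R) -> Prop) :
  (forall f, P f -> (forall x, derivable f x 1) /\ P f^`()%classic) ->
  forall f, P f -> smooth f.
Proof.
move=> hP f Pf m; have : P f^`(m)%classic.
  elim: m f Pf => [|m IH] f Pf; first by rewrite derive1n0.
  by rewrite derive1Sn; apply: IH; case: (hP f Pf).
by move=> /hP[].
Qed.

Lemma smooth_derivable f x : smooth f -> derivable f x 1.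
Proof. by move=> sf; exact: (sf 0%N). Qed.

Lemma smooth_is_derive f x : smooth f -> is_derive x (1 : R) f (f^`()%classic x).
Proof.
move=> sf; rewrite derive1E; apply: DeriveDef => //; exact: smooth_derivable.
Qed.

Lemma smooth_deriv f : smooth f -> smooth f^`()%classic.
Proof. by move=> sf m x; rewrite -derive1Sn; exact: sf. Qed.

Lemma smooth_derivn f m : smooth f -> smooth f^`(m)%classic.
Proof.
by elim: m => [//|m IH] sf; rewrite derive1nS; apply: smooth_deriv; exact: IH.
Qed.

Lemma smooth_derivn_is_derive f m x : smooth f ->
  is_derive x (1 : R) f^`(m)%classic (f^`(m.+1)%classic x).
Proof.
by move=> sf; rewrite derive1nS; apply: smooth_is_derive; exact: smooth_derivn.
Qed.

Lemma smooth_continuous f : smooth f -> continuous f.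
Proof. by move=> sf x; exact: is_derive1_continuous (smooth_is_derive x sf). Qed.

Lemma smooth_cst c : smooth (fun _ : R => c).
Proof.
apply: (@smooth_invariant (fun f => exists d, f = (fun=> d))); last by exists c.
move=> _ [d ->]; split=> [x|]; first exact: derivable_cst.
by exists 0; apply/funext => x; rewrite derive1E derive_cst.
Qed.

Lemma is_derive_lin f g x a l m : is_derive x (1 : R) f l ->
  is_derive x (1 : R) g m ->
  is_derive x (1 : R) (fun y => a * f y + g y) (a * l + m).
Proof.
move=> df dg; have := is_deriveD (is_deriveZ a df) dg.
by move=> h; apply: (is_derive_eq h).
Qed.

Lemma derive1n_lin f g a m : smooth f -> smooth g ->
  (fun x => a * f x + g x)^`(m)%classic =
  (fun x => a * f^`(m)%classic x + g^`(m)%classic x).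
Proof.
move=> sf sg; elim: m => [|m IH]; first by [].
rewrite derive1nS IH; apply: derive1_funE => x.
by apply: is_derive_lin; exact: smooth_derivn_is_derive.
Qed.

Lemma smooth_lin f g a : smooth f -> smooth g -> smooth (fun x => a * f x + g x).
Proof.
move=> sf sg m x; rewrite derive1n_lin//; apply: ex_derive.
by apply: is_derive_lin; exact: smooth_derivn_is_derive.
Qed.

Lemma is_deriveZf f x a l : is_derive x (1 : R) f l ->
  is_derive x (1 : R) (fun y => a * f y) (a * l).
Proof. by move=> df; have h := is_deriveZ a df; exact: (is_derive_eq h). Qed.

Lemma derive1nZ f a m : smooth f ->
  (fun x => a * f x)^`(m)%classic = (fun x => a * f^`(m)%classic x).
Proof.
move=> sf; elim: m => [|m IH]; first by [].
rewrite derive1nS IH; apply: derive1_funE => x.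
by apply: is_deriveZf; exact: smooth_derivn_is_derive.
Qed.

Lemma is_derive_affine f x a b l : is_derive (a * x + b) (1 : R) f l ->
  is_derive x (1 : R) (fun y => f (a * y + b)) (a * l).
Proof.
move=> df.
have d1 : is_derive x (1 : R) (fun y => a * y + b) a.
  have := is_deriveD (is_deriveZ a (is_derive_id x (1 : R)))
                     (is_derive_cst b x (1 : R)).
  by move=> h; apply: (is_derive_eq h); rewrite addr0 [_ *: _]mulr1.
have := @is_derive1_comp _ f (fun y => a * y + b) x _ _ df d1.
by move=> h; apply: (is_derive_eq h); rewrite mulrC.
Qed.

Lemma derive1n_affine f a b m : smooth f ->
  (fun x => f (a * x + b))^`(m)%classic =
  (fun x => a ^+ m * f^`(m)%classic (a * x + b)).
Proof.
move=> sf; elim: m => [|m IH].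
  by apply/funext => x; rewrite expr0 mul1r.
rewrite derive1nS IH; apply: derive1_funE => x; rewrite exprSr -mulrA.
by apply/is_deriveZf/is_derive_affine; exact: smooth_derivn_is_derive.
Qed.

Lemma smooth_affine f a b : smooth f -> smooth (fun x => f (a * x + b)).
Proof.
move=> sf m x; rewrite derive1n_affine//; apply: ex_derive.
by apply/is_deriveZf/is_derive_affine; exact: smooth_derivn_is_derive.
Qed.

Lemma smoothZ f a : smooth f -> smooth (fun x => a * f x).
Proof.
move=> sf; have := smooth_lin (a := a) sf (@smooth_cst 0); congr smooth.
by apply/funext => x; rewrite addr0.
Qed.

Lemma smooth_id : smooth (fun x : R => x).
Proof.
move=> m x; suff : smooth (fun x : R => x) by apply.
apply: (@smooth_invariant (fun f => f = id \/ smooth f)); last by left.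
move=> f [->|sf].
  split=> [y|]; first exact: derivable_id.
  right; suff -> : (id : R -> R)^`()%classic = (fun=> 1) by exact: smooth_cst.
  by apply: derive1_funE => y.
by split=> [y|]; [exact: smooth_derivable|right; exact: smooth_deriv].
Qed.

End smooth_functions.

(** * Signed integrals of continuous functions *)

Section calculus.
Variable R : realType.
Implicit Types (f g : R -> R) (a b c x y h : R).

(** The disjunction covers both orders of the end points, so that signed increments need no case
    analysis later. *)
Lemma MVT_le f (f' : R -> R) (M : R) x y :
  (forall z, (x <= z <= y) || (y <= z <= x) -> is_derive z (1 : R) f (f' z)) ->
  (forall z, (x <= z <= y) || (y <= z <= x) -> `|f' z| <= M) ->
  `|f y - f x| <= M * `|y - x|.
Proof.
wlog xy : x y / x <= y => [hw df bf|].
  have /orP[xy|yx] := le_total x y; first exact: hw.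
  rewrite distrC (distrC y); apply: hw => // z zyx.
    by apply: df; rewrite orbC.
  by apply: bf; rewrite orbC.
move=> df bf.
have [||c cxy ->] := @MVT_segment R f f' x y xy.
- move=> z; rewrite in_itv/= => /andP[xz zy].
  by apply: df; rewrite (ltW xz) (ltW zy).
- move=> /= z; apply: continuous_in_subspaceT => {}z /set_mem /=.
  rewrite in_itv/= => zxy.
  by apply: is_derive1_continuous; apply: df; rewrite zxy.
rewrite normrM ler_wpM2r//; apply: bf.
by move: cxy; rewrite in_itv/= => ->.
Qed.

Lemma is_derive0_eq f x y :
  (forall z, (x <= z <= y) || (y <= z <= x) -> is_derive z (1 : R) f 0) ->
  f x = f y.
Proof.
move=> df; apply/eqP; rewrite eq_sym -subr_eq0 -normr_le0.
have := @MVT_le f (fun=> 0) 0 x y df; rewrite mul0r; apply.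
by move=> z _; rewrite normr0.
Qed.

Lemma derive_ge0_le f (f' : R -> R) x y : x <= y ->
  (forall z, x <= z <= y -> is_derive z (1 : R) f (f' z)) ->
  (forall z, x <= z <= y -> 0 <= f' z) -> f x <= f y.
Proof.
move=> xy df f0.
have [||c cxy E] := @MVT_segment R f f' x y xy.
- move=> z; rewrite in_itv/= => /andP[xz zy].
  by apply: df; rewrite (ltW xz) (ltW zy).
- move=> /= z; apply: continuous_in_subspaceT => {}z /set_mem /=.
  rewrite in_itv/= => zxy.
  by apply: is_derive1_continuous; exact: df.
rewrite -subr_ge0 E mulr_ge0 ?subr_ge0//; apply: f0.
by move: cxy; rewrite in_itv/=.
Qed.

(** The integral from [- n] is a primitive only to the right of [- n]. Normalised at 0, these
    primitives agree where they overlap, and they glue to a primitive on the whole line. *)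
Lemma primitive_exists g : continuous g ->
  exists P : R -> R, forall x, is_derive x (1 : R) P (g x).
Proof.
move=> cg.
pose Q (n : nat) x := (\int[@lebesgue_measure R]_(t in `[- n%:R, x]) g t)%R.
have dQ (n : nat) x : `|x| < n%:R -> is_derive x (1 : R) (Q n) (g x).
  rewrite ltr_norml => /andP[nx xn].
  have ig : (@lebesgue_measure R).-integrable `[- n%:R, n%:R] (EFin \o g).
    apply: continuous_compact_integrable; first exact: segment_compact.
    exact: continuous_subspaceT.
  have [] := continuous_FTC1_closed xn ig nx (cg x).
  move=> d1; rewrite derive1E => d2.
  exact: (DeriveDef d1 d2).
pose P n x := Q n x - Q n 0.
have dP n x : `|x| < n%:R -> is_derive x (1 : R) (P n) (g x).
  move=> xn; have h := is_deriveB (dQ n x xn) (is_derive_cst (Q n 0) x (1 : R)).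
  by apply: (is_derive_eq h); rewrite subr0.
have PE n m x : `|x| < n%:R -> `|x| < m%:R -> P n x = P m x.
  move=> xn xm; apply/eqP; rewrite -subr_eq0; apply/eqP.
  transitivity ((fun y => P n y - P m y) 0); last by rewrite /P !subrr.
  apply: (@is_derive0_eq (fun y => P n y - P m y) x 0) => z zx.
  have zx' : `|z| <= `|x|.
    case/orP: zx => /andP[h1 h2].
      by rewrite (ler0_norm h2) (ler0_norm (le_trans h1 h2)) lerN2.
    by rewrite (ger0_norm h1) (ger0_norm (le_trans h1 h2)).
  have h := is_deriveB (dP n z (le_lt_trans zx' xn)) (dP m z (le_lt_trans zx' xm)).
  by apply: (is_derive_eq h); rewrite subrr.
pose N x := (Num.truncn `|x|).+1.
have xN x : `|x| < (N x)%:R by rewrite /N truncnS_gt.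
exists (fun x => P (N x) x) => x.
apply: (near_eq_is_derive _ (dP (N x) x (xN x))).
have : \forall y \near x, `|y| < (N x)%:R.
  have := cvgr_lt `|x| (@norm_continuous _ R x); exact.
by apply: filterS => y yx; apply: PE.
Qed.

Definition primitive g : R -> R :=
  xget (cst 0) [set P | forall x, is_derive x (1 : R) P (g x)].

Lemma primitiveP g : continuous g ->
  forall x, is_derive x (1 : R) (primitive g) (g x).
Proof.
move=> /primitive_exists[P hP].
by rewrite /primitive; case: xgetP => [Q _ //|/(_ P)]; tauto.
Qed.

(** An oriented integral through a chosen primitive: the end points may come in any order, and for
    continuous integrands every rule becomes a statement about derivatives, free of integrability
    conditions. *)
Definition Int a b g := primitive g b - primitive g a.

Lemma IntE f g a b : continuous g ->
  (forall x, is_derive x (1 : R) f (g x)) -> Int a b g = f b - f a.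
Proof.
move=> cg df; apply/eqP; rewrite /Int -subr_eq0; apply/eqP.
have H : primitive g b - f b = primitive g a - f a.
  apply: (@is_derive0_eq (fun x => primitive g x - f x)) => z _.
  have h := is_deriveB (primitiveP cg z) (df z).
  by apply: (is_derive_eq h); rewrite subrr.
transitivity ((primitive g b - f b) - (primitive g a - f a)); first ring.
by rewrite H subrr.
Qed.

Lemma Int_is_derive g a x : continuous g ->
  is_derive x (1 : R) (fun y => Int a y g) (g x).
Proof.
move=> cg; have h := is_deriveB (primitiveP cg x) (is_derive_cst (primitive g a) x (1 : R)).
by apply: (is_derive_eq h); rewrite subr0.
Qed.

Lemma Intxx g a : Int a a g = 0.
Proof. by rewrite /Int subrr. Qed.

Lemma Int_split g a b c : Int a b g + Int b c g = Int a c g.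
Proof. by rewrite /Int; ring. Qed.

Lemma continuous_lin f g a : continuous f -> continuous g ->
  continuous (fun x => a * f x + g x).
Proof.
move=> cf cg x; apply: cvgD; last exact: cg.
by apply: cvgM; [exact: cvg_cst|exact: cf].
Qed.

Lemma continuousMf f g : continuous f -> continuous g ->
  continuous (fun x => f x * g x).
Proof. by move=> cf cg x; apply: cvgM; [exact: cf|exact: cg]. Qed.

Lemma Int_lin f g a b k : continuous f -> continuous g ->
  Int a b (fun x => k * f x + g x) = k * Int a b f + Int a b g.
Proof.
move=> cf cg.
have d x : is_derive x (1 : R) (fun y => k * primitive f y + primitive g y)
    (k * f x + g x) by apply: is_derive_lin; exact: primitiveP.
by rewrite (IntE a b (continuous_lin cf cg) d) /Int; ring.
Qed.

Lemma Int_cst k a b : Int a b (fun=> k) = k * (b - a).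
Proof.
have d x : is_derive x (1 : R) (fun y => k * y) k.
  have h := is_deriveZ k (is_derive_id x (1 : R)).
  by apply: (is_derive_eq h); rewrite [_ *: _]mulr1.
by rewrite (IntE a b (@cst_continuous _ _ k) d); ring.
Qed.

Lemma IntZ f a b k : continuous f -> Int a b (fun x => k * f x) = k * Int a b f.
Proof.
move=> cf; have := @Int_lin f (fun=> 0) a b k cf (@cst_continuous _ _ _).
by under eq_fun do rewrite addr0; rewrite Int_cst mul0r addr0.
Qed.

Lemma IntD f g a b : continuous f -> continuous g ->
  Int a b (fun x => f x + g x) = Int a b f + Int a b g.
Proof.
move=> cf cg; have := @Int_lin f g a b 1 cf cg.
by under eq_fun do rewrite mul1r; rewrite mul1r.
Qed.

Lemma IntB f g a b : continuous f -> continuous g ->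
  Int a b (fun x => f x - g x) = Int a b f - Int a b g.
Proof.
move=> cf cg; have := @Int_lin g f a b (-1) cg cf.
under eq_fun do rewrite mulN1r addrC.
by rewrite mulN1r addrC.
Qed.

Lemma Int_ge0 g a b : continuous g -> a <= b ->
  (forall x, a <= x <= b -> 0 <= g x) -> 0 <= Int a b g.
Proof.
move=> cg ab g0; rewrite /Int subr_ge0; apply: (@derive_ge0_le _ g) => //.
by move=> z _; exact: primitiveP.
Qed.

Lemma Int_le f g a b : continuous f -> continuous g -> a <= b ->
  (forall x, a <= x <= b -> f x <= g x) -> Int a b f <= Int a b g.
Proof.
move=> cf cg ab fg; rewrite -subr_ge0 -IntB//; apply: Int_ge0 => //.
  by move=> x; apply: cvgB; [exact: cg|exact: cf].
by move=> x /fg; rewrite subr_ge0.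
Qed.

Lemma continuous_normf f : continuous f -> continuous (fun x => `|f x|).
Proof. by move=> cf x; apply: cvg_norm; exact: cf. Qed.

Lemma Int_norm f a b : continuous f -> a <= b ->
  `|Int a b f| <= Int a b (fun x => `|f x|).
Proof.
move=> cf ab; have cn := continuous_normf cf.
rewrite ler_norml -mulN1r -IntZ//; apply/andP; split; apply: Int_le => //.
- by apply: continuousMf => //; exact: cst_continuous.
- by move=> x _; rewrite mulN1r lerNl; apply: le_trans (ler_norm _) _; rewrite normrN.
- by move=> x _; exact: ler_norm.
Qed.

Lemma Int_norm_le f a b M : continuous f -> a <= b ->
  (forall x, a <= x <= b -> `|f x| <= M) -> `|Int a b f| <= M * (b - a).
Proof.
move=> cf ab fM; rewrite -Int_cst; apply: le_trans (Int_norm cf ab) _.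
by apply: Int_le => //; [exact: continuous_normf|exact: cst_continuous].
Qed.

Lemma eq_Int f g a b : continuous f -> continuous g -> a <= b ->
  (forall x, a <= x <= b -> f x = g x) -> Int a b f = Int a b g.
Proof.
by move=> cf cg ab fg; apply/eqP; rewrite eq_le; apply/andP; split;
  apply: Int_le => // x /fg ->.
Qed.

Lemma continuous_affine g c h : continuous g -> continuous (fun x => g (c * x + h)).
Proof.
move=> cg x; apply: (@continuous_comp _ _ _ (fun x => c * x + h) g); last exact: cg.
apply: cvgD; last exact: cvg_cst.
by apply: cvgM; [exact: cvg_cst|exact: cvg_id].
Qed.

Lemma Int_affine g a b c h : continuous g ->
  c * Int a b (fun x => g (c * x + h)) = Int (c * a + h) (c * b + h) g.
Proof.
move=> cg; have ca := @continuous_affine g c h cg.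
have d x : is_derive x (1 : R) (fun y => primitive g (c * y + h))
    (c * g (c * x + h)) by apply: is_derive_affine; exact: primitiveP.
rewrite -IntZ// (IntE a b (continuousMf (@cst_continuous _ _ c) ca) d).
by [].
Qed.

Lemma is_deriveMf f g x l m : is_derive x (1 : R) f l ->
  is_derive x (1 : R) g m ->
  is_derive x (1 : R) (fun y => f y * g y) (f x * m + l * g x).
Proof.
move=> df dg; have h := is_deriveM df dg.
by apply: (is_derive_eq h); rewrite (mulrC l).
Qed.

Lemma Int_parts f f' g g' a b : continuous f' -> continuous g' ->
  (forall x, is_derive x (1 : R) f (f' x)) ->
  (forall x, is_derive x (1 : R) g (g' x)) ->
  Int a b (fun x => f x * g' x) =
  f b * g b - f a * g a - Int a b (fun x => f' x * g x).
Proof.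
move=> cf' cg' df dg.
have cf : continuous f by move=> x; exact: is_derive1_continuous (df x).
have cg : continuous g by move=> x; exact: is_derive1_continuous (dg x).
have c1 := continuousMf cf cg'; have c2 := continuousMf cf' cg.
apply/eqP; rewrite eq_sym subr_eq -IntD//; apply/eqP; apply/esym.
apply: (@IntE (fun x => f x * g x)).
  by move=> x; apply: cvgD; [exact: c1|exact: c2].
by move=> x; exact: is_deriveMf.
Qed.

Lemma Int_eq0 g a b : continuous g -> a <= b ->
  (forall x, a <= x <= b -> g x = 0) -> Int a b g = 0.
Proof.
move=> cg ab g0; rewrite (@eq_Int g (fun=> 0))//; last exact: cst_continuous.
by rewrite Int_cst mul0r.
Qed.

Lemma Int_widen g a b c d : continuous g -> c <= a -> a <= b -> b <= d ->
  (forall x, (x < a) || (b < x) -> g x = 0) -> Int c d g = Int a b g.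
Proof.
move=> cg ca ab bd g0.
rewrite -(Int_split g c a) -(Int_split g a b d).
(* The integrand is known to vanish only strictly outside [a, b], so the mean value theorem is
   applied at an interior point. *)
have H u v : u <= v -> (forall x, u < x < v -> g x = 0) -> Int u v g = 0.
  move=> uv h; rewrite /Int.
  move: uv; rewrite le_eqVlt => /predU1P[->|uv]; first by rewrite subrr.
  have [||z zuv ->] := @MVT R (primitive g) g u v uv.
  - by move=> z _; exact: primitiveP.
  - by apply: continuous_subspaceT => z; exact: is_derive1_continuous (primitiveP cg z).
  by rewrite h ?mul0r//; move: zuv; rewrite in_itv.
by rewrite (H c a)// ?(H b d)// ?add0r ?addr0// => x /andP[xa xb];
   apply: g0; rewrite ?xa ?xb ?orbT.
Qed.

End calculus.

(** * Test functions *)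

Section smooth_support.
Variable R : realType.
Implicit Types (f g : R -> R) (a b c x y h : R).

(** An explicit interval in place of [supp] reduces questions about supports to linear arithmetic on
    the end points. *)
Definition vanish_out a b f := forall x, (x < a) || (b < x) -> f x = 0.

Lemma vanish_out_sub a b c d f : c <= a -> b <= d ->
  vanish_out a b f -> vanish_out c d f.
Proof.
move=> ca bd f0 x /orP[xc|dx]; apply: f0.
  by rewrite (lt_le_trans xc ca).
by rewrite (le_lt_trans bd dx) orbT.
Qed.

Lemma vanish_out_lin a b f g k : vanish_out a b f -> vanish_out a b g ->
  vanish_out a b (fun x => k * f x + g x).
Proof. by move=> f0 g0 x xab; rewrite f0// g0// mulr0 addr0. Qed.

Lemma vanish_outMr a b f g : vanish_out a b g -> vanish_out a b (fun x => f x * g x).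
Proof. by move=> f0 x /f0 ->; rewrite mulr0. Qed.

Lemma vanish_out_deriv a b f : vanish_out a b f -> vanish_out a b f^`()%classic.
Proof.
move=> f0 x /orP xab; apply: is_derive1E.
apply: (near_eq_is_derive _ (is_derive_cst (0 : R) x (1 : R))).
case: xab => xab; [have := lt_nbhsl xab|have := lt_nbhsr xab].
  by apply: filterS => y ya; rewrite f0// ya.
by apply: filterS => y ya; rewrite f0// ya orbT.
Qed.

Lemma vanish_out_derivn a b f m : vanish_out a b f -> vanish_out a b f^`(m)%classic.
Proof.
by elim: m => [//|m IH] f0; rewrite derive1nS; apply: vanish_out_deriv; exact: IH.
Qed.

Lemma vanish_out_supp a b f : vanish_out a b f -> supp f `<=` `[a, b].
Proof.
move=> f0; rewrite /supp; have /closure_id -> := @itv_closed _ R a b.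
apply: closureS => x /= fx; rewrite in_itv/=; apply: contraNT fx.
by rewrite negb_and -!ltNge => /f0 ->.
Qed.

Lemma test_functionP a b f : smooth f -> vanish_out a b f -> test_function f.
Proof.
move=> sf f0; split => //.
apply: (subclosed_compact (@closed_closure _ _) (@segment_compact _ a b)).
exact: vanish_out_supp.
Qed.

Lemma test_function_vanish_out f : test_function f ->
  exists2 B : R, 0 < B & vanish_out (- B) B f.
Proof.
move=> [sf /compact_bounded[M [Mr HM]]].
have M1 : M < `|M| + 1 by rewrite (le_lt_trans (ler_norm _))// ltrDl.
exists (`|M| + 1); first by rewrite ltr_pwDr.
move=> x xB; apply/eqP; apply/negP => /negP fx.
have sx : supp f x by apply: subset_closure.
have := HM _ M1 x sx; rewrite /= ler_norml => /andP[h1 h2].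
by case/orP: xB; rewrite ltNge ?h1 ?h2.
Qed.

Lemma bounded_on_itv a b f : continuous f ->
  exists2 M : R, 0 <= M & forall x, a <= x <= b -> `|f x| <= M.
Proof.
move=> cf; have [ab|ba] := leP a b; last first.
  exists 0 => // x /andP[h1 h2]; have := le_trans h1 h2.
  by rewrite leNgt ba.
have cn : {within `[a, b], continuous (fun x => `|f x|)}.
  by apply: continuous_subspaceT; exact: continuous_normf.
have [c _ hc] := EVT_max ab cn.
exists `|f c| => // x xab; apply: hc; by rewrite in_itv.
Qed.

Lemma vanish_out_bounded a b f : continuous f -> vanish_out a b f ->
  exists2 M : R, 0 <= M & forall x, `|f x| <= M.
Proof.
move=> cf f0; have [M M0 hM] := @bounded_on_itv a b f cf.
exists M => // x; have [xab|] := boolP (a <= x <= b); first exact: hM.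
by rewrite negb_and -!ltNge => /f0 ->; rewrite normr0.
Qed.

Lemma derivn_bounded a b f m : smooth f -> vanish_out a b f ->
  exists2 M : R, 0 <= M & forall x, `|f^`(m)%classic x| <= M.
Proof.
move=> sf f0; apply: (@vanish_out_bounded a b).
  exact/smooth_continuous/smooth_derivn.
exact: vanish_out_derivn.
Qed.

(** Quadratic remainders, unlike remainders in little-o form, pass unchanged through seminorm
    estimates, integrals and limits; most derivatives of parametrised families below are obtained
    this way. *)
Lemma is_derive_quadratic f x l (r C : R) : 0 < r ->
  (forall h, `|h| < r -> `|f (x + h) - f x - h * l| <= C * `|h| ^+ 2) ->
  is_derive x (1 : R) f l.
Proof.
move=> r0 hC.
have cv : h^-1 *: (f (h *: 1 + x) - f x) @[h --> (0:R)^'] --> l.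
  apply/cvgrPdist_le => e e0.
  have C1 : 0 < `|C| + 1 by rewrite ltr_pwDr.
  near=> h.
  have h0 : h != 0 by near: h; exact: nbhs_dnbhs_neq.
  have hr : `|h| < r by near: h; exact: dnbhs0_lt.
  have he : `|h| <= e / (`|C| + 1).
    by near: h; apply: dnbhs0_le; rewrite divr_gt0.
  have -> : l - h^-1 *: (f (h *: 1 + x) - f x) =
      - (h^-1 * (f (x + h) - f x - h * l)).
    rewrite [h *: 1]mulr1 (addrC h) [_ *: _]/(_ * _).
    by rewrite mulrBr mulKf// opprB.
  rewrite normrN normrM normfV.
  rewrite mulrC ler_pdivrMr ?normr_gt0//.
  apply: le_trans (hC h hr) _; rewrite expr2 mulrA ler_wpM2r//.
  apply: le_trans (_ : (`|C| + 1) * `|h| <= _).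
    by rewrite ler_wpM2r// (le_trans (ler_norm _))// lerDl.
  by rewrite mulrC -ler_pdivlMr.
have d : derivable f x 1 by apply/cvg_ex; exists l.
by apply: DeriveDef => //; exact: cvg_lim cv.
Unshelve. all: by end_near. Qed.

End smooth_support.

(** * Flat functions and a smooth bump *)

Section bump_functions.
Variable R : realType.
Implicit Types (f g : R -> R) (a b c x y h : R) (p : {poly R}).

Lemma smooth_antiderivative f g : (forall x, is_derive x (1 : R) f (g x)) ->
  smooth g -> smooth f.
Proof.
move=> df sg [|m] x; first exact: ex_derive.
by rewrite derive1Sn (derive1_funE df); exact: sg.
Qed.

Lemma horner_bound p : exists2 A : R, 0 <= A &
  forall u, 1 <= u -> `|p.[u]| <= A * u ^+ size p.
Proof.
exists (\sum_(i < size p) `|p`_i|); first by rewrite sumr_ge0.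
move=> u u1; rewrite horner_coef (le_trans (ler_norm_sum _ _ _))// mulr_suml.
apply: ler_sum => i _; rewrite normrM ler_wpM2l// normrX.
rewrite ger0_norm; last by rewrite (le_trans ler01).
by rewrite ler_weXn2l// ltnW.
Qed.

(** The functions [p(1/x) exp(-1/x)], extended by 0, with an arbitrary polynomial [p]: the family is
    stable under derivation, as [smooth_invariant] requires, while the single function [exp(-1/x)]
    is not. *)
Definition flat p x : R := if 0 < x then p.[x^-1] * expR (- x^-1) else 0.

Definition flat_deriv p := (p - p^`()) * 'X^2.

Lemma flat_is_derive p x : is_derive x (1 : R) (flat p) (flat (flat_deriv p) x).
Proof.
have [x0|x0|->] := ltgtP x 0.
- apply: (@near_eq_is_derive _ _ _ (cst 0)).
    have := lt_nbhsl x0; apply: filterS => y y0.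
    by rewrite /flat ltNge (ltW y0).
  rewrite /flat ltNge (ltW x0) /=; exact: is_derive_cst.
- apply: (@near_eq_is_derive _ _ _ (fun y => p.[y^-1] * expR (- y^-1))).
    by have := lt_nbhsr x0; apply: filterS => y y0; rewrite /flat y0.
  rewrite /flat x0.
  have dV : is_derive x (1 : R) (fun y : R => y^-1) (- x ^- 2).
    have xn0 : x != 0 by rewrite gt_eqF.
    apply: DeriveDef; first by apply: (@derivableV _ _ id).
    by rewrite (@deriveV _ _ id)// derive_id [LHS]mulr1.
  have d1 := @is_derive1_comp _ (horner p) (fun y => y^-1) x _ _
    (is_derive_poly p x^-1) dV.
  have dN : is_derive x (1 : R) (fun y : R => - y^-1) (x ^- 2).
    by have h := is_deriveN dV; apply: (is_derive_eq h); rewrite opprK.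
  have d2 := @is_derive1_comp _ expR (fun y => - y^-1) x _ _
    (is_derive_expR (- x^-1)) dN.
  have h := is_deriveMf d1 d2; apply: (is_derive_eq h).
  rewrite /flat_deriv hornerM hornerXn hornerD hornerN -exprVn /=.
  ring.
- rewrite {2}/flat ltxx.
  have [A A0 hA] := horner_bound p.
  (* The term of order [size p + 2] of the exponential series absorbs the growth [u ^ size p] of the
     polynomial at [u = 1/h] and leaves a factor [h ^ 2]. *)
  apply: (@is_derive_quadratic _ _ _ _ 1 (A * (size p).+2`!%:R)) => // h h1.
  rewrite /flat ltxx add0r subr0 mulr0 subr0.
  case: ifPn => h0; last by rewrite normr0 !mulr_ge0// ler0n.
  rewrite (gtr0_norm h0) in h1 *; set u := h^-1.
  have u1 : 1 <= u by rewrite invf_ge1// ltW.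
  have u0 : 0 < u by rewrite invr_gt0.
  rewrite normrM (gtr0_norm (expR_gt0 _)) expRN.
  have eu : u ^+ (size p).+2 / (size p).+2`!%:R <= expR u.
    by have := expR_ge1Dxn (size p).+1 (ltW u0); apply: le_trans; rewrite lerDr.
  clear h1; have up : 0 < u ^+ (size p).+2 / (size p).+2`!%:R.
    by rewrite divr_gt0 ?exprn_gt0// ltr0n fact_gt0.
  apply: le_trans (_ : A * u ^+ size p * (u ^+ (size p).+2 / (size p).+2`!%:R)^-1 <= _).
    apply: ler_pM => //; first exact: hA.
    by rewrite lef_pV2// posrE expR_gt0.
  have cn : (size p).+2`!%:R != 0 :> R by rewrite pnatr_eq0 -lt0n fact_gt0.
  move: (size p).+2`!%:R cn => c cn.
  have un : u ^+ size p != 0 by rewrite expf_neq0// gt_eqF.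
  have -> : u ^+ (size p).+2 = u ^+ size p * u ^+ 2 by rewrite -exprD addn2.
  have hu : h = u^-1 by rewrite invrK.
  move: (u ^+ size p) un => w un; have un0 : u != 0 by rewrite gt_eqF.
  clear eu up u1 u0; clearbody u.
  rewrite le_eqVlt; apply/orP; left; apply/eqP.
  rewrite hu; field.
  by rewrite cn un un0.
Qed.

Lemma flat_smooth p : smooth (flat p).
Proof.
apply: (@smooth_invariant _ (fun f => exists q, f = flat q)); last by exists p.
move=> _ [q ->]; split=> [x|]; first by have := flat_is_derive q x => ?; exact: ex_derive.
by exists (flat_deriv q); apply: derive1_funE => x; exact: flat_is_derive.
Qed.

Definition bump x : R := flat 1 (x + 1) * flat 1 (1 - x).

Lemma bump_smooth : smooth bump.
Proof.
have h a b : smooth (fun x => flat 1 (a * x + b)).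
  by apply: smooth_affine; exact: flat_smooth.
apply: smoothM.
  by have := h 1 1; congr smooth; apply/funext => x; rewrite mul1r.
by have := h (-1) 1; congr smooth; apply/funext => x; rewrite mulN1r addrC.
Qed.

Lemma flat_ge0 x : 0 <= flat 1 x.
Proof. by rewrite /flat; case: ifP => // _; rewrite hornerC mul1r expR_ge0. Qed.

Lemma bump_ge0 x : 0 <= bump x.
Proof. by rewrite mulr_ge0// flat_ge0. Qed.

Lemma bump_gt0 x : `|x| < 1 -> 0 < bump x.
Proof.
rewrite ltr_norml -subr_gt0 opprK => /andP[x1 x2].
by rewrite mulr_gt0// /flat ?x1 ?subr_gt0 ?x2// hornerC mul1r expR_gt0.
Qed.

Lemma bumpN x : bump (- x) = bump x.
Proof. by rewrite /bump mulrC opprK (addrC _ 1) (addrC x). Qed.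

Lemma bump_out : vanish_out (-1) 1 bump.
Proof.
move=> x /orP[x1|x1]; rewrite /bump /flat.
  by rewrite ltNge -lerBrDr sub0r ltW//= mul0r.
by rewrite (ltNge 0 (1 - x)) subr_le0 ltW//= mulr0.
Qed.

End bump_functions.

(** * Linearity, continuity and differentiation under a distribution *)

Section distributions.
Variable R : realType.
Implicit Types (f g zeta : R -> R) (a b c x y h t s : R) (u : Dprime R).

Definition testf a b f := smooth f /\ vanish_out a b f.

Lemma testf_test a b f : testf a b f -> test_function f.
Proof. by case; exact: test_functionP. Qed.

Lemma testf_sub a b c d f : c <= a -> b <= d -> testf a b f -> testf c d f.
Proof. by move=> ca bd [sf f0]; split => //; exact: vanish_out_sub f0. Qed.

Lemma testf_lin a b f g k : testf a b f -> testf a b g ->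
  testf a b (fun x => k * f x + g x).
Proof.
by move=> [sf f0] [sg g0]; split; [exact: smooth_lin|exact: vanish_out_lin].
Qed.

Lemma testf0 a b : testf a b (fun=> 0).
Proof. by split; [exact: smooth_cst|]. Qed.

Lemma testfZ a b f k : testf a b f -> testf a b (fun x => k * f x).
Proof.
move=> tf; have := testf_lin k tf (testf0 a b); congr testf.
by apply/funext => x; rewrite addr0.
Qed.

Lemma testfB a b f g : testf a b f -> testf a b g -> testf a b (fun x => f x - g x).
Proof.
move=> tf tg; have := testf_lin (-1) tg tf; congr testf.
by apply/funext => x; rewrite mulN1r addrC.
Qed.

Lemma testf_deriv a b f : testf a b f -> testf a b f^`()%classic.
Proof. by move=> [sf f0]; split; [exact: smooth_deriv|exact: vanish_out_deriv]. Qed.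

Lemma Dprime0 u : u (fun=> 0) = 0.
Proof.
have t0 := testf_test (testf0 0 0).
have := Dprime_linear u (-1) t0 t0; under eq_fun do rewrite mulr0 addr0.
by rewrite mulN1r addNr.
Qed.

Lemma Dprime_lin u a b f g k : testf a b f -> testf a b g ->
  u (fun x => k * f x + g x) = k * u f + u g.
Proof. by move=> /testf_test tf /testf_test tg; exact: Dprime_linear. Qed.

Lemma DprimeZ u a b f k : testf a b f -> u (fun x => k * f x) = k * u f.
Proof.
move=> tf; have := Dprime_lin u k tf (testf0 a b).
by under eq_fun do rewrite addr0; rewrite Dprime0 addr0.
Qed.

Lemma DprimeD u a b f g : testf a b f -> testf a b g ->
  u (fun x => f x + g x) = u f + u g.
Proof.
move=> tf tg; have := Dprime_lin u 1 tf tg.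
by under eq_fun do rewrite mul1r; rewrite mul1r.
Qed.

Lemma DprimeB u a b f g : testf a b f -> testf a b g ->
  u (fun x => f x - g x) = u f - u g.
Proof.
move=> tf tg; have := Dprime_lin u (-1) tg tf.
under eq_fun do rewrite mulN1r addrC.
by rewrite mulN1r addrC.
Qed.

Lemma Dprime_bound u a b : exists (C : R) (N : nat), 0 <= C /\
  forall f (d : R), testf a b f ->
    (forall k, (k <= N)%N -> forall x, `|f^`(k)%classic x| <= d) ->
    `|u f| <= C * d.
Proof.
have [C [N hC]] := Dprime_continuous u (@segment_compact _ a b).
exists (`|C| * N.+1%:R), N; split; first by rewrite mulr_ge0.
move=> f d [sf f0] hd; apply: le_trans (hC f _ _) _.
- exact: test_functionP f0.
- exact: vanish_out_supp.
have S : \sum_(m < N.+1) sup (range (fun x => `|f^`(m)%classic x|)) <= N.+1%:R * d.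
  rewrite mulr_natl -[X in d *+ X]card_ord -sumr_const; apply: ler_sum => i _.
  apply: ge_sup; first by exists `|f^`(i)%classic 0|; exists 0.
  by move=> _ [x _ <-]; apply: hd; rewrite -ltnS.
have d0 : 0 <= d := le_trans (normr_ge0 _) (hd 0%N (leq0n N) 0).
have S0 : 0 <= \sum_(m < N.+1) sup (range (fun x => `|f^`(m)%classic x|)).
  apply: sumr_ge0 => i _; apply: le_trans (normr_ge0 (f^`(i)%classic 0)) _.
  apply: ub_le_sup; last by exists 0.
  by exists d => _ [x _ <-]; apply: hd; rewrite -ltnS.
rewrite -mulrA; apply: le_trans (_ : `|C| * (\sum_(m < N.+1) sup (range (fun x => `|f^`(m)%classic x|))) <= _).
  by rewrite ler_wpM2r// ler_norm.
by rewrite ler_wpM2l.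
Qed.

(** Two uses of the mean value inequality, which is why the constant is [M] and not [M / 2]. *)
Lemma taylor2_le f (f1 f2 : R -> R) (M r : R) x h : `|h| < r ->
  (forall z, `|z - x| < r -> is_derive z (1 : R) f (f1 z)) ->
  (forall z, `|z - x| < r -> is_derive z (1 : R) f1 (f2 z)) ->
  (forall z, `|z - x| < r -> `|f2 z| <= M) ->
  `|f (x + h) - f x - h * f1 x| <= M * `|h| ^+ 2.
Proof.
move=> hr d1 d2 hM.
have B z : (x <= z <= x + h) || (x + h <= z <= x) -> `|z - x| <= `|h|.
  case/orP => /andP[h1 h2].
    rewrite ger0_norm ?subr_ge0//; apply: le_trans (ler_norm h).
    by rewrite lerBlDl.
  rewrite ler0_norm ?subr_le0// -normrN; apply: le_trans (ler_norm (- h)).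
  by rewrite opprB lerBlDl -lerBlDr opprK.
have Br z : (x <= z <= x + h) || (x + h <= z <= x) -> `|z - x| < r.
  by move=> /B zh; exact: le_lt_trans hr.
have := @MVT_le _ (fun z => f z - z * f1 x) (fun z => f1 z - f1 x) (M * `|h|) x (x + h).
rewrite (_ : x + h - x = h); last by ring.
have -> : f (x + h) - (x + h) * f1 x - (f x - x * f1 x) = f (x + h) - f x - h * f1 x.
  by ring.
rewrite -mulrA -expr2; apply.
- move=> z /Br zr.
  have e := is_deriveB (d1 z zr) (is_deriveZ (f1 x) (is_derive_id z (1 : R))).
  have e' := is_derive_eq e (erefl _).
  apply: (near_eq_is_derive _ (is_derive_eq e' _)).
    by near=> w; rewrite /= [w * _]mulrC.
  by rewrite [_ *: _]mulr1.
- move=> z zI; have zh := B z zI.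
  apply: le_trans (_ : M * `|z - x| <= _).
    apply: (@MVT_le _ f1 f2).
    + move=> w wI; apply: d2; apply: Br.
      case/orP: zI => /andP[z1 z2]; case/orP: wI => /andP[w1 w2]; apply/orP; 
        [left|left|right|right]; apply/andP; split; lra.
    + move=> w wI; apply: hM; apply: Br.
      case/orP: zI => /andP[z1 z2]; case/orP: wI => /andP[w1 w2]; apply/orP; 
        [left|left|right|right]; apply/andP; split; lra.
  rewrite ler_wpM2l//; apply: le_trans (normr_ge0 (f2 x)) (hM x _).
  by rewrite subrr normr0; exact: le_lt_trans (normr_ge0 _) hr.
Unshelve. all: by end_near. Qed.

(** On a fixed interval the distribution is controlled by finitely many derivatives. It is therefore
    enough that each derivative in [y] of the family has a quadratic remainder in the parameter,
    uniformly in [y]; the constants for different orders are then added up. *)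
Lemma Dprime_is_derive u (th : R -> R -> R) (th1 : R -> R) a b s (r : R) : 0 < r ->
  (forall h, `|h| < r -> testf a b (th (s + h))) -> testf a b th1 ->
  (forall m, exists C : R, forall h y, `|h| < r ->
    `|(th (s + h))^`(m)%classic y - (th s)^`(m)%classic y - h * th1^`(m)%classic y|
    <= C * `|h| ^+ 2) ->
  is_derive s (1 : R) (fun s => u (th s)) (u th1).
Proof.
move=> r0 tth tth1 hC.
have ts : testf a b (th s) by have := tth 0; rewrite addr0 normr0; apply.
have [D [N [D0 hD]]] := Dprime_bound u a b.
have [Cm hCm] := choice hC.
pose C := \sum_(m < N.+1) `|Cm m|.
apply: (@is_derive_quadratic _ _ _ _ r (D * C)) => // h hr.
have th_h := tth h hr.
have E : (fun y => th (s + h) y - th s y - h * th1 y) =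
    (fun y => - h * th1 y + ((-1) * th s y + th (s + h) y)).
  by apply/funext => y; ring.
have -> : u (th (s + h)) - u (th s) - h * u th1 =
    u (fun y => th (s + h) y - th s y - h * th1 y).
  rewrite E (Dprime_lin u (- h) tth1 (testf_lin (-1) ts th_h)).
  by rewrite (Dprime_lin u (-1) ts th_h); ring.
rewrite -mulrA; apply: hD.
  by rewrite E; apply: testf_lin => //; exact: testf_lin.
move=> k kN y; rewrite E derive1n_lin; [|by case: tth1|by case: (testf_lin (-1) ts th_h)].
rewrite derive1n_lin; [|by case: ts|by case: th_h].
have -> : - h * th1^`(k)%classic y + (-1 * (th s)^`(k)%classic y + (th (s + h))^`(k)%classic y)
  = (th (s + h))^`(k)%classic y - (th s)^`(k)%classic y - h * th1^`(k)%classic y by ring.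
apply: le_trans (hCm k h y hr) _; rewrite ler_wpM2r// ?exprn_ge0//.
apply: le_trans (ler_norm _) _.
rewrite /C (bigD1 (Ordinal (kN : (k < N.+1)%N)))//= lerDl.
by apply: sumr_ge0.
Qed.

End distributions.

(** * Means of a distribution *)

Section rescaling.
Variable R : realType.
Implicit Types (f g zeta : R -> R) (a b c x y h t s B : R) (u : Dprime R).

Definition rescale zeta x t : R -> R := fun y => zeta ((y - x) / t).

(** For test kernels and compactly supported [u] this is [phi_transform] freed from the cutoff
    ([phi_transform_mean]); it makes sense for [F] as well, which need not have compact support. *)
Definition mean u zeta x t : R := t^-1 * u (rescale zeta x t).

Lemma rescaleE zeta x t :
  rescale zeta x t = (fun y => zeta (t^-1 * y + (- x / t))).
Proof. by apply/funext => y; rewrite /rescale mulrBl mulrC mulNr. Qed.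

Lemma rescale_smooth zeta x t : smooth zeta -> smooth (rescale zeta x t).
Proof. by move=> sz; rewrite rescaleE; exact: smooth_affine. Qed.

Lemma derive1n_rescale zeta x t m : smooth zeta ->
  (rescale zeta x t)^`(m)%classic =
  (fun y => t^-1 ^+ m * zeta^`(m)%classic ((y - x) / t)).
Proof.
move=> sz; rewrite rescaleE derive1n_affine//; apply/funext => y.
by rewrite mulrBl (mulrC y) mulNr.
Qed.

Lemma rescale_vanish_out a b zeta x t : 0 < t -> vanish_out a b zeta ->
  vanish_out (x + t * a) (x + t * b) (rescale zeta x t).
Proof.
move=> t0 z0 y yab; apply: z0; rewrite ltr_pdivrMr// ltr_pdivlMr//.
by rewrite ltrBlDl ltrBrDl (mulrC a) (mulrC b).
Qed.

Lemma rescale_testf a b zeta x t : 0 < t -> testf a b zeta ->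
  testf (x + t * a) (x + t * b) (rescale zeta x t).
Proof.
by move=> t0 [sz z0]; split; [exact: rescale_smooth|exact: rescale_vanish_out].
Qed.

Lemma mean_is_derive u a b zeta x t : 0 < t -> testf a b zeta ->
  is_derive x (1 : R) (fun x => mean u zeta x t) (- t^-1 * mean u zeta^`()%classic x t).
Proof.
move=> t0 tz; have [sz z0] := tz.
have tz' := testf_deriv tz.
have -> : - t^-1 * mean u zeta^`()%classic x t =
    t^-1 * u (fun y => - t^-1 * rescale zeta^`()%classic x t y).
  rewrite (DprimeZ u _ (rescale_testf x t0 tz')) /mean; ring.
apply: is_deriveZf.
apply: (@Dprime_is_derive _ u (fun x => rescale zeta x t)
  (fun y => - t^-1 * rescale zeta^`()%classic x t y)
  (x - 1 + t * a) (x + 1 + t * b) x 1).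
- exact: ltr01.
- move=> h; rewrite ltr_norml => /andP[h1 h2].
  by apply: testf_sub (rescale_testf (x + h) t0 tz); lra.
- by apply: testfZ; apply: testf_sub (rescale_testf x t0 tz'); lra.
move=> m; have [M M0 hM] := @derivn_bounded R a b zeta m.+2 sz z0.
exists (t^-1 ^+ m * t^-1 ^+ 2 * M) => h y h1.
rewrite !derive1n_rescale//.
have s1 : smooth (rescale zeta^`()%classic x t).
  by apply: rescale_smooth; exact: smooth_deriv.
have -> : (fun y => - t^-1 * rescale zeta^`()%classic x t y)^`(m)%classic y =
    - t^-1 * (t^-1 ^+ m * zeta^`(m.+1)%classic ((y - x) / t)).
  rewrite (derive1nZ _ _ s1) derive1n_rescale; last exact: smooth_deriv.
  by rewrite derive1Sn.
(* [E k] is the [k]-th derivative with respect to the centre [w] of the [m]-th derivative of the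
   rescaled kernel, so the Taylor estimate applies to [E 0], [E 1], [E 2]. *)
pose E k w := t^-1 ^+ m * (- t^-1) ^+ k * zeta^`(m + k)%classic ((y - w) / t).
have dE k w : is_derive w (1 : R) (E k) (E k.+1 w).
  have -> : E k = (fun w => (t^-1 ^+ m * (- t^-1) ^+ k) *
      zeta^`(m + k)%classic (- t^-1 * w + y / t)).
    by apply/funext => v; rewrite /E; congr (_ * zeta^`(_)%classic _); ring.
  have -> : E k.+1 w = (t^-1 ^+ m * (- t^-1) ^+ k) *
      (- t^-1 * zeta^`((m + k).+1)%classic (- t^-1 * w + y / t)).
    rewrite /E addnS exprSr !mulrA.
    by congr (_ * zeta^`(_)%classic _); ring.
  by apply/is_deriveZf/is_derive_affine; exact: smooth_derivn_is_derive.
have := @taylor2_le R (E 0%N) (E 1%N) (E 2%N) (t^-1 ^+ m * t^-1 ^+ 2 * M) 1 x h h1.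
rewrite /E expr0 !mulr1 addn0 addn1 expr1 => T.
have -> : - t^-1 * (t^-1 ^+ m * zeta^`(m.+1)%classic ((y - x) / t)) =
  t^-1 ^+ m * - t^-1 * zeta^`(m.+1)%classic ((y - x) / t) by ring.
apply: T.
- by move=> z _; have := dE 0%N z; rewrite /E expr0 !mulr1 addn0 addn1 expr1.
- by move=> z _; have := dE 1%N z; rewrite /E addn1 expr1.
move=> z _; rewrite !normrM !normrX normrN normfV (gtr0_norm t0) addn2.
have ti : 0 <= t^-1 by rewrite invr_ge0 ltW.
by apply: ler_wpM2l (hM _); apply: mulr_ge0; [exact: exprn_ge0|exact: mulr_ge0].
Qed.

Lemma mean_continuous u a b zeta t : 0 < t -> testf a b zeta ->
  continuous (fun x => mean u zeta x t).
Proof. by move=> t0 tz x; exact: is_derive1_continuous (mean_is_derive u x t0 tz). Qed.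

(* [s^-(m+1) dil m g (z / s)] is the derivative of [s^-m g (z / s)] in [s]. *)
Definition dil (m : nat) g : R -> R :=
  fun z => - (m%:R * g z + z * g^`()%classic z).

Lemma smooth_dil m g : smooth g -> smooth (dil m g).
Proof.
move=> sg; have -> : dil m g = (fun z => - m%:R * g z + -1 * (z * g^`()%classic z)).
  by apply/funext => z; rewrite /dil; ring.
apply: smooth_lin; first exact: sg.
apply: smoothZ; apply: smoothM; first exact: smooth_id.
exact: smooth_deriv.
Qed.

Lemma dil_is_derive m g z s : smooth g -> s != 0 ->
  is_derive s (1 : R) (fun s => s^-1 ^+ m * g (z / s)) (s^-1 ^+ m.+1 * dil m g (z / s)).
Proof.
move=> sg s0.
have dV : is_derive s (1 : R) (fun y : R => y^-1) (- s ^- 2).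
  apply: DeriveDef; first by apply: (@derivableV _ _ id).
  by rewrite (@deriveV _ _ id)// derive_id [LHS]mulr1.
have dm : is_derive s^-1 (1 : R) (fun y => y ^+ m) (m%:R * s^-1 ^+ m.-1).
  have h := is_deriveX m (is_derive_id s^-1 (1 : R)); rewrite exprfctE in h.
  by apply: (is_derive_eq h); rewrite [LHS]mulr1.
have dX := @is_derive1_comp _ (fun y => y ^+ m) (fun y => y^-1) s _ _ dm dV.
have dz : is_derive s (1 : R) (fun s => z * s^-1) (z * (- s ^- 2)).
  exact: is_deriveZf.
have dg := @is_derive1_comp _ g (fun s => z * s^-1) s _ _
   (smooth_is_derive _ sg) dz.
have h := is_deriveMf dX dg; apply: (is_derive_eq h).
rewrite /= /dil -exprVn.
case: m {dm dX h} => [|m]; last by rewrite !exprS /=; ring.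
by rewrite !expr0 /=; ring.
Qed.

(** Each derivative commuted past [z d/dz] raises the index by one; this matches the extra power of
    [1/s] that a derivative of a rescaled function carries. *)
Lemma derive1n_dil g m : smooth g ->
  (dil 0 g)^`(m)%classic = dil m g^`(m)%classic.
Proof.
move=> sg; elim: m => [//|m IH]; rewrite derive1nS IH; apply: derive1_funE => z.
have d0 := smooth_derivn_is_derive m z sg.
have d1 := smooth_derivn_is_derive m.+1 z sg.
have dz := is_deriveMf (is_derive_id z (1 : R)) d1.
have h := is_deriveN (is_derive_lin m%:R d0 dz).
by apply: (is_derive_eq h); rewrite /dil -!derive1nS -natr1 /=; ring.
Qed.

Lemma vanish_out_dil a b m g : vanish_out a b g -> vanish_out a b (dil m g).
Proof.
move=> g0 z zab; rewrite /dil g0// (vanish_out_deriv g0)//; ring.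
Qed.

Lemma vanish_out_dil0 a b g : vanish_out a b g^`()%classic -> vanish_out a b (dil 0 g).
Proof. by move=> g0 z zab; rewrite /dil g0//; ring. Qed.

(** Only the derivative of [zeta] has compact support, as for a smoothed Heaviside function. Two
    rescalings about the same centre take the same constant values far to the left and far to the
    right, so their difference is a test function. *)
Lemma rescaleB_testf B zeta x s r : smooth zeta -> 0 < B ->
  vanish_out (- B) B zeta^`()%classic -> 0 < s -> 0 < r ->
  testf (x - Num.max s r * B) (x + Num.max s r * B)
    (fun y => rescale zeta x s y - rescale zeta x r y).
Proof.
move=> sz B0 z0 s0 r0; split.
  by apply: smoothB; exact: rescale_smooth.
move=> y yB; apply/eqP; rewrite subr_eq0; apply/eqP.
rewrite /rescale; apply: (@is_derive0_eq _ zeta) => z zI.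
suff zB : (z < - B) || (B < z).
  by rewrite -(z0 z zB); exact: smooth_is_derive.
have [sM rM] : s <= Num.max s r /\ r <= Num.max s r by rewrite !le_max !lexx orbT.
have M0 := lt_le_trans s0 sM.
have W q : 0 < q -> q <= Num.max s r ->
    (y < x - Num.max s r * B -> (y - x) / q < - B) /\
    (x + Num.max s r * B < y -> B < (y - x) / q).
  move=> q0 qM; have qB : q * B <= Num.max s r * B by rewrite ler_wpM2r// ltW.
  by rewrite ltr_pdivrMr// ltr_pdivlMr//; split => h; lra.
have [W1 W2] := W s s0 sM; have [W3 W4] := W r r0 rM.
case/orP: yB => h; [have k1 := W1 h; have k2 := W3 h|have k1 := W2 h; have k2 := W4 h];
  case/orP: zI => /andP[z1 z2]; apply/orP; [left|left|right|right].
- exact: le_lt_trans z2 k2.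
- exact: le_lt_trans z2 k1.
- exact: lt_le_trans k1 z1.
- exact: lt_le_trans k2 z1.
Qed.

(** Subtracting the rescaling at the fixed scale [r] makes the argument a test function without
    changing the derivative in [s]. *)
Lemma rescale_is_derive u B zeta x s r : smooth zeta -> 0 < B ->
  vanish_out (- B) B zeta^`()%classic -> 0 < s -> 0 < r ->
  is_derive s (1 : R) (fun s => u (fun y => rescale zeta x s y - rescale zeta x r y))
    (mean u (dil 0 zeta) x s).
Proof.
move=> sz B0 z0 s0 r0.
have td : testf (- B) B (dil 0 zeta).
  by split; [exact: smooth_dil|exact: vanish_out_dil0].
rewrite /mean -(DprimeZ u _ (rescale_testf x s0 td)).
pose M := Num.max (2 * s) r.
have sr0 : 0 < s / 2 by rewrite divr_gt0.
apply: (@Dprime_is_derive _ u (fun s y => rescale zeta x s y - rescale zeta x r y)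
  (fun y => s^-1 * rescale (dil 0 zeta) x s y) (x - M * B) (x + M * B) s (s / 2)).
- exact: sr0.
- move=> h; rewrite ltr_norml => /andP[h1 h2].
  have sh0 : 0 < s + h by lra.
  have le : Num.max (s + h) r * B <= M * B.
    rewrite ler_wpM2r//; first exact: ltW.
    rewrite /M ge_max !le_max lexx orbT andbT; apply/orP; left; lra.
  by apply: testf_sub (rescaleB_testf x sz B0 z0 sh0 r0); lra.
- have le : s * B <= M * B.
    rewrite ler_wpM2r//; first exact: ltW.
    by rewrite /M le_max; apply/orP; left; lra.
  by apply: testfZ; apply: testf_sub (rescale_testf x s0 td); lra.
move=> m.
(* The second derivative in the scale has compact support even for [m = 0], where [zeta] itself may
   not: [dil 0] involves only the derivative of [zeta]. *)
have v2 : vanish_out (- B) B (dil m.+1 (dil m zeta^`(m)%classic)).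
  apply: vanish_out_dil; case: m => [|m]; first exact: vanish_out_dil0.
  by apply: vanish_out_dil; rewrite derive1Sn; exact: vanish_out_derivn.
have [C C0 hC] : exists2 M : R, 0 <= M & forall x, `|dil m.+1 (dil m zeta^`(m)%classic) x| <= M.
  apply: vanish_out_bounded v2; apply/smooth_continuous/smooth_dil/smooth_dil.
  exact: smooth_derivn.
(* Scales within [s / 2] of [s] have inverse at most [2 / s]. *)
exists ((2 / s) ^+ m.+2 * C) => h y hs.
have DB w : (fun y => rescale zeta x w y - rescale zeta x r y)^`(m)%classic y =
   w^-1 ^+ m * zeta^`(m)%classic ((y - x) / w) -
   r^-1 ^+ m * zeta^`(m)%classic ((y - x) / r).
  have -> : (fun y => rescale zeta x w y - rescale zeta x r y) =
    (fun y => -1 * rescale zeta x r y + rescale zeta x w y).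
    by apply/funext => v; ring.
  rewrite derive1n_lin; [|exact: rescale_smooth..].
  by rewrite !derive1n_rescale//; ring.
rewrite !DB.
have -> : (fun y0 => s^-1 * rescale (dil 0 zeta) x s y0)^`(m)%classic y =
    s^-1 ^+ m.+1 * dil m zeta^`(m)%classic ((y - x) / s).
  have st : smooth (dil 0 zeta) by exact: smooth_dil.
  rewrite derive1nZ; last exact: rescale_smooth.
  by rewrite derive1n_rescale// derive1n_dil// exprS -mulrA.
have H := @taylor2_le R (fun w => w^-1 ^+ m * zeta^`(m)%classic ((y - x) / w))
  (fun w => w^-1 ^+ m.+1 * dil m zeta^`(m)%classic ((y - x) / w))
  (fun w => w^-1 ^+ m.+2 * dil m.+1 (dil m zeta^`(m)%classic) ((y - x) / w))
  ((2 / s) ^+ m.+2 * C) (s / 2) s h hs.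
rewrite [X in `|X - _|](_ : _ = (s + h)^-1 ^+ m * zeta^`(m)%classic ((y - x) / (s + h)) -
   s^-1 ^+ m * zeta^`(m)%classic ((y - x) / s)); last by ring.
have pos z : `|z - s| < s / 2 -> s / 2 < z by rewrite ltr_norml => /andP[h1 h2]; lra.
apply: H.
- move=> z /pos zs; apply: dil_is_derive; first exact: smooth_derivn.
  by rewrite gt_eqF//; lra.
- move=> z /pos zs; apply: dil_is_derive; first by apply: smooth_dil; exact: smooth_derivn.
  by rewrite gt_eqF//; lra.
move=> z /pos zs; have zp : 0 < z by lra.
rewrite normrM ler_pM// normrX normfV (gtr0_norm zp) lerXn2r// ?nnegrE.
- by rewrite invr_ge0 ltW.
- by rewrite divr_ge0// ltW.
- by rewrite -[2 / s]invrK lef_pV2 ?posrE// invf_div// ltW.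
Qed.

End rescaling.

(** * Distributions under the integral sign *)

Section mollification.
Variable R : realType.
Implicit Types (f g zeta : R -> R) (a b c d x y h t s B p q : R) (u : Dprime R).

Lemma lipschitz_continuous f (L : R) :
  (forall x y, `|f x - f y| <= L * `|x - y|) -> continuous f.
Proof.
move=> hL x; apply/cvgrPdist_le => e e0.
have L0 : 0 < `|L| + 1 by rewrite ltr_pwDr.
near=> y; apply: le_trans (hL x y) _.
apply: le_trans (_ : (`|L| + 1) * `|x - y| <= _).
  by rewrite ler_wpM2r// (le_trans (ler_norm _))// lerDl.
rewrite -ler_pdivlMl// mulrC; near: y.
have := @cvgrPdist_le R R^o; move=> /(_ _ (nbhs x) _ id x).
move=> [+ _] => /(_ (@cvg_id _ _)); apply.
by rewrite divr_gt0.
Unshelve. all: by end_near. Qed.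

Lemma Int_norm_le_bounded f p q (M : R) : continuous f ->
  (forall x, `|f x| <= M) -> `|Int p q f| <= M * `|q - p|.
Proof.
move=> cf hM; apply: (@MVT_le _ _ f) => z _; last exact: hM.
exact: primitiveP.
Qed.

Lemma testf_bounded_derivn a b f m : testf a b f ->
  exists2 M : R, 0 <= M & forall x, `|f^`(m)%classic x| <= M.
Proof. by case; exact: derivn_bounded. Qed.

Variables (P Q : R -> R) (a b a' b' c d A B : R).
Hypotheses (tP : testf a b P) (tQ : testf a' b' Q).
Hypothesis vQ : forall x, a <= x <= b -> vanish_out A B (fun y => Q (c * y + d * x)).

(** The [m]-th derivative in [y] of the kernel [P x * Q (c y + d x)]. Free coefficients [c] and [d]
    cover both forms of a convolution: translating the mollifier or translating the test
    function. *)
Let k m x y := P x * (c ^+ m * Q^`(m)%classic (c * y + d * x)).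

Let sP : smooth P. Proof. by case: tP. Qed.
Let sQ : smooth Q. Proof. by case: tQ. Qed.

Let k_derive_y m x y : is_derive y (1 : R) (k m x) (k m.+1 x y).
Proof.
rewrite /k exprSr -[in X in is_derive _ _ _ X]mulrA.
apply/is_deriveZf/is_deriveZf.
by apply: is_derive_affine; exact: smooth_derivn_is_derive.
Qed.

Let k_derive_x m x y : is_derive x (1 : R) (fun x => k m x y)
  (P x * (c ^+ m * (d * Q^`(m.+1)%classic (d * x + c * y))) +
   P^`()%classic x * (c ^+ m * Q^`(m)%classic (d * x + c * y))).
Proof.
rewrite /k; have -> : (fun x => P x * (c ^+ m * Q^`(m)%classic (c * y + d * x))) =
   (fun x => P x * (c ^+ m * Q^`(m)%classic (d * x + c * y))).
  by apply/funext => z; rewrite (addrC (c * y)).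
have h : is_derive x (1 : R) (fun x => c ^+ m * Q^`(m)%classic (d * x + c * y))
    (c ^+ m * (d * Q^`(m.+1)%classic (d * x + c * y))).
  by apply/is_deriveZf/is_derive_affine; exact: smooth_derivn_is_derive.
exact: is_deriveMf (smooth_is_derive x sP) h.
Qed.

Let k_cont m y : continuous (fun x => k m x y).
Proof. by move=> x; exact: is_derive1_continuous (k_derive_x m x y). Qed.

Let k_bounded m : exists2 M : R, 0 <= M & forall x y, `|k m x y| <= M.
Proof.
have [M0 M00 hM0] := testf_bounded_derivn 0 tP.
have [M1 M10 hM1] := testf_bounded_derivn m tQ.
exists (M0 * (`|c| ^+ m * M1)) => [|x y].
  by rewrite mulr_ge0// mulr_ge0// exprn_ge0.
rewrite /k normrM normrM normrX; apply: ler_pM => //.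
by apply: ler_wpM2l; [exact: exprn_ge0|exact: hM1].
Qed.

Let k_lip m : exists2 L : R, 0 <= L &
  forall x x' y, `|k m x y - k m x' y| <= L * `|x - x'|.
Proof.
have [M0 M00 hM0] := testf_bounded_derivn 0 tP.
have [M0' M00' hM0'] := testf_bounded_derivn 1 tP.
have [M1 M10 hM1] := testf_bounded_derivn m tQ.
have [M1' M10' hM1'] := testf_bounded_derivn m.+1 tQ.
exists (M0 * (`|c| ^+ m * (`|d| * M1')) + M0' * (`|c| ^+ m * M1)).
  by rewrite addr_ge0// mulr_ge0// mulr_ge0// ?exprn_ge0// mulr_ge0.
move=> x x' y; apply: (@MVT_le _ (fun x => k m x y)) => z _; first exact: k_derive_x.
have cm : 0 <= `|c| ^+ m by exact: exprn_ge0.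
apply: le_trans (ler_normD _ _) _; rewrite !normrM !normrX; apply: lerD.
  apply: ler_pM => //.
  by apply: ler_wpM2l => //; apply: ler_wpM2l => //; exact: hM1'.
apply: ler_pM => //; first exact: (hM0' z).
by apply: ler_wpM2l => //; exact: hM1.
Qed.

Let th p q : R -> R := fun y => Int p q (fun x => P x * Q (c * y + d * x)).

Let thE p q : th p q = (fun y => Int p q (fun x => k 0 x y)).
Proof.
by apply/funext => y; rewrite /th /k; under [in RHS]eq_fun do rewrite expr0 mul1r.
Qed.

Let Int_k_derive p q m y : is_derive y (1 : R)
  (fun y => Int p q (fun x => k m x y)) (Int p q (fun x => k m.+1 x y)).
Proof.
have [M M0 hM] := k_bounded m.+2.
apply: (@is_derive_quadratic _ _ _ _ 1 (M * `|q - p|)); first exact: ltr01.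
move=> h h1.
have -> : Int p q (fun x => k m x (y + h)) - Int p q (fun x => k m x y) -
    h * Int p q (fun x => k m.+1 x y) =
    Int p q (fun x => k m x (y + h) - k m x y - h * k m.+1 x y).
  rewrite IntB; [|by move=> x; apply: cvgB; exact: k_cont|].
    by rewrite IntB ?IntZ//; exact: k_cont.
  by apply: continuousMf; [exact: cst_continuous|exact: k_cont].
rewrite mulrAC; apply: Int_norm_le_bounded.
  move=> x; apply: cvgB; first by apply: cvgB; exact: k_cont.
  by apply: cvgM; [exact: cvg_cst|exact: k_cont].
move=> x; apply: (@taylor2_le _ (k m x) (k m.+1 x) (k m.+2 x) M 1 y h h1) => z _.
- exact: k_derive_y.
- exact: k_derive_y.
- exact: hM.
Qed.

Lemma derive1n_Int_kernel p q m :
  (fun y => Int p q (fun x => P x * Q (c * y + d * x)))^`(m)%classic =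
  (fun y => Int p q (fun x => P x * (c ^+ m * Q^`(m)%classic (c * y + d * x)))).
Proof.
rewrite -/(th p q) thE; elim: m => [//|m IH].
rewrite derive1nS IH; apply: derive1_funE => y; exact: Int_k_derive.
Qed.

Lemma testf_Int_kernel p q :
  testf A B (fun y => Int p q (fun x => P x * Q (c * y + d * x))).
Proof.
split.
  move=> m y; rewrite derive1n_Int_kernel; have := Int_k_derive p q m y => ?.
  exact: ex_derive.
move=> y yAB; have -> : (fun x => P x * Q (c * y + d * x)) = (fun=> 0).
  apply/funext => x; have [xab|] := boolP (a <= x <= b).
    by rewrite (vQ xab yAB) mulr0.
  by rewrite negb_and -!ltNge; case: tP => _ v /v ->; rewrite mul0r.
by rewrite Int_cst mul0r.
Qed.

Let testf_k x : testf A B (fun y => P x * Q (c * y + d * x)).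
Proof.
split; first by apply: smoothZ; exact: smooth_affine.
move=> y yAB; have [xab|] := boolP (a <= x <= b).
  by rewrite (vQ xab yAB) mulr0.
by rewrite negb_and -!ltNge; case: tP => _ v /v ->; rewrite mul0r.
Qed.

Let derive1n_k x m y : (fun y => P x * Q (c * y + d * x))^`(m)%classic y = k m x y.
Proof.
have sa : smooth (fun y => Q (c * y + d * x)) by apply: smooth_affine; exact: sQ.
by rewrite (derive1nZ _ _ sa) derive1n_affine.
Qed.

Let u_k_continuous u : continuous (fun x => u (fun y => P x * Q (c * y + d * x))).
Proof.
have [D [N [D0 hD]]] := Dprime_bound u A B.
have /choice[L hL] : forall m, exists L : R, 0 <= L /\
  forall x x' y, `|k m x y - k m x' y| <= L * `|x - x'|.
  by move=> m; have [L L0 hL] := k_lip m; exists L.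
apply: (@lipschitz_continuous _ (D * \sum_(m < N.+1) L m)) => x x'.
rewrite -(DprimeB u (testf_k x) (testf_k x')) -mulrA; apply: hD.
  by apply: testfB; exact: testf_k.
move=> m mN y.
have -> : (fun y => P x * Q (c * y + d * x) - P x' * Q (c * y + d * x')) =
    (fun y => -1 * (P x' * Q (c * y + d * x')) + P x * Q (c * y + d * x)).
  by apply/funext => z; ring.
rewrite derive1n_lin; [|by case: (testf_k x')|by case: (testf_k x)].
rewrite !derive1n_k mulN1r addrC; have [L0 L1] := hL m.
apply: le_trans (L1 x x' y) _; rewrite ler_wpM2r//.
rewrite (bigD1 (Ordinal (mN : (m < N.+1)%N)))//= lerDl.
by apply: sumr_ge0 => i _; case: (hL i).
Qed.

(** A Fubini rule obtained without Riemann sums: as functions of the upper limit both sides have the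
    same derivative, and both vanish at [p]. *)
Lemma Dprime_Int_kernel u p q :
  u (fun y => Int p q (fun x => P x * Q (c * y + d * x))) =
  Int p q (fun x => u (fun y => P x * Q (c * y + d * x))).
Proof.
have H s : is_derive s (1 : R) (fun s => u (th p s)) (u (fun y => P s * Q (c * y + d * s))).
  apply: (@Dprime_is_derive _ u (fun s => th p s)
    (fun y => P s * Q (c * y + d * s)) A B s 1); first exact: ltr01.
  - by move=> h _; exact: testf_Int_kernel.
  - exact: testf_k.
  move=> m; have [L L0 hL] := k_lip m; exists L => h y _.
  rewrite derive1n_k !derive1n_Int_kernel.
  have dI z : is_derive z (1 : R) (fun z => Int p z (fun x => k m x y)) (k m z y).
    by apply: Int_is_derive; exact: k_cont.
  have := @MVT_le _ (fun z => Int p z (fun x => k m x y) - k m s y * z)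
    (fun z => k m z y - k m s y) (L * `|h|) s (s + h).
  rewrite (_ : s + h - s = h); last by ring.
  rewrite expr2 => T.
  rewrite [X in `|X|](_ : _ = Int p (s + h) (fun x => k m x y) - k m s y * (s + h) -
     (Int p s (fun x => k m x y) - k m s y * s)); last by rewrite /k; ring.
  rewrite -mulrA in T; apply: T => z zI.
    have e := is_deriveB (dI z) (is_deriveZf (k m s y) (is_derive_id z (1 : R))).
    by apply: (is_derive_eq e); rewrite mulr1.
  apply: le_trans (hL z s y) _; rewrite ler_wpM2l//.
  case/orP: zI => /andP[z1 z2].
    by rewrite ger0_norm ?subr_ge0// (le_trans _ (ler_norm h))// lerBlDl.
  by rewrite ler0_norm ?subr_le0// -normrN (le_trans _ (ler_norm (- h)))//; lra.
rewrite (IntE p q (@u_k_continuous u) H).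
have -> : th p p = (fun=> 0) by apply/funext => y; rewrite /th Intxx.
by rewrite Dprime0 subr0.
Qed.

End mollification.

Section mollify.
Variable R : realType.
Variables (u : Dprime R) (w psi : R -> R) (a b B : R).
Hypotheses (B0 : 0 < B) (ab : a <= b).
Hypotheses (tw : testf (- B) B w) (tpsi : testf a b psi).
Implicit Types (x y z t e : R).

Let cw : continuous w. Proof. by apply: smooth_continuous; case: tw. Qed.
Let cpsi : continuous psi. Proof. by apply: smooth_continuous; case: tpsi. Qed.

Let conv_swap t y : 0 < t ->
  Int a b (fun x => (t^-1 * psi x) * w (t^-1 * y + (- t^-1) * x)) =
  Int (- B) B (fun z => w z * psi (1 * y + (- t) * z)).
Proof.
move=> t0.
(* [Z] is so large that the range |z| <= Z contains [-B, B] and its image under [x = y - t z]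
   contains [a, b]; both integrals are extended by zero to ranges that the substitution
   exchanges. *)
have [Z [BZ yZa yZb]] : exists Z, [/\ B <= Z, y - t * Z <= a & b <= y + t * Z].
  exists (Num.max B ((`|y| + `|a| + `|b|) / t)).
  have h : (`|y| + `|a| + `|b|) <= t * Num.max B ((`|y| + `|a| + `|b|) / t).
    by rewrite mulrC -ler_pdivrMr// le_max lexx orbT.
  rewrite le_max lexx; split => //.
    have := ler_norm y; have := ler_norm (- a); rewrite normrN; have := normr_ge0 b; lra.
  have := ler_norm (- y); have := ler_norm b; rewrite normrN; have := normr_ge0 a; lra.
pose g x := psi x * w (t^-1 * y + (- t^-1) * x).
have cg : continuous g.
  apply: continuousMf => //.
  have := @continuous_affine R w (- t^-1) (t^-1 * y) cw.
  by under eq_fun do rewrite addrC.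
under eq_fun do rewrite -mulrA; rewrite IntZ//.
rewrite -(@Int_widen _ g a b (y - t * Z) (y + t * Z))//; last first.
  by move=> x xab; rewrite /g; case: tpsi => _ /(_ x xab) ->; rewrite mul0r.
have := @Int_affine R g Z (- Z) (- t) y cg.
rewrite (_ : - t * Z + y = y - t * Z); last by ring.
rewrite (_ : - t * - Z + y = y + t * Z); last by ring.
move=> <-.
have -> : (fun z => g (- t * z + y)) = (fun z => w z * psi (1 * y + (- t) * z)).
  apply/funext => z; rewrite /g mulrC; congr (w _ * psi _); last by ring.
  by field; rewrite gt_eqF.
have cg2 : continuous (fun z => w z * psi (1 * y + (- t) * z)).
  apply: continuousMf => //.
  have := @continuous_affine R psi (- t) (1 * y) cpsi.
  by under eq_fun do rewrite addrC.
rewrite -(@Int_widen _ (fun z => w z * psi (1 * y + (- t) * z)) (- B) B (- Z) Z) ?lerN2//.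
- rewrite /Int; field; by rewrite gt_eqF.
- by rewrite ltW// (lt_trans _ B0)// oppr_lt0.
- by move=> z zB; case: tw => _ /(_ z zB) ->; rewrite mul0r.
Qed.

Let tP t : testf a b (fun x => t^-1 * psi x). Proof. exact: testfZ. Qed.

Let vw t x : 0 < t -> a <= x <= b ->
  vanish_out (a - t * B) (b + t * B) (fun y => w (t^-1 * y + (- t^-1) * x)).
Proof.
move=> t0 /andP[ax xb] y yab; case: tw => _; apply.
rewrite mulNr -mulrBr mulrC ltr_pdivrMr// ltr_pdivlMr//.
by case/orP: yab => h; apply/orP; [left|right]; lra.
Qed.

Let vpsi t z : 0 < t -> - B <= z <= B ->
  vanish_out (a - t * B) (b + t * B) (fun y => psi (1 * y + (- t) * z)).
Proof.
move=> t0 /andP[Bz zB] y yab; case: tpsi => _; apply.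
have h1 : t * z <= t * B by rewrite ler_wpM2l// ltW.
have h2 : t * (- B) <= t * z by rewrite ler_wpM2l// ltW.
by case/orP: yab => h; apply/orP; [left|right]; lra.
Qed.

Let conv t := fun y => Int (- B) B (fun z => w z * psi (1 * y + (- t) * z)).

Let Int_meanE t : 0 < t ->
  Int a b (fun x => psi x * mean u w x t) = u (conv t).
Proof.
move=> t0.
have -> : conv t = fun y => Int a b (fun x => (t^-1 * psi x) * w (t^-1 * y + (- t^-1) * x)).
  by apply/funext => y; rewrite conv_swap.
rewrite (Dprime_Int_kernel (tP t) tw (fun x => @vw t x t0)).
congr (Int a b _); apply/funext => x.
have -> : (fun y => t^-1 * psi x * w (t^-1 * y + (- t^-1) * x)) =
    (fun y => (t^-1 * psi x) * rescale w x t y).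
  by apply/funext => y; rewrite rescaleE mulNr mulNr (mulrC x).
by rewrite (DprimeZ u _ (rescale_testf x t0 tw)) /mean; ring.
Qed.

(** Means are mollifications: integrating them against [psi] is applying [u] to [conv t], the
    convolution of [psi] with the kernel at scale [t]. On finitely many derivatives this differs
    from the integral of [w] times [psi] by O(t). *)
Lemma Int_mean_cvg e : 0 < e -> exists2 d : R, 0 < d & forall t, 0 < t < d ->
  `|Int a b (fun x => psi x * mean u w x t) - Int (- B) B w * u psi| <= e.
Proof.
move=> e0.
have [D [N [D0 hD]]] := Dprime_bound u (a - B) (b + B).
have [Mw Mw0 hMw] := testf_bounded_derivn 0 tw.
have /choice[M hM] : forall m, exists M : R, 0 <= M /\ forall x, `|psi^`(m)%classic x| <= M.
  by move=> m; have [M M0 h] := testf_bounded_derivn m tpsi; exists M.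
pose K := \sum_(m < N.+1) (Mw * (M m.+1 * B) * (2 * B)).
have K0 : 0 <= K.
  apply: sumr_ge0 => i _; have [h _] := hM i.+1.
  by rewrite !mulr_ge0// ltW.
have DK : 0 < D * K + 1 by rewrite ltr_wpDl// mulr_ge0.
exists (Num.min 1 (e / (D * K + 1))); first by rewrite lt_min ltr01 divr_gt0.
move=> t /andP[t0]; rewrite lt_min => /andP[t1 te].
rewrite Int_meanE//.
have tc : testf (a - B) (b + B) (conv t).
  have := testf_Int_kernel tw tpsi (fun z => @vpsi t z t0) (- B) B.
  have tB : t * B <= B by rewrite ger_pMl// ltW.
  by apply: testf_sub; lra.
have tp : testf (a - B) (b + B) psi by apply: testf_sub tpsi; have := B0; lra.
rewrite -(DprimeZ u _ tp) -(DprimeB u tc (testfZ _ tp)).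
apply: le_trans (_ : D * (t * K) <= _); last first.
  have : t * (D * K + 1) <= e by rewrite -ler_pdivlMr// ltW.
  by move=> h; apply: le_trans h; lra.
apply: hD; first by apply: testfB => //; exact: testfZ.
move=> m mN y.
have E : (fun x => conv t x - Int (- B) B w * psi x) =
    (fun x => - Int (- B) B w * psi x + conv t x).
  by apply/funext => x; ring.
rewrite E derive1n_lin; [|by case: tp|by case: tc].
rewrite (derive1n_Int_kernel 1 (- t) tw tpsi) expr1n.
have cp : continuous (psi^`(m)%classic).
  by apply/smooth_continuous/smooth_derivn; case: tpsi.
have cpa : continuous (fun z => psi^`(m)%classic (1 * y + (- t) * z)).
  have := @continuous_affine R (psi^`(m)%classic) (- t) (1 * y) cp.
  by under eq_fun do rewrite addrC.
have -> : - Int (- B) B w * psi^`(m)%classic y +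
    Int (- B) B (fun x => w x * (1 * psi^`(m)%classic (1 * y + (- t) * x))) =
    Int (- B) B (fun z => w z * (psi^`(m)%classic (1 * y + (- t) * z) - psi^`(m)%classic y)).
  have -> : (fun z => w z * (psi^`(m)%classic (1 * y + (- t) * z) - psi^`(m)%classic y))
     = (fun z => - psi^`(m)%classic y * w z +
          w z * psi^`(m)%classic (1 * y + (- t) * z)).
    by apply/funext => z; ring.
  rewrite Int_lin//; last exact: continuousMf.
  by under eq_fun do rewrite mul1r; ring.
have [M0 hM1] := hM m.+1.
have BB : - B <= B by have := B0; lra.
apply: le_trans (_ : (Mw * (M m.+1 * (t * B))) * (B - - B) <= _).
  apply: Int_norm_le => //.
    apply: continuousMf => //.
    by move=> z; apply: cvgB; [exact: cpa|exact: cvg_cst].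
  move=> z /andP[z1 z2]; rewrite normrM.
  apply: ler_pM => //.
  apply: le_trans (@MVT_le _ _ (psi^`(m.+1)%classic) (M m.+1) y (1 * y + (- t) * z) _ _) _.
  - by move=> v _; apply: smooth_derivn_is_derive; case: tpsi.
  - by move=> v _; exact: hM1.
  rewrite (_ : 1 * y + (- t) * z - y = t * (- z)); last by ring.
  rewrite normrM normrN (gtr0_norm t0) ler_wpM2l// ler_wpM2l ?(ltW t0)//.
  by rewrite ler_norml z1 z2.
rewrite (_ : B - - B = 2 * B); last by ring.
rewrite (_ : Mw * (M m.+1 * (t * B)) * (2 * B) = t * (Mw * (M m.+1 * B) * (2 * B))); last by ring.
rewrite ler_wpM2l ?(ltW t0)// /K (bigD1 (Ordinal (mN : (m < N.+1)%N)))//= lerDl.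
apply: sumr_ge0 => i _; have [h _] := hM i.+1.
by rewrite !mulr_ge0// ltW.
Qed.

End mollify.

(** * The kernels *)

Section kernels.
Variable R : realType.
Implicit Types (f g : R -> R) (a b c x y z t : R).

(** The bridge from the Lebesgue integrals of the definitions to [Int]. *)
Lemma integral_Int a b f : a < b -> continuous f -> vanish_out a b f ->
  (\int[@lebesgue_measure R]_x (f x)%:E = (Int a b f)%:E)%E.
Proof.
move=> ab cf f0.
have -> : (\int[@lebesgue_measure R]_x (f x)%:E =
    \int[@lebesgue_measure R]_(x in `[a, b]) (f x)%:E)%E.
  rewrite [RHS]integral_mkcond; apply: eq_integral => x _.
  rewrite /patch; case: ifPn => //; rewrite notin_setE /= in_itv/= => /negP.
  by rewrite negb_and -!ltNge => /f0 ->.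
rewrite (@continuous_FTC2 _ f (primitive f) a b)//.
- exact: continuous_subspaceT.
- split=> [x _||].
  + by have := primitiveP cf x => ?; exact: ex_derive.
  + apply: cvg_at_right_filter; exact: is_derive1_continuous (primitiveP cf a).
  + apply: cvg_at_left_filter; exact: is_derive1_continuous (primitiveP cf b).
- by move=> x _; exact: is_derive1E (primitiveP cf x).
Qed.

Lemma Rintegral_Int a b f : a < b -> continuous f -> vanish_out a b f ->
  (\int[@lebesgue_measure R]_x f x = Int a b f)%R.
Proof. by move=> ab cf f0; rewrite /Rintegral (integral_Int ab cf f0). Qed.

Lemma bump_continuous : continuous (@bump R).
Proof. by apply: smooth_continuous; exact: bump_smooth. Qed.

Lemma bump0 x : (x <= -1) || (1 <= x) -> bump x = 0.
Proof.
case/orP => h; rewrite /bump /flat.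
  by rewrite ltNge -lerBrDr sub0r h/= mul0r.
by rewrite (ltNge 0 (1 - x)) subr_le0 h/= mulr0.
Qed.

Lemma Int_gt0 g a b c d : continuous g -> a <= c -> c < d -> d <= b ->
  (forall x, a <= x <= b -> 0 <= g x) -> (forall x, c < x < d -> 0 < g x) ->
  0 < Int a b g.
Proof.
move=> cg ac cd db g0 gp.
rewrite -(Int_split g a c b) -(Int_split g c d b).
have h1 : 0 <= Int a c g.
  apply: Int_ge0 => // x /andP[ax xc]; apply: g0; rewrite ax /=; lra.
have h2 : 0 <= Int d b g.
  apply: Int_ge0 => // x /andP[dx xb]; apply: g0; rewrite xb andbT; lra.
have h3 : 0 < Int c d g; last by lra.
rewrite /Int.
have [||z zcd ->] := @MVT R (primitive g) g c d cd.
- by move=> z _; exact: primitiveP.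
- by apply: continuous_subspaceT => z; exact: is_derive1_continuous (primitiveP cg z).
by rewrite mulr_gt0 ?subr_gt0// gp//; move: zcd; rewrite in_itv.
Qed.

Lemma Int_bump_gt0 : 0 < Int (-1) 1 (@bump R).
Proof.
apply: (@Int_gt0 _ _ _ (-1) 1); first exact: bump_continuous.
- by [].
- by lra.
- by [].
- by move=> x _; exact: bump_ge0.
- by move=> x /andP[x1 x2]; apply: bump_gt0; rewrite ltr_norml x1.
Qed.

Definition eta x : R := (Int (-1) 1 (@bump R))^-1 * bump x.

Lemma testf_eta : testf (-1) 1 eta.
Proof. by apply: testfZ; split; [exact: bump_smooth|exact: bump_out]. Qed.

Lemma eta_smooth : smooth eta. Proof. by case: testf_eta. Qed.

Lemma eta_continuous : continuous eta.
Proof. by apply: smooth_continuous; exact: eta_smooth. Qed.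

Lemma eta_ge0 x : 0 <= eta x.
Proof. by rewrite mulr_ge0 ?bump_ge0// invr_ge0 ltW// Int_bump_gt0. Qed.

Lemma eta0 x : (x <= -1) || (1 <= x) -> eta x = 0.
Proof. by move=> /bump0; rewrite /eta => ->; rewrite mulr0. Qed.

Lemma Int_eta : Int (-1) 1 eta = 1.
Proof.
rewrite /eta IntZ; last exact: bump_continuous.
by rewrite mulVf// gt_eqF// Int_bump_gt0.
Qed.

(** A smoothed Heaviside function. Differences of its rescalings are test functions whose
    derivatives are differences of rescaled [eta]; this is how positivity of [f] is converted into
    statements about [F]. *)
Definition step x : R := Int (-1) x eta.

Lemma step_is_derive x : is_derive x (1 : R) step (eta x).
Proof. exact: Int_is_derive eta_continuous. Qed.

Lemma step_smooth : smooth step.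
Proof. by apply: smooth_antiderivative step_is_derive _; exact: eta_smooth. Qed.

Lemma step0 x : x <= -1 -> step x = 0.
Proof.
move=> x1; rewrite /step; suff : Int x (-1) eta = 0.
  by rewrite /Int => /eqP; rewrite subr_eq0 => /eqP ->; rewrite subrr.
apply: Int_eq0 => //; first exact: eta_continuous.
by move=> z /andP[_ z1]; rewrite eta0// z1.
Qed.

Lemma step1 x : 1 <= x -> step x = 1.
Proof.
move=> x1; rewrite /step -(Int_split eta (-1) 1) Int_eta Int_eq0 ?addr0//.
  exact: eta_continuous.
by move=> z /andP[z1 _]; rewrite eta0// z1 orbT.
Qed.

Lemma step_homo x y : x <= y -> step x <= step y.
Proof.
move=> xy; apply: (@derive_ge0_le _ _ eta) => // z _; first exact: step_is_derive.
exact: eta_ge0.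
Qed.

Lemma step_ge0 x : 0 <= step x.
Proof.
have /orP[x1|x1] := le_total x (-1); first by rewrite step0.
by rewrite -(step0 (lexx (-1))); exact: step_homo.
Qed.

Lemma step_le1 x : step x <= 1.
Proof.
have /orP[x1|x1] := le_total 1 x; first by rewrite step1.
by rewrite -(step1 (lexx 1)); exact: step_homo.
Qed.

(** The second moment is normalised, and not the integral: by parts, the integral of [phi] is the
    second moment of [weight]. *)
Definition weight x : R := (Int (-1) 1 (fun z => z ^+ 2 * bump z))^-1 * bump x.

Let cz2 : continuous (fun z => z ^+ 2 * bump z : R).
Proof.
apply: continuousMf; last exact: bump_continuous.
exact: exprn_continuous.
Qed.

Lemma Int_z2bump_gt0 : 0 < Int (-1) 1 (fun z => z ^+ 2 * @bump R z).
Proof.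
apply: (@Int_gt0 _ _ _ (1 / 3) (2 / 3)) => //.
- by lra.
- by lra.
- by lra.
- by move=> x _; rewrite mulr_ge0 ?bump_ge0// sqr_ge0.
- move=> x /andP[x1 x2]; rewrite mulr_gt0 ?exprn_gt0//; first lra.
  by apply: bump_gt0; rewrite ltr_norml; apply/andP; split; lra.
Qed.

Lemma testf_weight : testf (-1) 1 weight.
Proof. by apply: testfZ; split; [exact: bump_smooth|exact: bump_out]. Qed.

Lemma weight_continuous : continuous weight.
Proof. by apply: smooth_continuous; case: testf_weight. Qed.

Lemma weight_ge0 x : 0 <= weight x.
Proof. by rewrite mulr_ge0 ?bump_ge0// invr_ge0 ltW// Int_z2bump_gt0. Qed.

Lemma weight0 x : (x <= -1) || (1 <= x) -> weight x = 0.
Proof. by move=> /bump0; rewrite /weight => ->; rewrite mulr0. Qed.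

Lemma weightN x : weight (- x) = weight x.
Proof. by rewrite /weight bumpN. Qed.

Lemma Int_z2weight : Int (-1) 1 (fun z => z ^+ 2 * weight z) = 1.
Proof.
rewrite /weight; under eq_fun do rewrite mulrCA.
by rewrite IntZ// mulVf// gt_eqF// Int_z2bump_gt0.
Qed.

Let c1 : continuous (fun z => - z * weight z).
Proof.
apply: continuousMf; last exact: weight_continuous.
by move=> z; apply: cvgN; exact: cvg_id.
Qed.

Let s1 : smooth (fun z => - z * weight z).
Proof.
apply: smoothM; last by case: testf_weight.
have := @smooth_id R => /(smoothZ (a := -1)); congr smooth.
by apply/funext => x; rewrite mulN1r.
Qed.

(** Evenness of [weight] makes its first moment vanish, so the primitive returns to 0 at 1 and has
    compact support; the sign of [- z * weight z] gives [phi >= 0] and the monotonicity required by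
    the class. *)
Definition phi x : R := Int (-1) x (fun z => - z * weight z).

Lemma phi_is_derive x : is_derive x (1 : R) phi (- x * weight x).
Proof. exact: Int_is_derive c1. Qed.

Lemma phi_deriv : phi^`()%classic = (fun z => - z * weight z).
Proof. exact: derive1_funE phi_is_derive. Qed.

Lemma phi_smooth : smooth phi.
Proof. exact: smooth_antiderivative phi_is_derive s1. Qed.

Let phi1 : phi 1 = 0.
Proof.
have := @Int_affine R (fun z => - z * weight z) (-1) 1 (-1) 0 c1.
have -> : (fun x => - (-1 * x + 0) * weight (-1 * x + 0)) =
          (fun z => -1 * (- z * weight z)).
  by apply/funext => z; rewrite addr0 mulN1r weightN; ring.
by rewrite IntZ// /phi /Int !mulN1r !addr0 !opprK; lra.
Qed.

Lemma Int_zweight : Int (-1) 1 (fun z => z * weight z) = 0.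
Proof.
have -> : (fun z => z * weight z) = (fun z => -1 * (- z * weight z)).
  by apply/funext => z; ring.
by rewrite IntZ// -/(phi 1) phi1 mulr0.
Qed.

Lemma testf_phi : testf (-1) 1 phi.
Proof.
split; first exact: phi_smooth.
move=> x /orP[x1|x1].
  rewrite /phi /Int -[_ - _]opprB -/(Int x (-1) (fun z => - z * weight z)).
  rewrite Int_eq0 ?oppr0//; first exact: ltW.
  by move=> z /andP[_ z1]; rewrite weight0 ?mulr0// z1.
rewrite /phi -(Int_split _ (-1) 1) -/(phi 1) phi1 add0r.
rewrite Int_eq0//; first exact: ltW.
by move=> z /andP[z1 _]; rewrite weight0 ?mulr0// z1 orbT.
Qed.

Lemma phi_ge0 x : 0 <= phi x.
Proof.
have [x1|x1] := boolP ((x < -1) || (1 < x)).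
  by case: testf_phi => _ ->.
move: x1; rewrite negb_or -!leNgt => /andP[x1 x2].
have /orP[x0|x0] := le_total x 0.
  apply: Int_ge0 => // z /andP[z1 z2]; rewrite mulr_ge0 ?weight_ge0//; lra.
have -> : phi x = Int x 1 (fun z => z * weight z).
  have -> : (fun z => z * weight z) = (fun z => -1 * (- z * weight z)).
    by apply/funext => z; ring.
  by rewrite IntZ//; have := phi1; rewrite /phi /Int; lra.
apply: Int_ge0 => // [|z /andP[z1 z2]]; last by rewrite mulr_ge0 ?weight_ge0//; lra.
by apply: continuousMf; [move=> z; exact: cvg_id|exact: weight_continuous].
Qed.

Lemma Int_phi : Int (-1) 1 phi = 1.
Proof.
have cphi : continuous phi by apply: smooth_continuous; exact: phi_smooth.
have := @Int_parts R phi (fun z => - z * weight z) id (fun=> 1) (-1) 1 c1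
  (fun x => @cvg_cst _ _ _ _ _) phi_is_derive (fun x => is_derive_id x (1 : R)).
have pm1 : phi (-1) = 0 by rewrite /phi Intxx.
have -> : (fun z => phi z * 1) = phi by apply/funext => z; rewrite mulr1.
rewrite phi1 pm1 !mul0r subr0 sub0r => ->.
have -> : (fun z => - z * weight z * id z) = (fun z => -1 * (z ^+ 2 * weight z)).
  by apply/funext => z /=; ring.
rewrite IntZ; first by rewrite Int_z2weight mulN1r opprK.
by apply: continuousMf; [exact: exprn_continuous|exact: weight_continuous].
Qed.

Lemma class_T1_phi : class_T1 phi.
Proof.
split; last first.
  move=> x; rewrite phi_deriv mulrA mulrN -expr2 mulNr oppr_le0.
  by rewrite mulr_ge0 ?sqr_ge0// weight_ge0.
split.
- exact: phi_smooth.
- exact: phi_ge0.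
- have cphi : continuous phi by apply: smooth_continuous; exact: phi_smooth.
  have lt : -1 < 1 :> R by lra.
  by case: testf_phi => _ vphi; rewrite (integral_Int lt cphi vphi) Int_phi.
(* The decay conditions hold with constant 0 from |x| = 2 on, outside the support. *)
exists (-2); first lra.
move=> m; exists 0, 2 => x x2; rewrite mul0r.
case: testf_phi => _ /(@vanish_out_derivn _ _ _ _ m) ->; first by rewrite normr0.
by move: x2; rewrite ler_normr => /orP[h|h]; apply/orP; [right|left]; lra.
Qed.

End kernels.

(** * Radial limits and local positivity *)

Section hypotheses.
Variable R : realType.
Implicit Types (f g zeta psi : R -> R) (a b c d x y z t e p q M C r : R) (u : Dprime R).

Lemma smooth_step_rescale x t : smooth (rescale (@step R) x t).
Proof. by apply: rescale_smooth; exact: step_smooth. Qed.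

Lemma cutoff_exists u : compactly_supported u -> exists chi, cutoff u chi.
Proof.
move=> [K cK uK]; have [M [Mr HM]] := compact_bounded cK.
have KM x : K x -> `|x| <= `|M| + 1.
  by move=> Kx; apply: (HM (`|M| + 1)) => //; rewrite (le_lt_trans (ler_norm _))// ltrDl.
pose L := `|M| + 2; have L0 : 0 < L by rewrite /L ltr_wpDl.
exists (fun y => step (1 * y + (L + 2)) * step (- 1 * y + (L + 2))).
split.
  apply: (@test_functionP _ (- (L + 3)) (L + 3)).
    by apply: smoothM; apply: smooth_affine; exact: step_smooth.
  by move=> y /orP[h|h]; [rewrite step0 ?mul0r|rewrite [X in _ * X]step0 ?mulr0]; lra.
exists K, [set y | - L < y < L]; split => //.
- by have := @itv_open _ R (- L) L; congr open; apply/seteqP; split => y /=; rewrite in_itv.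
- by move=> y /KM /=; rewrite ler_norml /L => /andP[h1 h2]; apply/andP; split; lra.
- by move=> y /= /andP[h1 h2]; rewrite !step1 ?mulr1//; lra.
Qed.

Lemma epairing_testf u psi a b : compactly_supported u -> testf a b psi ->
  epairing u psi = u psi.
Proof.
move=> cu tp; have [chi cchi] := cutoff_exists cu.
have [spsi _] := tp; rewrite (epairingE spsi cchi).
have [[schi _] [K [U [_ uK oU KU chiU]]]] := cchi.
have tcp : testf a b (fun x => chi x * psi x).
  by split; [exact: smoothM|apply: vanish_outMr; case: tp].
have td := testfB tp tcp.
have : u (fun x => psi x - chi x * psi x) = 0.
  apply: uK; first exact: testf_test td.
  apply: (@subset_trans _ (~` U)); last exact: subsetC.
  rewrite /supp; have /closure_id -> : closed (~` U) by exact: open_closedC.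
  by apply: closureS => x /= /[swap] Ux; rewrite chiU// mul1r subrr eqxx.
by rewrite (DprimeB u tp tcp) => /eqP; rewrite subr_eq0 => /eqP ->.
Qed.

Lemma phi_transform_mean u zeta a b x t : compactly_supported u ->
  testf a b zeta -> 0 < t -> phi_transform u zeta x t = mean u zeta x t.
Proof.
move=> cu tz t0; rewrite /phi_transform /mean; congr (_ * _).
exact: (epairing_testf cu (rescale_testf x t0 tz)).
Qed.

Lemma radial_upper_ge0 u zeta a b x e d : compactly_supported u ->
  testf a b zeta -> (0 <= radial_upper u zeta x)%E -> 0 < e -> 0 < d ->
  exists2 t, 0 < t < d & - e <= mean u zeta x t.
Proof.
move=> cu tz; rewrite /radial_upper limf_esupE => h e0 d0.
apply: contrapT => hn.
have : (ereal_sup ((fun t => (phi_transform u zeta x t)%:E) @` [set t : R | (0 < t < d)%R]) <= (- e)%:E)%E.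
  apply: ge_ereal_sup => _ [t /= td <-]; rewrite lee_fin leNgt; apply/negP => te.
  apply: hn; exists t => //; rewrite -(phi_transform_mean x cu tz); first exact: ltW.
  by case/andP: td.
apply/negP; rewrite -ltNge; apply: lt_le_trans (_ : (0 <= _)%E).
  by rewrite lte_fin oppr_lt0.
apply: le_trans h _; apply: ereal_inf_lbound; exists [set t : R | (0 < t < d)%R] => //=.
near=> t; apply/andP; split; near: t; [exact: nbhs_right_gt|exact: nbhs_right_lt].
Unshelve. all: by end_near. Qed.

(** Passing from the lower limit to actual values at small scales costs the summand 1. *)
Lemma radial_lower_bound u zeta a b x M : compactly_supported u ->
  testf a b zeta -> ((- M)%:E <= radial_lower u zeta x)%E ->
  exists2 d, 0 < d & forall t, 0 < t < d -> - M - 1 <= mean u zeta x t.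
Proof.
move=> cu tz; rewrite /radial_lower limf_einfE => h.
have : ((- M - 1)%:E < ereal_sup [set ereal_inf ((fun t => (phi_transform u zeta x t)%:E) @` V) | V in 0^'+])%E.
  by apply: lt_le_trans h; rewrite lte_fin ltrBlDr ltrDl.
move=> /ereal_sup_gt[_ [V V0 <-] hV].
have [d d0 dV] : exists2 d, 0 < d & forall t, 0 < t < d -> V t.
  move: V0 => [d /= d0 dV]; exists d => // t /andP[t0 td]; apply: dV => //=.
  by rewrite sub0r normrN gtr0_norm.
exists d => // t td; have t0 : 0 < t by case/andP: td.
rewrite -(phi_transform_mean x cu tz t0) -lee_fin.
apply: le_trans (ltW hV) _; apply: ereal_inf_lbound; exists t => //; exact: dV.
Qed.

Lemma point_value_mean u x gamma zeta a b e : has_point_value u x gamma -> a < b ->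
  testf a b zeta -> 0 < e -> exists2 d, 0 < d &
  forall t, 0 < t < d -> `|mean u zeta x t - gamma * Int a b zeta| <= e.
Proof.
move=> hv ab tz e0; have := hv _ (testf_test tz).
have [sz vz] := tz.
rewrite (Rintegral_Int ab (smooth_continuous sz) vz).
move=> /cvgrPdist_le /(_ e e0) [d /= d0 hd]; exists d => // t /andP[t0 td].
have := hd t; rewrite /= sub0r normrN (gtr0_norm t0) => /(_ td).
by rewrite gt_eqF// distrC /mean; exact.
Qed.

Definition bounded_below u C p q := forall psi, testf p q psi ->
  (forall x, 0 <= psi x) -> - C * Int p q psi <= u psi.

Definition nonneg_on u p q := forall psi, testf p q psi ->
  (forall x, 0 <= psi x) -> 0 <= u psi.

Lemma nonneg_on_sub u a b c d : a <= c -> d <= b -> nonneg_on u a b -> nonneg_on u c d.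
Proof. by move=> ac db h psi tp; apply: h; exact: testf_sub tp. Qed.

(** A smoothed step whose transition lies in the overlap [b, c] splits a nonnegative test function
    into two nonnegative ones. *)
Lemma nonneg_on_glue u a b c d : a <= b -> b < c -> c <= d ->
  nonneg_on u a c -> nonneg_on u b d -> nonneg_on u a d.
Proof.
move=> ab bc cd h1 h2 psi tp psi0.
pose m := (b + c) / 2; pose r := (c - b) / 2.
have r0 : 0 < r by rewrite /r; lra.
pose chi := rescale (@step R) m r.
have schi : smooth chi by exact: smooth_step_rescale.
have chi0 y : y <= b -> chi y = 0.
  by move=> yb; rewrite /chi /rescale step0// ler_pdivrMr// /m /r; lra.
have chi1 y : c <= y -> chi y = 1.
  by move=> yc; rewrite /chi /rescale step1// ler_pdivlMr// /m /r; lra.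
have [spsi vpsi] := tp.
have t2 : testf b d (fun y => psi y * chi y).
  split; first exact: smoothM.
  move=> y /orP[yb|dy]; first by rewrite chi0 ?mulr0// ltW.
  by rewrite vpsi ?mul0r// dy orbT.
have t1 : testf a c (fun y => psi y - psi y * chi y).
  split; first by apply: smoothB; [exact: spsi|exact: smoothM].
  move=> y /orP[ya|cy]; first by rewrite vpsi ?mul0r ?subrr// ya.
  by rewrite chi1 ?mulr1 ?subrr// ltW.
have -> : psi = (fun y => (psi y - psi y * chi y) + psi y * chi y).
  by apply/funext => y; ring.
have t1' := testf_sub (lexx a) cd t1; have t2' := testf_sub ab (lexx d) t2.
rewrite (DprimeD u t1' t2'); apply: addr_ge0.
  apply: h1 => // y; rewrite subr_ge0 ler_piMr//; exact: step_le1.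
by apply: h2 => // y; rewrite mulr_ge0//; exact: step_ge0.
Qed.

(** Positivity is local. The supremum of the points reached from [p] has a good neighbourhood, which
    can be glued to what was reached before; so it is [q]. *)
Lemma nonneg_on_local u p q : p <= q ->
  (forall x, p <= x <= q -> exists2 r, 0 < r & nonneg_on u (x - r) (x + r)) ->
  nonneg_on u p q.
Proof.
move=> pq hloc.
pose S := [set y | p <= y <= q /\ nonneg_on u p y].
have Sp : S p.
  split; first by rewrite lexx pq.
  have [|r r0 hr] := hloc p; first by rewrite lexx.
  by apply: nonneg_on_sub hr; lra.
have hS : has_sup S by split; [exists p|exists q => y [/andP[]]].
have ps : p <= sup S by apply: ub_le_sup => //; case: hS.
have sq : sup S <= q by apply: ge_sup; [exists p|move=> y [/andP[]]].
have [|r r0 hr] := hloc (sup S); first by rewrite ps.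
have hsr : nonneg_on u p (sup S + r).
  have [y Sy ysr] := sup_adherent r0 hS.
  have ys : y <= sup S by apply: ub_le_sup => //; case: hS.
  have [/andP[py yq] hy] := Sy.
  have [h|h] := leP p (sup S - r).
    by apply: (nonneg_on_glue h ysr _ hy hr); lra.
  by apply: nonneg_on_sub hr; lra.
suff sE : sup S = q by apply: nonneg_on_sub hsr => //; lra.
apply/eqP; rewrite eq_le sq /= leNgt; apply/negP => sq'.
pose y := Num.min q (sup S + r).
have yS : S y.
  split; first by rewrite /y le_min ge_min pq lexx /= andbT; lra.
  by apply: nonneg_on_sub hsr => //; rewrite /y ge_min lexx orbT.
have : y <= sup S by apply: ub_le_sup => //; case: hS.
by rewrite /y ge_min leNgt sq' /=; lra.
Qed.

End hypotheses.

(** * Bounds of means over cones *)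

Section uniform_boundedness.
Variable R : realType.
Implicit Types (f g zeta psi : R -> R) (a b c x y z t e p q M C K r : R) (u : Dprime R).

Lemma le_of_geometric a b C : (forall n : nat, a <= b + C * 3^-1 ^+ n) -> a <= b.
Proof.
move=> h; rewrite leNgt; apply/negP => ab.
have d0 : 0 < a - b by lra.
have C1 : 0 < `|C| + 1 by rewrite ltr_wpDl.
have [n hn] : exists n : nat, (`|C| + 1) / (a - b) < n%:R.
  by exists (Num.truncn ((`|C| + 1) / (a - b))).+1; rewrite truncnS_gt.
have n3 : n%:R <= 3 ^+ n :> R by rewrite -natrX ler_nat ltnW// ltn_expl.
have p3 : 0 < 3 ^+ n :> R by rewrite exprn_gt0.
have := h n; rewrite exprVn -lerBlDl ler_pdivlMr//.
apply/negP; rewrite -ltNge.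
have h1 : `|C| + 1 < 3 ^+ n * (a - b).
  by rewrite -ltr_pdivrMr//; apply: lt_le_trans hn n3.
have := ler_norm C; rewrite mulrC; lra.
Qed.

(** The intervals of radius [2 K / 3^n] about [s n] are nested, so the supremum of their left ends
    lies in all of them. *)
Lemma geometric_cauchy (s : nat -> R) K : 0 <= K ->
  (forall n, `|s n.+1 - s n| <= K * 3^-1 ^+ n) ->
  exists l : R, forall n, `|l - s n| <= 2 * K * 3^-1 ^+ n.
Proof.
move=> K0 hs.
have q0 n : 0 <= 3^-1 ^+ n :> R by rewrite exprn_ge0// invr_ge0.
have qS n : 3^-1 ^+ n.+1 = 3^-1 ^+ n / 3 :> R by rewrite exprSr.
pose lo n := s n - 2 * K * 3^-1 ^+ n; pose up n := s n + 2 * K * 3^-1 ^+ n.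
have Kq n : 0 <= K * 3^-1 ^+ n by rewrite mulr_ge0.
have loS n : lo n <= lo n.+1.
  have := hs n; rewrite ler_norml /lo qS => /andP[h1 h2]; have := Kq n; lra.
have upS n : up n.+1 <= up n.
  have := hs n; rewrite ler_norml /up qS => /andP[h1 h2]; have := Kq n; lra.
have lohomo m n : (m <= n)%N -> lo m <= lo n.
  by move=> /subnK <-; elim: (n - m)%N => // k IH; exact: le_trans IH (loS _).
have uphomo m n : (m <= n)%N -> up n <= up m.
  by move=> /subnK <-; elim: (n - m)%N => // k IH; exact: le_trans (upS _) IH.
have loup m n : lo m <= up n.
  apply: le_trans (lohomo m (maxn m n) (leq_maxl _ _)) _.
  apply: le_trans _ (uphomo n (maxn m n) (leq_maxr _ _)).
  by have := Kq (maxn m n); rewrite /lo /up; lra.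
exists (sup (range lo)) => n.
have h1 : lo n <= sup (range lo).
  by apply: ub_le_sup; [exists (up 0%N) => _ [m _ <-]|exists n].
have h2 : sup (range lo) <= up n.
  by apply: ge_sup; [exists (lo 0%N); exists 0%N|move=> _ [m _ <-]].
by move: h1 h2; rewrite /lo /up => h1 h2; rewrite ler_norml; apply/andP; split; lra.
Qed.

(** The quadratic Taylor remainders of the derivatives of [g n] are bounded uniformly in [n]; in the
    limit they show that the limit of the derivatives of order [m + 1] is the derivative of the
    limit of those of order [m]. *)
Lemma smooth_limit (g : nat -> R -> R) (a b : R) :
  (forall n, testf a b (g n)) -> g 0%N = (fun=> 0) ->
  (forall m, exists2 K : R, 0 <= K & forall n y,
     `|(g n.+1)^`(m)%classic y - (g n)^`(m)%classic y| <= K * 3^-1 ^+ n) ->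
  exists2 l : R -> R, testf a b l & forall m, exists C : R, forall n y,
    `|l^`(m)%classic y - (g n)^`(m)%classic y| <= C * 3^-1 ^+ n.
Proof.
move=> tg g0 hK.
have /choice[K hK'] : forall m, exists K : R, 0 <= K /\ forall n y,
     `|(g n.+1)^`(m)%classic y - (g n)^`(m)%classic y| <= K * 3^-1 ^+ n.
  by move=> m; have [K K0 h] := hK m; exists K.
have q0 n : 0 <= 3^-1 ^+ n :> R by rewrite exprn_ge0// invr_ge0.
have q1 n : 3^-1 ^+ n <= 1 :> R by rewrite exprn_ile1// ?invr_ge0//; lra.
have /choice[G hG] : forall p : nat * R, exists l : R, forall n,
    `|l - (g n)^`(p.1)%classic p.2| <= 2 * K p.1 * 3^-1 ^+ n.
  move=> [m y] /=; have [K0 h] := hK' m.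
  exact: geometric_cauchy K0 (fun n => h n y).
have g00 m y : (g 0%N)^`(m)%classic y = 0.
  (* With its ends reversed, [vanish_out 1 0] says that the function vanishes everywhere, and so do
     its derivatives. *)
  rewrite g0 {g0}; have v0 : vanish_out 1 0 (fun=> 0 : R) by [].
  apply: (vanish_out_derivn m v0).
  by have [h|h] := leP y 0; apply/orP; [left|right]; lra.
(* Starting the sequence at 0 turns the bounds on increments into bounds on the derivatives
   themselves. *)
clear g0; have gbd m n y : `|(g n)^`(m)%classic y| <= 2 * K m + 2 * K m.
  have h1 := hG (m, y) n; have h2 := hG (m, y) 0%N; rewrite /= expr0 mulr1 in h1 h2.
  rewrite g00 subr0 in h2.
  have [K0 _] := hK' m.
  have : 2 * K m * 3^-1 ^+ n <= 2 * K m by rewrite ler_piMr// mulr_ge0.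
  move: h1 h2; rewrite !ler_norml => /andP[a1 a2] /andP[a3 a4] a5.
  by apply/andP; split; lra.
have dG m y : is_derive y (1 : R) (fun y => G (m, y)) (G (m.+1, y)).
  apply: (@is_derive_quadratic _ _ _ _ 1 (4 * K m.+2)); first exact: ltr01.
  move=> h h1; apply: (@le_of_geometric _ _ (4 * K m + `|h| * (2 * K m.+1))) => n.
  have sg : smooth (g n) by case: (tg n).
  have T := @taylor2_le R (g n)^`(m)%classic (g n)^`(m.+1)%classic
    (g n)^`(m.+2)%classic (4 * K m.+2) 1 y h h1.
  have {}T : `|(g n)^`(m)%classic (y + h) - (g n)^`(m)%classic y -
      h * (g n)^`(m.+1)%classic y| <= 4 * K m.+2 * `|h| ^+ 2.
    apply: T => z _; [exact: smooth_derivn_is_derive..|].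
    by apply: le_trans (gbd m.+2 n z) _; lra.
  have e1 := hG (m, y + h) n; have e2 := hG (m, y) n; have e3 := hG (m.+1, y) n.
  rewrite /= in e1 e2 e3.
  have -> : G (m, y + h) - G (m, y) - h * G (m.+1, y) =
    ((g n)^`(m)%classic (y + h) - (g n)^`(m)%classic y - h * (g n)^`(m.+1)%classic y) +
    ((G (m, y + h) - (g n)^`(m)%classic (y + h)) + (- (G (m, y) - (g n)^`(m)%classic y) +
     (- h) * (G (m.+1, y) - (g n)^`(m.+1)%classic y))) by ring.
  apply: le_trans (ler_normD _ _) _; apply: lerD; first exact: T.
  apply: le_trans (ler_normD _ _) _; apply: le_trans (lerD (lexx _) (ler_normD _ _)) _.
  rewrite normrN normrM normrN.
  have : `|h| * `|G (m.+1, y) - (g n)^`(m.+1)%classic y| <= `|h| * (2 * K m.+1 * 3^-1 ^+ n).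
    by rewrite ler_wpM2l.
  lra.
have GE m : (fun y => G (0%N, y))^`(m)%classic = (fun y => G (m, y)).
  elim: m => [//|m IH]; rewrite derive1nS IH; exact: derive1_funE (dG m).
exists (fun y => G (0%N, y)).
  split=> [m y|y yab].
    by rewrite GE; have := dG m y => ?; exact: ex_derive.
  apply/eqP; rewrite -normr_le0; apply: (@le_of_geometric _ _ (2 * K 0%N)) => n.
  have := hG (0%N, y) n; rewrite /= add0r; have [_ v] := tg n.
  by rewrite (v y yab) subr0.
by move=> m; exists (2 * K m) => n y; rewrite GE; exact: (hG (m, y) n).
Qed.

Lemma mean_lin u f g a b k x t : 0 < t -> testf a b f -> testf a b g ->
  mean u (fun y => k * f y + g y) x t = k * mean u f x t + mean u g x t.
Proof.
move=> t0 tf tg; rewrite /mean.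
have := Dprime_lin u k (rescale_testf x t0 tf) (rescale_testf x t0 tg).
by rewrite /rescale => ->; ring.
Qed.

Lemma mean_bound u a b x t : 0 < t -> exists (C : R) (N : nat), 0 <= C /\
  forall f (d : R), testf a b f ->
    (forall k, (k <= N)%N -> forall y, `|f^`(k)%classic y| <= d) ->
    `|mean u f x t| <= C * d.
Proof.
move=> t0; have [D [N [D0 hD]]] := Dprime_bound u (x + t * a) (x + t * b).
have ti : 0 <= t^-1 by rewrite invr_ge0 ltW.
exists (t^-1 * (D * \sum_(k < N.+1) t^-1 ^+ k)), N; split.
  by rewrite !mulr_ge0// sumr_ge0// => i _; rewrite exprn_ge0.
move=> f d tf hd; rewrite /mean normrM (ger0_norm ti) -!mulrA ler_wpM2l//.
apply: hD; first exact: rescale_testf.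
move=> k kN y; rewrite derive1n_rescale; last by case: tf.
rewrite normrM ger0_norm ?exprn_ge0//.
apply: le_trans (_ : t^-1 ^+ k * d <= _).
  by rewrite ler_wpM2l ?exprn_ge0//; exact: hd.
rewrite ler_wpM2r//; first by apply: le_trans (hd 0%N (leq0n N) 0).
rewrite (bigD1 (Ordinal (kN : (k < N.+1)%N)))//= lerDl.
by apply: sumr_ge0 => i _; rewrite exprn_ge0.
Qed.

End uniform_boundedness.

Section cone_bound.
Variable R : realType.
Implicit Types (zeta : R -> R).

(* Gliding hump: if the means over the cone were unbounded, a series of
   translates of [zeta] chosen at worst positions and with suitable signs would
   be a test function along which the point value fails to exist. *)
Lemma cone_bound (u : Dprime R) (x gamma : R) zeta : has_point_value u x gamma ->
  testf (-1) 1 zeta -> exists n : nat, forall t c : R, 0 < t < n.+1%:R^-1 ->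
    `|c| <= 1 -> `|mean u zeta (x + c * t) t| <= n.+1%:R.
Proof.
move=> hv tz; apply: contrapT => /forallNP hn.
have [sz vz] := tz.
pose Lam t c := mean u zeta (x + c * t) t.
have cLam t : 0 < t -> continuous (Lam t).
  move=> t0; have -> : Lam t = (fun c => mean u zeta (t * c + x) t).
    by apply/funext => c; rewrite /Lam; congr (mean _ _ _ _); ring.
  exact: (@continuous_affine R (fun x => mean u zeta x t) t x
    (@mean_continuous R u _ _ _ t t0 tz)).
(* At a bad scale the position is chosen to maximise the mean over the whole cone, so that
   translates added later cannot exceed it at that scale. The growth [6^n] beats the coefficients
   [3^-n] by [2^n]. *)
have /choice[tc htc] : forall n : nat, exists tc : R * R,
  [/\ 0 < tc.1 < n.+1%:R^-1, `|tc.2| <= 1, 6 ^+ n < `|Lam tc.1 tc.2| &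
    forall c, `|c| <= 1 -> `|Lam tc.1 c| <= `|Lam tc.1 tc.2| ].
  move=> n; have /existsNP[t /existsNP[c /not_implyP[/andP[t0 tn] /not_implyP[c1 /negP]]]] :=
    hn (6 ^ n)%N.
  rewrite -ltNge => hc.
  have cn : {within `[(-1)%R, 1%R], continuous (fun c => `|Lam t c|)}.
    by apply: continuous_subspaceT; apply: continuous_normf; exact: cLam.
  have [|c' c'1 hc'] := EVT_max _ cn; first lra.
  have hc2 c'' : `|c''| <= 1 -> `|Lam t c''| <= `|Lam t c'|.
    by move=> h; apply: hc'; rewrite in_itv/= -ler_norml.
  exists (t, c') => /=; split => //.
  - rewrite t0 (lt_le_trans tn)// lef_pV2 ?posrE ?ltr0n// ler_nat ltnS.
    by rewrite ltnW// ltn_expl.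
  - by move: c'1; rewrite in_itv/= ler_norml.
  - apply: lt_le_trans (hc2 c c1); apply: le_lt_trans _ hc.
    by rewrite -natrX ler_nat.
pose T n := (tc n).1; pose c n := (tc n).2; pose m n := `|Lam (T n) (c n)|.
have T0 n : 0 < T n by have [/andP[]] := htc n.
have Tn n : T n < n.+1%:R^-1 by have [/andP[]] := htc n.
have c1 n : `|c n| <= 1 by have [] := htc n.
have m6 n : 6 ^+ n < m n by have [] := htc n.
have mmax n c' : `|c'| <= 1 -> `|Lam (T n) c'| <= m n.
  by have [_ _ _] := htc n; apply.
pose sh c' : R -> R := fun y => zeta (1 * y + - c').
have tsh c' : `|c'| <= 1 -> testf (-2) 2 (sh c').
  rewrite ler_norml => /andP[h1 h2]; split; first exact: smooth_affine.
  by move=> y yo; apply: vz; case/orP: yo => h; apply/orP; [left|right]; lra.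
have shE c' t : 0 < t -> mean u (sh c') x t = Lam t c'.
  move=> t0; rewrite /Lam /mean; congr (_ * u _); apply/funext => y.
  rewrite /rescale /sh; congr zeta; field; by rewrite gt_eqF.
(* The sign makes the [n]-th hump reinforce what the partial sum already contributes at scale [T n],
   so nothing can cancel. *)
pose sg n (g : R -> R) : R := if 0 <= mean u g x (T n) * Lam (T n) (c n) then 1 else -1.
have sg1 n g : `|sg n g| = 1 by rewrite /sg; case: ifP; rewrite ?normrN normr1.
pose psi := fix psi n : R -> R := if n is n'.+1 then
  fun y => (sg n' (psi n') * 3^-1 ^+ n') * sh (c n') y + psi n' y else fun=> 0.
have tpsi n : testf (-2) 2 (psi n).
  elim: n => [|n IH]; first exact: testf0.
  by apply: testf_lin; [exact: tsh|exact: IH].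
have q0 n : 0 < 3^-1 ^+ n :> R by rewrite exprn_gt0// invr_gt0.
have [l tl hl] : exists2 l : R -> R, testf (-2) 2 l & forall k, exists C : R, forall n y,
    `|l^`(k)%classic y - (psi n)^`(k)%classic y| <= C * 3^-1 ^+ n.
  apply: smooth_limit => // k.
  have [M M0 hM] := testf_bounded_derivn k tz.
  exists M => // n y.
  have sh_s : smooth (sh (c n)) by case: (tsh _ (c1 n)).
  have ps : smooth (psi n) by case: (tpsi n).
  rewrite [psi n.+1]/= (derive1n_lin _ _ sh_s ps) addrK /sh derive1n_affine//.
  rewrite expr1n mul1r !normrM sg1 mul1r (gtr0_norm (q0 n)) [X in X <= _]mulrC.
  by rewrite mul1r; apply: ler_wpM2r; [exact: ltW|exact: hM].
pose V n g := mean u g x (T n).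
have VS n k : V n (psi k.+1) = (sg k (psi k) * 3^-1 ^+ k) * Lam (T n) (c k) + V n (psi k).
  by rewrite /V [psi k.+1]/= (mean_lin _ _ _ (T0 n) (tsh _ (c1 k)) (tpsi k)) shE.
have Vlow n : 3^-1 ^+ n * m n <= `|V n (psi n.+1)|.
  rewrite VS /sg -/(V n (psi n)).
  have -> : 3^-1 ^+ n * m n = `|3^-1 ^+ n * Lam (T n) (c n)|.
    by rewrite normrM (gtr0_norm (q0 n)).
  have E : V n (psi n) * (3^-1 ^+ n * Lam (T n) (c n)) =
     3^-1 ^+ n * (V n (psi n) * Lam (T n) (c n)) by ring.
  case: ifPn => [h|].
    have : 0 <= V n (psi n) * (3^-1 ^+ n * Lam (T n) (c n)).
      by rewrite E mulr_ge0// ltW.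
    rewrite mul1r; set A := _ * Lam _ _; set W := V n (psi n) => AW.
    rewrite -ler_sqr ?nnegrE// !real_normK ?num_real//.
    have := sqr_ge0 W; rewrite sqrrD; lra.
  rewrite -ltNge => h.
  have : V n (psi n) * (3^-1 ^+ n * Lam (T n) (c n)) <= 0.
    by rewrite E mulr_ge0_le0// ltW.
  rewrite mulN1r mulNr; set A := _ * Lam _ _; set W := V n (psi n) => AW.
  rewrite -ler_sqr ?nnegrE// !real_normK ?num_real//.
  have := sqr_ge0 W; rewrite sqrrD sqrrN mulNr; lra.
have m0 n : 0 <= m n by exact: normr_ge0.
(* By maximality of [c n], each later hump changes the mean at scale [T n] by at most its
   coefficient times [m n]. The ratio 1/3 makes the whole tail at most half of the [n]-th
   contribution. *)
have Vtail n k : `|V n (psi (n.+1 + k)%N) - V n (psi n.+1)| <=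
    m n * (3^-1 ^+ n / 2 - 3^-1 ^+ (n + k) / 2).
  elim: k => [|k IH]; first by rewrite !addn0 !subrr normr0 mulr0.
  rewrite addnS VS.
  have h1 : `|sg (n.+1 + k)%N (psi (n.+1 + k)%N) * 3^-1 ^+ (n.+1 + k) * Lam (T n) (c (n.+1 + k)%N)|
     <= 3^-1 ^+ (n.+1 + k) * m n.
    rewrite normrM normrM sg1 mul1r (gtr0_norm (q0 _)).
    by apply: ler_wpM2l; [exact: ltW|exact: (mmax _ _ (c1 _))].
  rewrite -addrA; apply: le_trans (ler_normD _ _) _.
  apply: le_trans (lerD h1 IH) _.
  rewrite addSn addnS exprSr.
  have := q0 (n + k)%N; have := m0 n; set q := 3^-1 ^+ (n + k); set r := 3^-1 ^+ n => h2 h3.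
  rewrite le_eqVlt; apply/orP; left; apply/eqP; by field.
have lowl n : 3^-1 ^+ n * m n / 2 <= `|V n l|.
  have [C [N [C0 hC]]] := mean_bound u (-2) 2 x (T0 n).
  have /choice[D hD] := hl.
  pose DD := \sum_(k < N.+1) `|D k|.
  apply: (@le_of_geometric _ _ _ (C * DD)) => k.
  have h1 := Vtail n k; have h2 := Vlow n.
  have h3 : `|V n (psi (n.+1 + k)%N) - V n l| <= C * DD * 3^-1 ^+ k.
    have -> : V n (psi (n.+1 + k)%N) - V n l =
       mean u (fun y => -1 * l y + psi (n.+1 + k)%N y) x (T n).
      by rewrite (mean_lin _ _ _ (T0 n) tl (tpsi _)) mulN1r addrC.
    rewrite -mulrA; apply: hC; first exact: testf_lin.
    move=> i iN y; rewrite derive1n_lin; [|by case: tl|by case: (tpsi (n.+1 + k)%N)].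
    rewrite mulN1r -normrN opprD opprK.
    apply: le_trans (hD i (n.+1 + k)%N y) _.
    apply: le_trans (_ : `|D i| * 3^-1 ^+ k <= _).
      rewrite exprD mulrA; apply: ler_wpM2r; first exact: ltW.
      apply: le_trans (_ : `|D i| * 3^-1 ^+ n.+1 <= _).
        by rewrite ler_wpM2r ?(ltW (q0 _))// ler_norm.
      rewrite ler_piMr// exprn_ile1// ?invr_ge0//; lra.
    rewrite ler_wpM2r ?(ltW (q0 _))// /DD (bigD1 (Ordinal (iN : (i < N.+1)%N)))//= lerDl.
    exact: sumr_ge0.
  have h4 : 0 <= m n * (3^-1 ^+ (n + k) / 2).
    by rewrite mulr_ge0// divr_ge0// ltW.
  have h5 : `|V n (psi n.+1)| <= `|V n l| + (`|V n (psi (n.+1 + k)%N) - V n l| +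
     `|V n (psi (n.+1 + k)%N) - V n (psi n.+1)|).
    rewrite [X in `|X| <= _](_ : _ = V n l + ((V n (psi (n.+1 + k)%N) - V n l) -
       (V n (psi (n.+1 + k)%N) - V n (psi n.+1)))); last by ring.
    apply: le_trans (ler_normD _ _) _; rewrite lerD2l.
    apply: le_trans (ler_normB _ _) _; exact: lexx.
  move: h1 h2 h3 h4 h5; rewrite mulrBr; set X1 := m n * _; lra.
have l01 : (-2 : R) < 2 by lra.
have [d d0 hd] := point_value_mean hv l01 tl ltr01.
pose B := `|gamma * Int (-2) 2 l| + 1.
(* Index [n + 1] has its scale below [d], while the mean there, at least [(n + 1) / 2], exceeds the
   bound [B] given by the point value. *)
pose n := Num.truncn (Num.max d^-1 (2 * B)).
have hn' : Num.max d^-1 (2 * B) < n.+1%:R by rewrite truncnS_gt.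
have Tnd : 0 < T n.+1 < d.
  rewrite T0 (lt_le_trans (Tn n.+1))// invf_ple ?posrE ?ltr0n//.
  apply: le_trans (_ : n.+1%:R <= _); last by rewrite ler_nat.
  by apply: le_trans (ltW hn'); rewrite le_max lexx.
have V1 : `|V n.+1 l| <= B.
  have := hd _ Tnd; rewrite -/(V n.+1 l) => h.
  rewrite /B -[V n.+1 l](subrK (gamma * Int (-2) 2 l)) addrC.
  by apply: le_trans (ler_normD _ _) _; rewrite lerD2l.
have V2 : n.+1%:R / 2 <= `|V n.+1 l|.
  apply: le_trans (lowl n.+1); rewrite ler_wpM2r//.
  apply: le_trans (_ : 3^-1 ^+ n.+1 * 6 ^+ n.+1 <= _); last first.
    by rewrite ler_wpM2l ?(ltW (q0 _))// ltW.
  rewrite -exprMn (_ : 3^-1 * 6 = 2 :> R); last by field.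
  by rewrite -natrX ler_nat ltnW// ltn_expl.
have : 2 * B < n.+1%:R by apply: le_lt_trans hn'; rewrite le_max lexx orbT.
by move: V1 V2; set X := n.+1%:R; lra.
Qed.

End cone_bound.

(** * Bounds near the closed set of irregular points *)

Section baire.
Variable R : realType.
Implicit Types (K : set R) (C : nat -> set R) (x y r e : R).

Lemma closed_adherent K x : closed K ->
  (forall e, 0 < e -> exists2 y, K y & `|y - x| < e) -> K x.
Proof.
move=> cK h; apply: cK => A [e /= e0 eA].
by have [y Ky yx] := h e e0; exists y; split => //; apply: eA; rewrite /= distrC.
Qed.

Lemma not_closed_ball K x : closed K -> ~ K x ->
  exists2 e, 0 < e & forall y, `|y - x| <= e -> ~ K y.
Proof.
move=> cK nK; apply: contrapT => h; apply: nK; apply: closed_adherent => // e e0.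
apply: contrapT => h2; apply: h; exists (e / 2); first by rewrite divr_gt0.
move=> y yx Ky; apply: h2; exists y => //; apply: le_lt_trans yx _.
by rewrite ltr_pdivrMr// ltr_pMr// ltr1n.
Qed.

(** If the conclusion fails, every ball centred in [K] contains a ball at most a third as large,
    centred in [K] and missing [C n]. The centres converge to a point of [K] that lies in no
    [C n]. *)
Lemma baire_closed K C : closed K -> K !=set0 -> (forall n, closed (C n)) ->
  (forall x, K x -> exists n, C n x) ->
  exists n x r, [/\ 0 < r, K x & forall y, K y -> `|y - x| < r -> C n y].
Proof.
move=> cK [k0 Kk0] cC KC; apply: contrapT => hn.
have step_ex : forall p : nat * (R * R), exists q : R * R,
    K p.2.1 -> 0 < p.2.2 -> [/\ K q.1, 0 < q.2 <= p.2.2 / 3,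
      `|q.1 - p.2.1| + q.2 <= p.2.2 & forall y, `|y - q.1| <= q.2 -> ~ C p.1 y].
  move=> [n [x r]] /=; have [[Kx r0]|h] := pselect (K x /\ 0 < r); last first.
    (* A dummy value for arguments outside [K] or with nonpositive radius, so that choice yields a
       total function. *)
    by exists (0, 0) => Kx r0; exfalso; apply: h.
  have [y [Ky yx nC]] : exists y, [/\ K y, `|y - x| < r & ~ C n y].
    apply: contrapT => h; apply: hn; exists n, x, r; split => // y Ky yx.
    by apply: contrapT => nC; apply: h; exists y.
  have [e e0 he] := not_closed_ball (cC n) nC.
  exists (y, Num.min e (Num.min (r / 3) (r - `|y - x|))) => _ _ /=; split => //.
  - by rewrite !lt_min e0 subr_gt0 yx divr_gt0//= !ge_min lexx orbT.
  - by rewrite -lerBrDl !ge_min lexx !orbT.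
  - by move=> z; rewrite !le_min => /andP[h _]; exact: he.
have [G hG] := choice step_ex.
pose s := fix s n := if n is n'.+1 then G (n', s n') else (k0, 1).
have sok n : K (s n).1 /\ 0 < (s n).2.
  elim: n => [|n [h1 h2]]; first by split => //=; exact: ltr01.
  by have [a1 /andP[a2 _] _ _] := hG (n, s n) h1 h2.
have sS n : [/\ (s n.+1).2 <= (s n).2 / 3,
     `|(s n.+1).1 - (s n).1| + (s n.+1).2 <= (s n).2 &
     forall y, `|y - (s n.+1).1| <= (s n.+1).2 -> ~ C n y].
  have [h1 h2] := sok n.
  by have [a1 /andP[_ a2] a3 a4] := hG (n, s n) h1 h2.
pose lo n := (s n).1 - (s n).2; pose up n := (s n).1 + (s n).2.
have nested n : lo n <= lo n.+1 /\ up n.+1 <= up n.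
  have [_ h _] := sS n; rewrite /lo /up.
  have := ler_norm ((s n.+1).1 - (s n).1).
  have := ler_norm (- ((s n.+1).1 - (s n).1)); rewrite normrN; split; lra.
have lohomo m n : (m <= n)%N -> lo m <= lo n.
  move=> /subnK <-; elim: (n - m)%N => // k IH.
  by apply: le_trans IH _; case: (nested (k + m)%N).
have uphomo m n : (m <= n)%N -> up n <= up m.
  move=> /subnK <-; elim: (n - m)%N => // k IH.
  by apply: le_trans _ IH; case: (nested (k + m)%N).
have loup m n : lo m <= up n.
  apply: le_trans (lohomo m (maxn m n) (leq_maxl _ _)) _.
  apply: le_trans _ (uphomo n (maxn m n) (leq_maxr _ _)).
  by have [_ h] := sok (maxn m n); rewrite /lo /up; lra.
pose l := sup (range lo).
have hl n : `|l - (s n).1| <= (s n).2.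
  have h1 : lo n <= l by apply: ub_le_sup; [exists (up 0%N) => _ [m _ <-]|exists n].
  have h2 : l <= up n.
    by apply: ge_sup; [exists (lo 0%N); exists 0%N|move=> _ [m _ <-]].
  by move: h1 h2; rewrite /lo /up ler_norml => h1 h2; apply/andP; split; lra.
have small n : (s n).2 <= 3^-1 ^+ n.
  elim: n => [|n IH]; first by rewrite expr0.
  have [h _ _] := sS n; rewrite exprSr; lra.
have Kl : K l.
  apply: closed_adherent => // e e0; apply: contrapT => h.
  suff : e <= 0 by rewrite leNgt e0.
  apply: (@le_of_geometric _ _ _ 1) => n; rewrite add0r mul1r.
  rewrite leNgt; apply/negP => en; apply: h; exists (s n).1; first by case: (sok n).
  by rewrite distrC; apply: le_lt_trans (hl n) _; apply: le_lt_trans (small n) en.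
have [n Cn] := KC l Kl.
by have [_ _ /(_ l (hl n.+1))] := sS n.
Qed.

End baire.

(** * Comparison of means across the gaps of the closed set *)

Section gaps.
Variable R : realType.
Variables f F : Dprime R.
Hypothesis fF : is_derivative_of f F.
Implicit Types (x y t c p q r e : R) (zeta : R -> R).

Lemma mean_shift (u : Dprime R) zeta x t c : t != 0 ->
  mean u (fun y => zeta (1 * y + - c)) x t = mean u zeta (x + c * t) t.
Proof.
move=> t0; rewrite /mean; congr (_ * u _); apply/funext => y.
by rewrite /rescale; congr zeta; field.
Qed.

Lemma testf_step_difference x t x' t' : 0 < t -> 0 < t' -> x - t <= x' - t' ->
  x + t <= x' + t' ->
  testf (x - t) (x' + t') (fun y => rescale (@step R) x t y - rescale (@step R) x' t' y).
Proof.
move=> t0 t'0 h1 h2; split; first by apply: smoothB; exact: smooth_step_rescale.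
move=> y /orP[h|h]; rewrite /rescale.
  by rewrite !step0 ?subrr// ler_pdivrMr//; lin.
by rewrite !step1 ?subrr// ler_pdivlMr//; lin.
Qed.

(** Integrating a difference of steps against [f = F'] is the smoothed form of taking an increment
    of [F]. *)
Lemma Dprime_step_difference x t x' t' : 0 < t -> 0 < t' -> x - t <= x' - t' ->
  x + t <= x' + t' ->
  f (fun y => rescale (@step R) x t y - rescale (@step R) x' t' y) =
  mean F (@eta R) x' t' - mean F (@eta R) x t.
Proof.
move=> t0 t'0 h1 h2; have tpsi := testf_step_difference t0 t'0 h1 h2.
have te : testf (x - t) (x' + t') (rescale (@eta R) x t).
  by apply: testf_sub (rescale_testf x t0 (@testf_eta R)); lin.
have te' : testf (x - t) (x' + t') (rescale (@eta R) x' t').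
  by apply: testf_sub (rescale_testf x' t'0 (@testf_eta R)); lin.
have dstep y z s : is_derive y (1 : R) (rescale (@step R) z s) (s^-1 * rescale (@eta R) z s y).
  rewrite !rescaleE; apply: is_derive_affine; exact: step_is_derive.
rewrite (fF (testf_test tpsi)).
have -> : (fun y => rescale (@step R) x t y - rescale (@step R) x' t' y)^`()%classic =
    (fun y => - t'^-1 * rescale (@eta R) x' t' y + t^-1 * rescale (@eta R) x t y).
  apply: derive1_funE => y.
  have h := is_deriveB (dstep y x t) (dstep y x' t').
  by apply: (is_derive_eq h); ring.
rewrite (Dprime_lin F _ te' (testfZ _ te)) (DprimeZ F _ te) /mean; ring.
Qed.

(** The second ball lies to the right of the first, so at every point one of the two steps already
    has its final value and their difference is nonnegative. *)
Lemma mean_mono x t x' t' p q : 0 < t -> 0 < t' -> p <= x - t -> x + t <= x' - t' ->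
  x' + t' <= q -> nonneg_on f p q -> mean F (@eta R) x t <= mean F (@eta R) x' t'.
Proof.
move=> t0 t'0 px xx' x'q fpq.
have h1 : x - t <= x' - t' by lin.
have h2 : x + t <= x' + t' by lin.
have tpsi := testf_step_difference t0 t'0 h1 h2.
rewrite -subr_ge0 -(Dprime_step_difference t0 t'0 h1 h2).
apply: fpq (testf_sub px x'q tpsi) _ => y.
rewrite /rescale; have [h|h] := leP y (x + t).
  by rewrite (@step0 _ ((y - x') / t')) ?subr0 ?step_ge0// ler_pdivrMr//; lin.
by rewrite (@step1 _ ((y - x) / t)) ?subr_ge0 ?step_le1// ler_pdivlMr//; lin.
Qed.

Let testf_eta_shift c : testf (c - 1) (c + 1) (fun y => @eta R (1 * y + - c)).
Proof.
have [se ve] := @testf_eta R; split; first exact: smooth_affine.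
by move=> y /orP[h|h]; apply: ve; apply/orP; [left|right]; lin.
Qed.

Let Int_eta_shift c : Int (c - 1) (c + 1) (fun y => @eta R (1 * y + - c)) = 1.
Proof.
have := @Int_affine R (@eta R) (c - 1) (c + 1) 1 (- c) (@eta_continuous R).
rewrite mul1r => ->; rewrite -[RHS](@Int_eta R); congr (Int _ _ _); ring.
Qed.

Lemma mean_eta_value x gamma c e : has_point_value F x gamma -> 0 < e ->
  exists2 d, 0 < d & forall t, 0 < t < d -> `|mean F (@eta R) (x + c * t) t - gamma| <= e.
Proof.
move=> hv e0; have lt : c - 1 < c + 1 by lin.
have [d d0 hd] := point_value_mean hv lt (testf_eta_shift c) e0.
exists d => // t td; have := hd t td; rewrite Int_eta_shift mulr1 mean_shift//.
by case/andP: td => t0 _; rewrite gt_eqF.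
Qed.

Lemma mean_le_value x t b gamma p : 0 < t -> p <= x - t -> x + t < b ->
  has_point_value F b gamma -> (forall q, q < b -> nonneg_on f p q) ->
  mean F (@eta R) x t <= gamma.
Proof.
move=> t0 px xb hv fp; apply/ler_addgt0Pr => e e0.
(* The offset -2 puts the comparison ball at [b - 3 t', b - t'], strictly to the left of [b], where
   positivity is available; its mean still tends to the value at [b]. *)
have [d d0 hd] := mean_eta_value (-2) hv e0.
pose t' := Num.min ((b - (x + t)) / 3) (d / 2).
have t'0 : 0 < t' by rewrite lt_min; apply/andP; split; lin.
have t'b : t' <= (b - (x + t)) / 3 by rewrite ge_min lexx.
have t'd : t' <= d / 2 by rewrite ge_min lexx orbT.
have t'd' : 0 < t' < d by rewrite t'0 /=; lin.
have := hd t' t'd'; rewrite ler_norml => /andP[_ h].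
have hm : mean F (@eta R) x t <= mean F (@eta R) (b + -2 * t') t'.
  by apply: (@mean_mono _ _ _ _ p (b - t')) => //; [lin|lin|apply: fp; lin].
lin.
Qed.

Lemma value_le_mean x t a gamma q : 0 < t -> a < x - t -> x + t <= q ->
  has_point_value F a gamma -> (forall p, a < p -> nonneg_on f p q) ->
  gamma <= mean F (@eta R) x t.
Proof.
move=> t0 ax xq hv fp; apply/ler_addgt0Pr => e e0.
have [d d0 hd] := mean_eta_value 2 hv e0.
pose t' := Num.min ((x - t - a) / 3) (d / 2).
have t'0 : 0 < t' by rewrite lt_min; apply/andP; split; lin.
have t'b : t' <= (x - t - a) / 3 by rewrite ge_min lexx.
have t'd : t' <= d / 2 by rewrite ge_min lexx orbT.
have t'd' : 0 < t' < d by rewrite t'0 /=; lin.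
have := hd t' t'd'; rewrite ler_norml => /andP[h _].
have hm : mean F (@eta R) (a + 2 * t') t' <= mean F (@eta R) x t.
  by apply: (@mean_mono _ _ _ _ (a + t') q) => //; [lin|lin|apply: fp; lin].
lin.
Qed.

Variables (K : set R) (gamma : R -> R).
Hypothesis cK : closed K.
Hypothesis hK : forall x, ~ K x -> exists2 r, 0 < r & nonneg_on f (x - r) (x + r).
Hypothesis hgamma : forall x, has_point_value F x (gamma x).

Lemma nonneg_gap p q : (forall x, p <= x <= q -> ~ K x) -> nonneg_on f p q.
Proof.
move=> h; have [pq|qp] := leP p q.
  by apply: nonneg_on_local => // x /h /hK.
move=> psi [_ v] psi0; have -> : psi = (fun=> 0); last by rewrite Dprime0.
apply/funext => x; apply: v; have [//|px] := ltP x p.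
by rewrite (lt_le_trans qp px).
Qed.

(** If [K] has points between [p] and [x], the last one is a point of [K] by closedness; [f] is
    nonnegative between it and the ball, so the mean is at least the value there. Otherwise the ball
    can be compared with any fixed ball in the gap. [mean_le_or_gap] is the mirror image. *)
Lemma mean_ge_or_gap p x t n : 0 < t -> (forall y, x - t <= y <= x + t -> ~ K y) ->
  (forall k, K k -> p <= k <= x -> - n <= gamma k) ->
  - n <= mean F (@eta R) x t \/ forall z, p <= z <= x + t -> ~ K z.
Proof.
move=> t0 xK hn; pose A := [set k | K k /\ p <= k <= x].
have [[k Ak]|hA] := pselect (A !=set0); [left|right]; last first.
  move=> z /andP[z1 z2] Kz; have [zx|xz] := leP z x.
    by apply: hA; exists z; rewrite /A /= z1 zx.
  by apply: (xK z) => //; rewrite z2 andbT; lin.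
have uA : has_sup A by split; [exists k|exists x => z [_ /andP[]]].
have As z : A z -> z <= sup A by move=> Az; apply: ub_le_sup => //; case: uA.
have sx : sup A <= x by apply: ge_sup; [exists k|move=> z [_ /andP[]]].
have KA : K (sup A).
  apply: closed_adherent => // e e0; have [z Az zs] := sup_adherent e0 uA.
  exists z; first by case: Az.
  by rewrite distrC ger0_norm ?subr_ge0 ?As//; lin.
have pA : p <= sup A by apply: le_trans (As k Ak); case: Ak => _ /andP[].
have st : sup A < x - t.
  by rewrite ltNge; apply/negP => h; apply: (xK (sup A)) => //; rewrite h /=; lin.
apply: le_trans (hn _ KA _) _; first by rewrite pA.
apply: (@value_le_mean _ _ (sup A) _ (x + t)) => // q qs.
apply: nonneg_gap => z /andP[z1 z2] Kz.
have [zx|xz] := leP z x; last by apply: (xK z) => //; rewrite z2 andbT; lin.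
have : z <= sup A by apply: As; split => //; rewrite zx andbT; lin.
by rewrite leNgt (lt_le_trans qs z1).
Qed.

Lemma mean_le_or_gap p x t n : 0 < t -> (forall y, x - t <= y <= x + t -> ~ K y) ->
  (forall k, K k -> x <= k <= p -> gamma k <= n) ->
  mean F (@eta R) x t <= n \/ forall z, x - t <= z <= p -> ~ K z.
Proof.
move=> t0 xK hn; pose A := [set k | K k /\ x <= k <= p].
have [[k Ak]|hA] := pselect (A !=set0); [left|right]; last first.
  move=> z /andP[z1 z2] Kz; have [xz|zx] := leP x z.
    by apply: hA; exists z; rewrite /A /= xz z2.
  by apply: (xK z) => //; rewrite z1 /=; lin.
have uA : has_inf A by split; [exists k|exists x => z [_ /andP[]]].
have As z : A z -> inf A <= z by move=> Az; apply: ge_inf => //; case: uA.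
have sx : x <= inf A by apply: lb_le_inf; [exists k|move=> z [_ /andP[]]].
have KA : K (inf A).
  apply: closed_adherent => // e e0; have [z Az zs] := inf_adherent e0 uA.
  exists z; first by case: Az.
  by rewrite ger0_norm ?subr_ge0 ?As//; lin.
have pA : inf A <= p by apply: le_trans (As k Ak) _; case: Ak => _ /andP[].
have st : x + t < inf A.
  by rewrite ltNge; apply/negP => h; apply: (xK (inf A)) => //; rewrite h andbT; lin.
apply: le_trans _ (hn _ KA _); last by rewrite pA sx.
apply: (@mean_le_value _ _ (inf A) _ (x - t)) => // q qs.
apply: nonneg_gap => z /andP[z1 z2] Kz.
have [xz|zx] := leP x z; last by apply: (xK z) => //; rewrite z1 /=; lin.
have : inf A <= z by apply: As; split => //; rewrite xz /=; lin.
by rewrite leNgt (le_lt_trans z2 qs).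
Qed.

(** A ball meeting [K] is governed by a cone at a point of [K]. A ball missing [K] lies in a gap,
    and monotonicity bounds its mean by a value at an end of the gap or, if the gap is long, by one
    of two fixed reference means. *)
Lemma local_mean_bound x0 r (n : R) : 0 < r -> 0 < n ->
  (forall k, K k -> `|k - x0| < r -> forall t c, 0 < t < n^-1 -> `|c| <= 1 ->
     `|mean F (@eta R) (k + c * t) t| <= n) ->
  exists M t0 : R, [/\ 0 <= M, 0 < t0 & forall x t, `|x - x0| <= r / 2 -> 0 < t < t0 ->
    `|mean F (@eta R) x t| <= M].
Proof.
move=> r0 n0 hcone.
(* The reference balls cover the distances from 9/16 r to 11/16 r: beyond every ball considered,
   which stays within 17/32 r of [x0], and inside the range 3/4 r used for the gaps. *)
pose M1 := mean F (@eta R) (x0 + 5 / 8 * r) (r / 16).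
pose M2 := mean F (@eta R) (x0 - 5 / 8 * r) (r / 16).
pose M := n + `|M1| + `|M2|.
have n1 : 0 < n^-1 by rewrite invr_gt0.
exists M, (Num.min n^-1 (r / 32)).
have MM : [/\ n <= M, M1 <= M & - M <= M2].
  have := ler_norm M1; have := ler_norm (- M2); rewrite normrN.
  have := normr_ge0 M1; have := normr_ge0 M2; rewrite /M; split; lin.
have [nM M1M M2M] := MM.
have M0 : 0 <= M by rewrite /M !addr_ge0// ltW.
have M1E : M1 = mean F (@eta R) (x0 + 5 / 8 * r) (r / 16) by [].
have M2E : M2 = mean F (@eta R) (x0 - 5 / 8 * r) (r / 16) by [].
clear MM; clearbody M M1 M2.
(* The cone bound at the axis passes to the point value as the scale tends to 0. *)
have gk k : K k -> `|k - x0| < r -> `|gamma k| <= n.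
  move=> Kk kr; apply/ler_addgt0Pr => e e0.
  have [d d0 hd] := mean_eta_value 0 (@hgamma k) e0.
  pose t := Num.min (d / 2) (n^-1 / 2).
  have t0 : 0 < t by rewrite lt_min !divr_gt0.
  have td : t <= d / 2 by rewrite ge_min lexx.
  have tn : t <= n^-1 / 2 by rewrite ge_min lexx orbT.
  have h1 : `|mean F (@eta R) (k + 0 * t) t - gamma k| <= e by apply: hd; rewrite t0 /=; lin.
  have h2 : `|mean F (@eta R) (k + 0 * t) t| <= n.
    apply: hcone => //; last by rewrite normr0.
    rewrite t0 /=; apply: le_lt_trans tn _.
    by rewrite ltr_pdivrMr// ltr_pMr// ltr1n.
  move: h1 h2; rewrite !ler_norml => /andP[a1 a2] /andP[a3 a4]; apply/andP; split; lin.
split => //; first by rewrite lt_min n1 divr_gt0.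
move=> x t xx0 /andP[t0]; rewrite lt_min => /andP[tn tr].
have [[k [Kk kx]]|hno] := pselect (exists k, K k /\ `|x - k| <= t).
  apply: le_trans nM; have -> : x = k + (x - k) / t * t by rewrite divfK ?gt_eqF// addrC subrK.
  apply: hcone => //.
  - move: xx0 kx; rewrite !ler_norml ltr_norml => /andP[a1 a2] /andP[a3 a4].
    by apply/andP; split; lin.
  - by rewrite t0.
  - by rewrite normrM normfV (gtr0_norm t0) ler_pdivrMr// mul1r.
have xK y : x - t <= y <= x + t -> ~ K y.
  move=> /andP[a1 a2] Ky; apply: hno; exists y; split => //.
  by rewrite ler_norml; apply/andP; split; lin.
move: (xx0); rewrite ler_norml => /andP[b1 b2].
clear xx0 tn n1 n0 M0 hcone hno.
rewrite ler_norml; apply/andP; split.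
- have [|h|h] := @mean_ge_or_gap (x0 - 3 / 4 * r) x t n t0 xK.
  + move=> k Kk kx; have : `|gamma k| <= n.
      by apply: gk => //; rewrite ltr_norml; apply/andP; split; lin.
    by rewrite ler_norml => /andP[].
  + by apply: le_trans h; rewrite lerN2.
  apply: le_trans M2M _; rewrite M2E.
  apply: (@mean_mono _ _ _ _ (x0 - 3 / 4 * r) (x + t)) => //; try lin.
  exact: nonneg_gap.
- have [|h|h] := @mean_le_or_gap (x0 + 3 / 4 * r) x t n t0 xK.
  + move=> k Kk kx; have : `|gamma k| <= n.
      by apply: gk => //; rewrite ltr_norml; apply/andP; split; lin.
    by rewrite ler_norml => /andP[].
  + exact: le_trans h nM.
  apply: le_trans M1M; rewrite M1E.
  apply: (@mean_mono _ _ _ _ (x - t) (x0 + 3 / 4 * r)) => //; try lin.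
  exact: nonneg_gap.
Qed.

End gaps.

(** * The Lipschitz second primitive *)

Section primitive_function.
Variable R : realType.
Variables (F : Dprime R) (x0 rho M t0 : R).
Hypotheses (rho0 : 0 < rho) (M0 : 0 <= M) (t00 : 0 < t0).
Hypothesis hM : forall x t, `|x - x0| <= rho -> 0 < t < t0 -> `|mean F (@eta R) x t| <= M.
Implicit Types (x y z t s e a b : R) (psi : R -> R) (k : nat).

Lemma geometric_small e : 0 < e -> exists k, 3^-1 ^+ k < e.
Proof.
move=> e0; apply: contrapT => /forallNP h; suff : e <= 0 by rewrite leNgt e0.
apply: (@le_of_geometric _ _ _ 1) => n; rewrite add0r mul1r leNgt; apply/negP; exact: h.
Qed.

Let m_cont t : 0 < t -> continuous (fun x => mean F (@eta R) x t).
Proof. by move=> h; exact: mean_continuous h (@testf_eta R). Qed.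

(** The means at small scales are mollifications of [F] bounded by [M], so in the limit [F] acts
    like a function bounded by [M]. *)
Lemma Dprime_L1_bound psi a b : x0 - rho <= a -> a <= b -> b <= x0 + rho ->
  testf a b psi -> `|F psi| <= M * Int a b (fun x => `|psi x|).
Proof.
move=> ha ab hb tp; apply/ler_addgt0Pr => e e0.
have cp : continuous psi by apply: smooth_continuous; case: tp.
have [d d0 hd] := Int_mean_cvg F ltr01 ab (@testf_eta R) tp e0.
pose t := Num.min (d / 2) (t0 / 2).
have t1 : 0 < t by rewrite lt_min !divr_gt0.
have td : t <= d / 2 by rewrite ge_min lexx.
have tt0 : t <= t0 / 2 by rewrite ge_min lexx orbT.
have td' : 0 < t < d by rewrite t1 /=; lra.
have := hd t td'; rewrite Int_eta mul1r => h.
have h2 : `|Int a b (fun x => psi x * mean F (@eta R) x t)| <= M * Int a b (fun x => `|psi x|).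
  have cpm := continuousMf cp (@m_cont t t1).
  apply: le_trans (Int_norm cpm ab) _.
  rewrite -IntZ; last exact: continuous_normf.
  apply: Int_le => //; first exact: continuous_normf.
    by apply: continuousMf; [exact: cst_continuous|exact: continuous_normf].
  move=> x /andP[ax xb]; rewrite normrM mulrC ler_wpM2r//; apply: hM.
    by rewrite ler_norml; apply/andP; split; lra.
  by rewrite t1 /=; have := t00; lra.
have -> : F psi = Int a b (fun x => psi x * mean F (@eta R) x t) -
  (Int a b (fun x => psi x * mean F (@eta R) x t) - F psi) by ring.
by apply: le_trans (ler_normB _ _) _; apply: lerD.
Qed.

Let H := rho / 2.
Let J1 := x0 - H.
Let J2 := x0 + H.

(** A smoothed signed indicator of the interval from [x0] to [x]; applying [F] to it approximates a
    primitive of [F] at [x]. *)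
Let tent t x : R -> R := fun y => rescale (@step R) x0 t y - rescale (@step R) x t y.

Let Int_mean_tent t x : 0 < t -> `|x - x0| <= H ->
  Int x0 x (fun z => mean F (@eta R) z t) = F (tent t x).
Proof.
move=> t1 xH.
(* The exchange lemma asks for a test function as first factor; this cutoff equals 1 on the range of
   integration. *)
pose P y := @step R (1 * y + (- x0 + H + 1)) * @step R (-1 * y + (x0 + H + 1)).
have tP : testf (x0 - H - 2) (x0 + H + 2) P.
  split.
    by apply: smoothM; apply: smooth_affine; exact: step_smooth.
  by move=> y /orP[h|h]; rewrite /P; [rewrite step0 ?mul0r|rewrite [X in _ * X]step0 ?mulr0]; lra.
have P1 y : `|y - x0| <= H -> P y = 1.
  by rewrite ler_norml => /andP[h1 h2]; rewrite /P !step1 ?mulr1//; lra.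
have tQ : testf (- t) t (fun y => t^-1 * @eta R (t^-1 * y + 0)).
  split; first by apply: smoothZ; apply: smooth_affine; exact: eta_smooth.
  move=> y h; rewrite eta0 ?mulr0// addr0 mulrC ler_pdivrMr// ler_pdivlMr//.
  by case/orP: h => h; apply/orP; [left|right]; lra.
have vQ z : x0 - H - 2 <= z <= x0 + H + 2 ->
    vanish_out (x0 - H - 2 - t) (x0 + H + 2 + t)
      (fun y => t^-1 * @eta R (t^-1 * (1 * y + (- 1) * z) + 0)).
  move=> /andP[z1 z2] y h; have [_ v] := tQ; apply: v.
  by case/orP: h => h; apply/orP; [left|right]; lra.
have E := Dprime_Int_kernel tP tQ vQ F x0 x.
have xI z : (x0 <= z <= x) || (x <= z <= x0) -> `|z - x0| <= H.
  move: xH; rewrite !ler_norml => /andP[h1 h2] /orP[]/andP[h3 h4]; apply/andP; split; lra.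
have IntE' (g1 g2 : R -> R) : continuous g1 -> continuous g2 ->
    (forall z, `|z - x0| <= H -> g1 z = g2 z) -> Int x0 x g1 = Int x0 x g2.
  move=> c1 c2 h; have [xx|xx] := leP x0 x.
    by apply: eq_Int => // z zx; apply/h/xI; rewrite zx.
  suff : Int x x0 g1 = Int x x0 g2 by rewrite /Int; lra.
  by apply: eq_Int => //; [exact: ltW|move=> z zx; apply/h/xI; rewrite zx orbT].
have cz y : continuous (fun z => t^-1 * @eta R (- t^-1 * z + y / t)).
  apply: continuousMf; first exact: cst_continuous.
  by apply: continuous_affine; exact: eta_continuous.
have -> : tent t x = (fun y => Int x0 x (fun z => P z *
    (t^-1 * @eta R (t^-1 * (1 * y + (- 1) * z) + 0)))).
  apply/funext => y.
  have -> : tent t x y = Int x0 x (fun z => t^-1 * @eta R (- t^-1 * z + y / t)).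
    have dz z : is_derive z (1 : R) (fun z => -1 * step (- t^-1 * z + y / t))
        (t^-1 * @eta R (- t^-1 * z + y / t)).
      have h := is_deriveZf (-1) (is_derive_affine (step_is_derive (- t^-1 * z + y / t))).
      by apply: (is_derive_eq h); ring.
    rewrite (IntE x0 x (@cz y) dz) /tent /rescale.
    have e z : (y - z) / t = - t^-1 * z + y / t by ring.
    by rewrite !e; ring.
  have e z : t^-1 * (1 * y + (- 1) * z) + 0 = - t^-1 * z + y / t by ring.
  under [in RHS]eq_fun do rewrite e.
  apply: IntE' => //.
    by apply: continuousMf => //; apply: smooth_continuous; case: tP.
  by move=> z zx; rewrite P1// mul1r.
rewrite E; apply: IntE'; first exact: m_cont.
  have -> : (fun z => F (fun y => P z * (t^-1 * eta (t^-1 * (1 * y + -1 * z) + 0)))) =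
    (fun z => P z * mean F (@eta R) z t).
    apply/funext => z; have te := rescale_testf z t1 (@testf_eta R).
    have -> : (fun y => P z * (t^-1 * eta (t^-1 * (1 * y + -1 * z) + 0))) =
      (fun y => (P z * t^-1) * rescale (@eta R) z t y).
      apply/funext => y; rewrite mulrA; congr (_ * eta _); ring.
    by rewrite (DprimeZ F _ te) mulrA.
  by apply: continuousMf; [apply: smooth_continuous; case: tP|exact: m_cont].
move=> z zx; rewrite P1//; have te := rescale_testf z t1 (@testf_eta R).
have -> : (fun y => 1 * (t^-1 * eta (t^-1 * (1 * y + -1 * z) + 0))) =
  (fun y => t^-1 * rescale (@eta R) z t y).
  apply/funext => y; rewrite mul1r; congr (_ * eta _); ring.
by rewrite (DprimeZ F _ te).
Qed.

Let Int_step_diff z t s m : 0 < t -> 0 < s -> t <= m -> s <= m ->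
  x0 - rho <= z - m -> z + m <= x0 + rho ->
  Int (x0 - rho) (x0 + rho) (fun y => `|rescale (@step R) z t y - rescale (@step R) z s y|)
    <= 2 * m.
Proof.
move=> t1 s1 tm sm h1 h2.
have m0 : 0 < m := lt_le_trans t1 tm.
have cs v : continuous (rescale (@step R) z v).
  by apply: smooth_continuous; exact: smooth_step_rescale.
have cd : continuous (fun y => `|rescale (@step R) z t y - rescale (@step R) z s y|).
  by apply: continuous_normf => y; apply: cvgB; exact: cs.
rewrite (@Int_widen _ _ (z - m) (z + m))//; last 2 first.
- lra.
- move=> y yo; rewrite /rescale; case/orP: yo => yo.
    rewrite !step0 ?subrr ?normr0// ler_pdivrMr//; lra.
  rewrite !step1 ?subrr ?normr0// ler_pdivlMr//; lra.
rewrite (_ : 2 * m = 1 * (z + m - (z - m))); last by ring.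
rewrite -Int_cst; apply: Int_le => //; [exact: cst_continuous|lra|].
move=> y _; rewrite ler_norml.
have a1 := @step_ge0 R ((y - z) / t); have a2 := @step_le1 R ((y - z) / t).
have a3 := @step_ge0 R ((y - z) / s); have a4 := @step_le1 R ((y - z) / s).
by rewrite /rescale; apply/andP; split; lra.
Qed.

(** Tents at scales up to [m] differ only near [x0] and near [x], by at most [4 m] in mean, so the
    L1 bound gives a Cauchy estimate. *)
Let tent_cauchy t s m x : 0 < t -> 0 < s -> t <= m -> s <= m -> m <= H ->
  `|x - x0| <= H -> `|F (tent t x) - F (tent s x)| <= 4 * M * m.
Proof.
move=> t1 s1 tm sm mH; rewrite ler_norml => /andP[x1 x2].
have hH : H = rho / 2 by [].
have m0 : 0 < m := lt_le_trans t1 tm.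
have tT v : 0 < v -> v <= m -> testf (x0 - rho) (x0 + rho) (tent v x).
  move=> v0 vm; split; first by apply: smoothB; exact: smooth_step_rescale.
  move=> y yo; rewrite /tent /rescale; case/orP: yo => yo.
    by rewrite !step0 ?subrr// ler_pdivrMr//; lra.
  by rewrite !step1 ?subrr// ler_pdivlMr//; lra.
have tt := tT t t1 tm; have ts := tT s s1 sm.
rewrite -(DprimeB F tt ts).
have rr : x0 - rho <= x0 + rho by have := rho0; lra.
apply: le_trans (Dprime_L1_bound (lexx _) rr (lexx _) (testfB tt ts)) _.
rewrite (_ : 4 * M * m = M * (2 * m + 2 * m)); last by ring.
apply: ler_wpM2l => //.
have cs z v : continuous (rescale (@step R) z v).
  by apply: smooth_continuous; exact: smooth_step_rescale.
pose A z y := `|rescale (@step R) z t y - rescale (@step R) z s y|.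
have cA z : continuous (A z) by apply: continuous_normf => y; apply: cvgB; exact: cs.
apply: le_trans (_ : Int (x0 - rho) (x0 + rho) (fun y => A x0 y + A x y) <= _).
  apply: Int_le => //.
  - by apply: continuous_normf => y; apply: cvgB; apply: cvgB; exact: cs.
  - by move=> y; apply: cvgD; exact: cA.
  move=> y _; rewrite /A /tent.
  rewrite [X in `|X| <= _](_ : _ = (rescale (@step R) x0 t y - rescale (@step R) x0 s y) -
     (rescale (@step R) x t y - rescale (@step R) x s y)); last by ring.
  exact: ler_normB.
by rewrite IntD//; apply: lerD; apply: Int_step_diff => //; lra.
Qed.

Let tau := Num.min (H / 2) (t0 / 2).

Let tau0 : 0 < tau.
Proof. by rewrite lt_min !divr_gt0. Qed.

Let tk k := tau * 3^-1 ^+ k.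

Let q0 k : 0 < 3^-1 ^+ k :> R. Proof. by rewrite exprn_gt0// invr_gt0. Qed.

Let q1 k : 3^-1 ^+ k <= 1 :> R.
Proof. by rewrite exprn_ile1// ?invr_ge0//; lra. Qed.

Let tk0 k : 0 < tk k. Proof. by rewrite mulr_gt0// ?tau0. Qed.

Let tktau k : tk k <= tau. Proof. by rewrite ger_pMr// ?tau0. Qed.

Let tkH k : tk k <= H.
Proof.
apply: le_trans (tktau k) _; rewrite /tau ge_min; apply/orP; left.
by rewrite /H; have := rho0; lra.
Qed.

Let tkt0 k : 0 < tk k < t0.
Proof.
rewrite tk0 /=; apply: le_lt_trans (tktau k) _.
rewrite /tau gt_min; apply/orP; right; have := t00; lra.
Qed.

Let Gk k x := Int x0 x (fun z => mean F (@eta R) z (tk k)).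

Let Gk_is_derive k x : is_derive x (1 : R) (Gk k) (mean F (@eta R) x (tk k)).
Proof. by apply: Int_is_derive; exact: m_cont. Qed.

(** Freezing [G] outside the interval makes the Lipschitz bound hold on the whole line. *)
Let clamp x := Num.max J1 (Num.min x J2).

Let J12 : J1 <= J2.
Proof. by rewrite /J1 /J2 /H; have := rho0; lra. Qed.

Let clampI x : `|clamp x - x0| <= H.
Proof.
rewrite ler_norml /clamp; apply/andP; split.
  by rewrite lerBrDr addrC le_max lexx.
by rewrite lerBlDr addrC ge_max J12 /= ge_min lexx orbT.
Qed.

Let clampE x : J1 <= x <= J2 -> clamp x = x.
Proof. by move=> /andP[h1 h2]; rewrite /clamp min_l// max_r. Qed.

Let clamp_lip x y : `|clamp x - clamp y| <= `|x - y|.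
Proof.
wlog xy : x y / x <= y => [hw|].
  have /orP[xy|yx] := le_total x y; first exact: hw.
  by rewrite distrC (distrC x); exact: hw.
have h : clamp x <= clamp y.
  rewrite /clamp ge_max !le_max lexx /=; apply/orP; right.
  by rewrite le_min !ge_min xy lexx orbT.
rewrite ler0_norm ?subr_le0// ler0_norm ?subr_le0//.
have := J12; rewrite /clamp => j.
by case: (leP x J2) => a1; case: (leP y J2) => a2; rewrite !maxEle;
  do 2?(case: ifPn; rewrite -?ltNge => ?); lra.
Qed.

(** [G] is the limit of the primitives [Gk] of the means at scales [tau / 3^k]. Its Lipschitz
    constant is the bound on the means, and integrating [Gk] by parts before letting [k] grow gives
    [F = G']. *)
Lemma primitive_function_exists : exists2 G : R -> R,
  (forall x y, `|G x - G y| <= M * `|x - y|) &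
  forall psi a b, x0 - rho / 2 < a -> b < x0 + rho / 2 -> testf a b psi ->
    F psi = - Int (x0 - rho / 2) (x0 + rho / 2) (fun x => G x * psi^`()%classic x).
Proof.
have h4 : 0 <= 4 * M * tau by rewrite !mulr_ge0// ltW// tau0.
have /choice[G hG] : forall x, exists l : R, forall k,
    `|l - Gk k (clamp x)| <= 2 * (4 * M * tau) * 3^-1 ^+ k.
  move=> x; apply: geometric_cauchy => // k.
  rewrite /Gk !Int_mean_tent//; try exact: tk0; try exact: clampI.
  rewrite -mulrA -/(tk k).
  apply: tent_cauchy => //; try exact: tk0; try exact: tkH; try exact: clampI.
  by rewrite /tk ler_wpM2l ?(ltW tau0)// exprSr ler_piMr ?(ltW (q0 k))//; lra.
have GL x y : `|G x - G y| <= M * `|x - y|.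
  apply: (@le_of_geometric _ _ _ (4 * (4 * M * tau))) => k.
  have e1 := hG x k; have e2 := hG y k.
  have e3 : `|Gk k (clamp x) - Gk k (clamp y)| <= M * `|x - y|.
    apply: le_trans (_ : M * `|clamp x - clamp y| <= _); last by rewrite ler_wpM2l.
    apply: (@MVT_le _ _ (fun z => mean F (@eta R) z (tk k))) => [z _|z zI].
      exact: Gk_is_derive.
    apply: hM; last exact: tkt0.
    have := clampI x; have := clampI y; rewrite !ler_norml.
    move=> /andP[a1 a2] /andP[a3 a4].
    have hH : H = rho / 2 by [].
    by case/orP: zI => /andP[z1 z2]; apply/andP; split; have := rho0; lra.
  rewrite [X in `|X| <= _](_ : _ = (Gk k (clamp x) - Gk k (clamp y)) +
    ((G x - Gk k (clamp x)) - (G y - Gk k (clamp y)))); last by ring.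
  apply: le_trans (ler_normD _ _) _; apply: lerD => //.
  apply: le_trans (ler_normB _ _) _; lra.
exists G => // psi a b ha hb tp.
have cG : continuous G := lipschitz_continuous GL.
have [spsi vpsi] := tp.
have cpsi := smooth_continuous spsi.
have cdpsi : continuous psi^`()%classic.
  by apply: smooth_continuous; exact: smooth_deriv.
have [D D0 hD] := testf_bounded_derivn 1 tp.
have tpJ : testf J1 J2 psi by apply: testf_sub tp; rewrite /J1 /J2 /H ltW.
suff : `|F psi + Int J1 J2 (fun x => G x * psi^`()%classic x)| <= 0.
  by rewrite normr_le0 addr_eq0 => /eqP.
apply/ler_addgt0Pr => e e0; rewrite add0r.
have e20 : 0 < e / 2 by rewrite divr_gt0.
have [d d0 hd] := Int_mean_cvg F ltr01 J12 (@testf_eta R) tpJ e20.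
pose C := 2 * (4 * M * tau) * D * (J2 - J1).
have C0 : 0 <= C by rewrite !mulr_ge0// ?(ltW tau0)// subr_ge0 J12.
have [k hk] : exists k, 3^-1 ^+ k < Num.min (d / tau) (e / 2 / (C + 1)).
  by apply: geometric_small; rewrite lt_min !divr_gt0// ?tau0// ltr_wpDl.
move: hk; rewrite lt_min => /andP[k1 k2].
have kd : 0 < tk k < d by rewrite tk0 /= /tk mulrC -ltr_pdivlMr ?tau0.
have kC : C * 3^-1 ^+ k <= e / 2.
  move: k2; rewrite ltr_pdivlMr ?ltr_wpDl// => k2.
  by have := q0 k; have := ltW k2; rewrite mulrC mulrDl; lra.
have := hd (tk k) kd; rewrite Int_eta mul1r => h1.
have cm := @m_cont (tk k) (tk0 k).
have cGk : continuous (Gk k) by move=> x; exact: is_derive1_continuous (Gk_is_derive k x).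
have ibp : Int J1 J2 (fun x => Gk k x * psi^`()%classic x) =
    - Int J1 J2 (fun x => psi x * mean F (@eta R) x (tk k)).
  rewrite (Int_parts J1 J2 cm cdpsi (Gk_is_derive k) (fun x => smooth_is_derive x spsi)).
  rewrite (vpsi J1); last by rewrite /J1 /H ha.
  rewrite (vpsi J2); last by rewrite /J2 /H hb orbT.
  by rewrite !mulr0 subrr sub0r; under eq_fun do rewrite mulrC.
have h2 : `|Int J1 J2 (fun x => (G x - Gk k x) * psi^`()%classic x)| <= e / 2.
  apply: le_trans kC; rewrite /C.
  rewrite (_ : 2 * (4 * M * tau) * D * (J2 - J1) * 3^-1 ^+ k =
     (2 * (4 * M * tau) * 3^-1 ^+ k * D) * (J2 - J1)); last by ring.
  apply: Int_norm_le; last 2 first.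
  - exact: J12.
  - move=> x xJ; rewrite normrM; apply: ler_pM => //.
      by have := hG x k; rewrite clampE.
    exact: hD.
  apply: (@continuousMf _ (fun x => G x - Gk k x)) => //.
  by move=> x; apply: cvgB; [exact: cG|exact: cGk].
have -> : F psi + Int J1 J2 (fun x => G x * psi^`()%classic x) =
    Int J1 J2 (fun x => (G x - Gk k x) * psi^`()%classic x) -
    (Int J1 J2 (fun x => psi x * mean F (@eta R) x (tk k)) - F psi).
  have -> : (fun x => (G x - Gk k x) * psi^`()%classic x) =
     (fun x => G x * psi^`()%classic x - Gk k x * psi^`()%classic x).
    by apply/funext => x; rewrite mulrBl.
  by rewrite IntB; [rewrite ibp; ring|exact: continuousMf..].
apply: le_trans (ler_normB _ _) _; lra.
Qed.

End primitive_function.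

(** * Maximum principle *)

Section maximum_principle.
Variable R : realType.
Variables (f F : Dprime R) (G : R -> R) (x0 H M : R).
Hypothesis fF : is_derivative_of f F.
Hypothesis M0 : 0 <= M.
Hypothesis GL : forall x y, `|G x - G y| <= M * `|x - y|.
Hypothesis FG : forall psi (a b : R), x0 - H < a -> b < x0 + H -> testf a b psi ->
  F psi = - Int (x0 - H) (x0 + H) (fun x => G x * psi^`()%classic x).
Implicit Types (x y z t s e a b c h l A B kappa : R) (w psi : R -> R).

Let cG : continuous G := lipschitz_continuous GL.

(** [E] has no value at 0, so its limit [v] there is expressed by the lower bound [v - L s]. The
    strict increase between two positive points leaves a gap below [v] that persists for all smaller
    [s]. *)
Lemma increasing_bounded_absurd (E : R -> R) v s1 : 0 < s1 ->
  (forall a b, 0 < a -> a < b -> b < s1 -> E a < E b) ->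
  (forall s, 0 < s -> s <= s1 -> E s <= v) ->
  (exists2 L, 0 <= L & forall s, 0 < s -> s <= s1 -> v - L * s <= E s) -> False.
Proof.
move=> s10 Einc Eup Elow.
have [L L0 hL] := Elow.
pose a := s1 / 3; pose b := s1 / 2.
have ab : E a < E b by apply: Einc; rewrite /a /b; lin.
have bup : E b <= v by apply: Eup; rewrite /b; lin.
pose d := E b - E a.
have d0 : 0 < d by rewrite subr_gt0.
pose s := Num.min (a / 2) (d / (L + 1)).
have L1 : 0 < L + 1 by lin.
have a0 : 0 < a by rewrite /a; lin.
have sp : 0 < s by rewrite lt_min !divr_gt0.
have sa : s <= a / 2 by rewrite ge_min lexx.
have sd : s * (L + 1) <= d by rewrite -ler_pdivlMr// ge_min lexx orbT.
have ss1 : s <= s1 by rewrite /a in sa; lin.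
have h1 := hL s sp ss1.
have h2 : E s < E a by apply: Einc => //; rewrite /a in sa a0 *; lin.
rewrite /d in sd; lin.
Qed.

(** The average at scale [s] of the perturbed [G] with weight [w] is at most its value at the
    maximum and tends to it as [s] decreases to 0. Its derivative in [s] is the expression assumed
    positive, so it would increase away from its upper bound. *)
Lemma no_local_max w B xs r kappa A s0 : 0 < B -> testf (- B) B w ->
  (forall z, 0 <= w z) -> 0 < r -> x0 - H <= xs - r -> xs + r <= x0 + H ->
  (forall h, `|h| < r -> G (xs + h) + kappa * h + A / 2 * h ^+ 2 <= G xs) ->
  0 < s0 ->
  (forall s, 0 < s < s0 -> 0 < mean F (fun z => z * w z) xs s +
     kappa * Int (- B) B (fun z => z * w z) +
     s * (A * Int (- B) B (fun z => z ^+ 2 * w z))) -> False.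
Proof.
move=> B0 tw w0 r0 xr1 xr2 hmax s00 hpos.
have [sw vw] := tw; have cw := smooth_continuous sw.
have BB : - B <= B by lin.
(* Differences of the averages of [G] are, up to sign, [F] applied to differences of rescaled [N],
   so the derivative in the scale is supplied by [rescale_is_derive]. *)
pose N y := Int (- B) y w.
have dN y : is_derive y (1 : R) N (w y) by exact: Int_is_derive.
have sN : smooth N by exact: smooth_antiderivative dN sw.
have N' : N^`()%classic = w by exact: derive1_funE dN.
have vN' : vanish_out (- B) B N^`()%classic by rewrite N'.
have dilN : dil 0 N = (fun z => -1 * (z * w z)).
  by apply/funext => z; rewrite /dil N'; ring.
have tzw : testf (- B) B (fun z => z * w z).
  split; last exact: vanish_outMr.
  by apply: smoothM; [exact: smooth_id|exact: sw].
have czw : continuous (fun z => z * w z).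
  by apply: smooth_continuous; case: tzw.
have czzw : continuous (fun z => z ^+ 2 * w z).
  by apply: continuousMf => //; exact: exprn_continuous.
set m1 := Int (- B) B (fun z => z * w z) in hpos *.
set m2 := Int (- B) B (fun z => z ^+ 2 * w z) in hpos *.
pose m0 := Int (- B) B w.
have m00 : 0 <= m0 by apply: Int_ge0.
pose s1 := Num.min (Num.min s0 1) (r / (2 * B)).
have s10 : 0 < s1 by rewrite !lt_min s00 ltr01 divr_gt0// mulr_gt0.
have s1s0 : s1 <= s0 by rewrite /s1 !ge_min lexx.
have s11 : s1 <= 1 by rewrite /s1 !ge_min lexx orbT.
have s1B : s1 * B <= r / 2.
  have : s1 <= r / (2 * B) by rewrite ge_min lexx orbT.
  by rewrite invfM mulrA ler_pdivlMr.
have cGs s : continuous (fun z => G (s * z + xs)) by exact: continuous_affine.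
have cwG s : continuous (fun z => w z * G (s * z + xs)) by exact: continuousMf.
pose WG s := Int (- B) B (fun z => w z * G (s * z + xs)).
pose E s := WG s + s * (kappa * m1) + s ^+ 2 / 2 * (A * m2).
have sz s z : 0 < s -> s <= s1 -> - B <= z <= B -> `|s * z| < r.
  move=> sp ss zB; rewrite normrM (gtr0_norm sp).
  apply: le_lt_trans (_ : r / 2 < r); last by lin.
  apply: le_trans s1B; apply: ler_pM => //; first exact: ltW.
  by rewrite ler_norml.
have Eup s : 0 < s -> s <= s1 -> E s <= m0 * G xs.
  move=> sp ss.
  have -> : E s = Int (- B) B (fun z => w z * (G (s * z + xs) + kappa * (s * z) +
      A / 2 * (s * z) ^+ 2)).
    have -> : (fun z => w z * (G (s * z + xs) + kappa * (s * z) + A / 2 * (s * z) ^+ 2)) =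
      (fun z => (s * kappa) * (z * w z) + (s ^+ 2 / 2 * A * (z ^+ 2 * w z) + w z * G (s * z + xs))).
      by apply/funext => z; ring.
    rewrite Int_lin//; last by apply: continuous_lin.
    by rewrite Int_lin// /E /WG -/m1 -/m2; ring.
  have -> : m0 * G xs = Int (- B) B (fun z => G xs * w z) by rewrite IntZ// mulrC.
  apply: Int_le => //.
  - apply: continuousMf => // z; apply: cvgD; first apply: cvgD.
    + exact: cGs.
    + by apply: cvgM; [exact: cvg_cst|apply: cvgM; [exact: cvg_cst|exact: cvg_id]].
    + apply: cvgM; first exact: cvg_cst.
      apply: (@continuous_comp _ _ _ (fun z => s * z) (fun z => z ^+ 2)).
        by apply: cvgM; [exact: cvg_cst|exact: cvg_id].
      exact: exprn_continuous.
  - by apply: continuousMf => //; exact: cst_continuous.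
  move=> z zB; rewrite mulrC; apply: ler_wpM2r => //.
  by rewrite (addrC _ xs); apply: hmax; exact: sz.
have Elow : exists2 L, 0 <= L & forall s, 0 < s -> s <= s1 -> m0 * G xs - L * s <= E s.
  exists (m0 * (M * B) + `|kappa * m1| + `|A * m2|); first by rewrite !addr_ge0// !mulr_ge0// ltW.
  move=> s sp ss.
  have h1 : m0 * G xs - m0 * (M * B) * s <= WG s.
    rewrite (_ : _ - _ = (G xs - M * B * s) * m0); last by ring.
    rewrite /m0 -IntZ//; apply: Int_le => //.
      by apply: continuousMf => //; exact: cst_continuous.
    move=> z zB; rewrite mulrC; apply: ler_wpM2l => //.
    have := GL (s * z + xs) xs; rewrite addrK normrM (gtr0_norm sp) ler_norml => /andP[h _].
    have h2 : M * (s * `|z|) <= M * B * s.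
      rewrite -mulrA ler_wpM2l// mulrC ler_wpM2r//; first exact: ltW.
      by rewrite ler_norml.
    lin.
  have h2 : - `|kappa * m1| * s <= s * (kappa * m1).
    by rewrite mulrC ler_wpM2l ?(ltW sp)// lerNl -normrN ler_norm.
  have h3 : - `|A * m2| * s <= s ^+ 2 / 2 * (A * m2).
    have k1 : - `|A * m2| * (s ^+ 2 / 2) <= s ^+ 2 / 2 * (A * m2).
      rewrite mulrC ler_wpM2l//; first by rewrite divr_ge0// sqr_ge0.
      by rewrite lerNl -normrN ler_norm.
    apply: le_trans k1; rewrite !mulNr lerN2; apply: ler_wpM2l => //.
    rewrite expr2; have : s * s <= s * 1 by rewrite ler_wpM2l ?(ltW sp)//; lin.
    lin.
  rewrite /E; lin.
have Einc a b : 0 < a -> a < b -> b < s1 -> E a < E b.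
  move=> a0 ab bs.
  have b0 : 0 < b := lt_trans a0 ab.
  have tpsi s : 0 < s -> s < s1 -> testf (xs - r / 2) (xs + r / 2)
      (fun y => rescale N xs s y - rescale N xs b y).
    move=> sp ss; have mm : Num.max s b <= s1 by rewrite ge_max !ltW.
    have h : Num.max s b * B <= r / 2.
      by apply: le_trans s1B; rewrite ler_wpM2r// ltW.
    by apply: testf_sub (rescaleB_testf xs sN B0 vN' sp b0); lin.
  have WGE s : 0 < s -> s < s1 ->
      WG s - WG b = - F (fun y => rescale N xs s y - rescale N xs b y).
    move=> sp ss; rewrite (FG _ _ (tpsi s sp ss)); [|lin|lin].
    rewrite opprK.
    have dpsi : (fun y => rescale N xs s y - rescale N xs b y)^`()%classic =
        (fun y => s^-1 * rescale w xs s y - b^-1 * rescale w xs b y).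
      apply: derive1_funE => y; rewrite !rescaleE.
      have h1 := is_derive_affine (dN (s^-1 * y + (- xs / s))).
      have h2 := is_derive_affine (dN (b^-1 * y + (- xs / b))).
      exact: (is_deriveB h1 h2).
    have WE v : 0 < v -> v < s1 ->
        WG v = Int (x0 - H) (x0 + H) (fun y => v^-1 * (rescale w xs v y * G y)).
      move=> vp vs.
      have cr : continuous (fun y => rescale w xs v y * G y).
        by apply: continuousMf => //; apply: smooth_continuous; exact: rescale_smooth.
      have vB : v * B <= r / 2 by apply: le_trans s1B; rewrite ler_wpM2r// ltW.
      rewrite IntZ// (@Int_widen _ _ (xs - v * B) (xs + v * B))//.
      - have := @Int_affine R _ (- B) B v xs cr.
        rewrite (_ : v * - B + xs = xs - v * B); last by ring.
        rewrite (_ : v * B + xs = xs + v * B); last by ring.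
        move=> <-; rewrite mulKf ?gt_eqF// /WG; congr Int; apply/funext => z.
        by rewrite /rescale addrK mulrAC divff ?mul1r ?gt_eqF.
      - lin.
      - have := mulr_gt0 vp B0; lin.
      - lin.
      - move=> y yo; rewrite (_ : rescale w xs v y = 0) ?mul0r//.
        by apply: (rescale_vanish_out (x := xs) vp vw); rewrite mulrN.
    rewrite (WE s)// (WE b)// -IntB.
    - congr Int; apply/funext => y; rewrite dpsi; ring.
    - apply: continuousMf; first exact: cst_continuous.
      by apply: continuousMf => //; apply: smooth_continuous; exact: rescale_smooth.
    - apply: continuousMf; first exact: cst_continuous.
      by apply: continuousMf => //; apply: smooth_continuous; exact: rescale_smooth.
  (* [P] equals [E] up to the constant [WG b], and it is differentiable through the distribution
     although [G] is only Lipschitz. *)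
  pose P s := - F (fun y => rescale N xs s y - rescale N xs b y) +
    (s * (kappa * m1) + s ^+ 2 / 2 * (A * m2)).
  have EP s : 0 < s -> s < s1 -> E s = P s + WG b.
    by move=> sp ss; rewrite /E /P -WGE//; ring.
  have as1 : a < s1 := lt_trans ab bs.
  rewrite EP// EP// ltrD2r -subr_gt0.
  have dP s : 0 < s -> is_derive s (1 : R) P (mean F (fun z => z * w z) xs s + kappa * m1 +
      s * (A * m2)).
    move=> sp.
    have h1 := is_deriveN (rescale_is_derive F xs sN B0 vN' sp b0).
    have h2 := is_deriveMf (is_derive_id s (1 : R)) (is_derive_cst (kappa * m1) s (1 : R)).
    have h3 := is_deriveZf (A * m2 / 2) (is_deriveMf (is_derive_id s (1 : R)) (is_derive_id s (1 : R))).
    have h := is_deriveD h1 (is_deriveD h2 h3).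
    have E1 : P = (fun s => - F (fun y => rescale N xs s y - rescale N xs b y)) \+
       ((fun y => id y * cst (kappa * m1) y) \+ (fun y => A * m2 / 2 * (id y * id y))).
      by apply/funext => v; rewrite /P /=; ring.
    rewrite E1; apply: (is_derive_eq h).
    have -> : mean F (dil 0 N) xs s = - mean F (fun z => z * w z) xs s.
      have := mean_lin F (-1) xs sp tzw (testf0 (- B) B).
      rewrite dilN; under eq_fun do rewrite addr0.
      by move=> ->; rewrite {2}/mean /rescale Dprime0 mulr0 addr0 mulN1r.
    rewrite opprK /= mulr0 add0r mul1r mulr1 mul1r -addrA.
    by congr (_ + (_ + _)); field.
  have [||v vab ->] := @MVT R P (fun s => mean F (fun z => z * w z) xs s + kappa * m1 + s * (A * m2)) a b ab.
  - by move=> v; rewrite in_itv/= => /andP[va vb]; apply: dP; exact: lt_trans va.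
  - move=> /= v; apply: continuous_in_subspaceT => {}v /set_mem /=.
    rewrite in_itv/= => /andP[va vb].
    by apply: is_derive1_continuous; apply: dP; exact: lt_le_trans va.
  move: vab; rewrite in_itv/= => /andP[va vb].
  rewrite mulr_gt0 ?subr_gt0//; apply: hpos; rewrite (lt_trans a0 va) /=.
  by apply: lt_le_trans s1s0; apply: lt_trans vb bs.
exact: increasing_bounded_absurd s10 Einc Eup Elow.
Qed.

End maximum_principle.

Section lower_bound_from_primitive.
Variable R : realType.
Variables (f F : Dprime R) (G : R -> R) (x0 H M : R).
Hypothesis fF : is_derivative_of f F.
Hypothesis M0 : 0 <= M.
Hypothesis GL : forall x y, `|G x - G y| <= M * `|x - y|.
Hypothesis FG : forall psi (a b : R), x0 - H < a -> b < x0 + H -> testf a b psi ->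
  F psi = - Int (x0 - H) (x0 + H) (fun x => G x * psi^`()%classic x).
Implicit Types (x y z t s e a b c h l A B kappa : R) (w psi : R -> R).

Let cG : continuous G := lipschitz_continuous GL.

(** The derivative of [phi] is [- z * weight z], so moving the derivative from [f = F'] to the
    kernel gains one factor [s]. This factor makes the bound on [f] comparable with the quadratic
    term in [no_local_max]. *)
Lemma mean_zweight x s : 0 < s ->
  mean F (fun z => z * @weight R z) x s = s * mean f (@phi R) x s.
Proof.
move=> s0; have tp := rescale_testf x s0 (@testf_phi R).
rewrite /mean (fF (testf_test tp)).
have tz : testf (-1) 1 (fun z => z * @weight R z).
  have [sw vw] := @testf_weight R; split; last exact: vanish_outMr.
  by apply: smoothM; [exact: smooth_id|exact: sw].
have tr := rescale_testf x s0 tz.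
have -> : (rescale (@phi R) x s)^`()%classic =
    (fun y => - s^-1 * rescale (fun z => z * @weight R z) x s y).
  apply: derive1_funE => y; rewrite rescaleE.
  have h := is_derive_affine (phi_is_derive (s^-1 * y + (- x / s))).
  by apply: (is_derive_eq h); rewrite rescaleE; ring.
rewrite (DprimeZ F _ tr); field; by rewrite gt_eqF.
Qed.

(** For [weight] the first moment is 0, so the slope [kappa] disappears, and the second moment is 1:
    the derivative of the averages is at least [s * (A - n)]. *)
Lemma no_max_regular xs r kappa A n s0 : 0 < r -> x0 - H <= xs - r -> xs + r <= x0 + H ->
  n < A -> 0 < s0 -> (forall s, 0 < s < s0 -> - n <= mean f (@phi R) xs s) ->
  ~ (forall h, `|h| < r -> G (xs + h) + kappa * h + A / 2 * h ^+ 2 <= G xs).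
Proof.
move=> r0 h1 h2 nA s00 hs hmax.
apply: (no_local_max M0 GL FG ltr01 (@testf_weight R) (@weight_ge0 R) r0 h1 h2 hmax s00).
move=> s ss; have s0' : 0 < s by case/andP: ss.
rewrite mean_zweight// Int_zweight mulr0 addr0 Int_z2weight mulr1 -mulrDr.
by rewrite mulr_gt0//; have := hs s ss; lin.
Qed.

Let testf_eta_shift c : `|c| = 2 -> testf (- 3) 3 (fun y => @eta R (1 * y + - c)).
Proof.
move=> c2; have [se ve] := @testf_eta R; split; first exact: smooth_affine.
have c3 : `|c| <= 2 by rewrite c2.
move: c3; rewrite ler_norml => /andP[a1 a2].
by move=> y /orP[h|h]; apply: ve; apply/orP; [left|right]; lin.
Qed.

Let Int_z_eta_shift c : `|c| = 2 -> 0 < c * Int (-3) 3 (fun z => z * @eta R (1 * z + - c)).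
Proof.
move=> c2; have te := testf_eta_shift c2.
have ce : continuous (fun z => @eta R (1 * z + - c)).
  by apply: continuous_affine; exact: eta_continuous.
have cze : continuous (fun z => z * @eta R (1 * z + - c)).
  by apply: continuousMf => //; move=> z; exact: cvg_id.
have c3 : `|c| <= 2 by rewrite c2.
have cc : c * c = 4 by rewrite -expr2 -real_normK ?num_real// c2; ring.
rewrite -IntZ//.
(* On the support of the shifted kernel [z] is within 1 of [c = 2] or [c = -2], hence
   [c * z >= 2]. *)
apply: lt_le_trans (_ : 2 * Int (-3) 3 (fun z => @eta R (1 * z + - c)) <= _).
  move: c3; rewrite ler_norml => /andP[a1 a2].
  rewrite (@Int_widen _ _ (c - 1) (c + 1))//; try lin.
    have := @Int_affine R (@eta R) (c - 1) (c + 1) 1 (- c) (@eta_continuous R).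
    rewrite mul1r => ->; rewrite !mul1r.
    rewrite (_ : c - 1 - c = -1); last by ring.
    by rewrite (_ : c + 1 - c = 1) ?Int_eta; [lin|ring].
  by move=> y yo; apply: eta0; case/orP: yo => h; apply/orP; [left|right]; lin.
rewrite -IntZ//; apply: Int_le => //.
- by apply: continuousMf => //; exact: cst_continuous.
- by apply: continuousMf => //; exact: cst_continuous.
- by lin.
move=> z _; rewrite mulrA.
have [h|h] := boolP ((1 * z + - c <= -1) || (1 <= 1 * z + - c)).
  by rewrite eta0// !mulr0.
move: h; rewrite negb_or -!ltNge => /andP[b1 b2].
apply: ler_wpM2r; first exact: eta_ge0.
move: c3; rewrite ler_norml => /andP[a1 a2].
have [cp|cn] := leP 0 c.
  have c2' : c = 2 by rewrite -c2 ger0_norm.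
  by rewrite c2' in b1 b2 *; lin.
have c2' : c = -2 by rewrite -c2 ltr0_norm// opprK.
by rewrite c2' in b1 b2 *; lin.
Qed.

(** The slope of [G] at [xs] is [gamma], so a maximum needs [gamma + kappa = 0]. Otherwise a kernel
    lying on one side of 0, the side given by the sign of [gamma + kappa], has a first moment of
    that sign and makes the averages increase. *)
Lemma no_max_value xs r kappa A gamma : 0 < r -> x0 - H <= xs - r -> xs + r <= x0 + H ->
  0 < A -> has_point_value F xs gamma -> gamma + kappa != 0 ->
  ~ (forall h, `|h| < r -> G (xs + h) + kappa * h + A / 2 * h ^+ 2 <= G xs).
Proof.
move=> r0 h1 h2 A0 hv gk hmax.
pose c : R := if 0 < gamma + kappa then 2 else -2.
have c2 : `|c| = 2.
  by rewrite /c; case: ifP => _; rewrite ?normrN ger0_norm.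
have te := testf_eta_shift c2; have ci := Int_z_eta_shift c2.
set w := (fun y => @eta R (1 * y + - c)) in te ci.
set m1 := Int (-3) 3 _ in ci.
have gm : 0 < (gamma + kappa) * m1.
  move: ci; rewrite /c; case: ifPn => [p|].
    by rewrite pmulr_rgt0// => m; rewrite mulr_gt0.
  rewrite -leNgt => p; rewrite mulNr oppr_gt0 pmulr_rlt0// => m.
  by rewrite nmulr_rgt0// lt_neqAle gk.
have tzw : testf (- 3) 3 (fun z => z * w z).
  have [sw vw] := te; split; last exact: vanish_outMr.
  by apply: smoothM; [exact: smooth_id|exact: sw].
have l33 : (- 3 : R) < 3 by lin.
have p30 : (0 : R) < 3 by lin.
have e0 : 0 < (gamma + kappa) * m1 / 2 by rewrite divr_gt0.
have [d d0 hd] := point_value_mean hv l33 tzw e0.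
apply: (no_local_max M0 GL FG p30 te (fun z => @eta_ge0 R _) r0 h1 h2 hmax d0).
move=> s sd; have s0 : 0 < s by case/andP: sd.
have := hd s sd; rewrite ler_norml => /andP[k1 _].
have k2 : 0 <= s * (A * Int (-3) 3 (fun z => z ^+ 2 * w z)).
  rewrite mulr_ge0// ?(ltW s0)// mulr_ge0// ?(ltW A0)//; apply: Int_ge0.
  - apply: continuousMf; first exact: exprn_continuous.
    by apply: smooth_continuous; case: te.
  - by lin.
  - by move=> z _; rewrite mulr_ge0 ?sqr_ge0//; exact: eta_ge0.
move: k1 gm; rewrite -/m1 mulrDl; lin.
Qed.

Variables (n gamma e0 : R).
Hypothesis n0 : 0 <= n.
Hypothesis hreg : forall xs, x0 - H < xs < x0 + H -> xs != e0 ->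
  exists2 s0, 0 < s0 & forall s, 0 < s < s0 -> - n <= mean f (@phi R) xs s.
Hypothesis hval : has_point_value F e0 gamma.

(* If the quadratic perturbation of [G] had an interior maximum, tilting it by
   two different slopes would put one of the maxima away from [e0], or contradict the
   value of [F] at [e0]. *)
Lemma second_difference_ge A x h : n < A -> 0 < h -> x0 - H < x - h -> x + h < x0 + H ->
  - (A * h ^+ 2) <= G (x + h) + G (x - h) - 2 * G x.
Proof.
move=> nA h0 hx1 hx2; rewrite leNgt; apply/negP => hneg.
pose D := 2 * G x - G (x + h) - G (x - h) - A * h ^+ 2.
have D0 : 0 < D by rewrite /D; lin.
pose l0 := (G (x + h) - G (x - h)) / (2 * h).
pose v l y := G y + (A / 2 * (y - x) ^+ 2 + - l * (y - x)).
have cv l : continuous (v l).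
  move=> y; apply: cvgD; first exact: cG.
  apply: cvgD; apply: cvgM; try exact: cvg_cst.
    apply: (@continuous_comp _ _ _ (fun z => z - x) (fun z => z ^+ 2)).
      by apply: cvgB; [exact: cvg_id|exact: cvg_cst].
    exact: exprn_continuous.
  by apply: cvgB; [exact: cvg_id|exact: cvg_cst].
have l0h : l0 * h = (G (x + h) - G (x - h)) / 2 by rewrite /l0; field; rewrite gt_eqF.
(* With slope [l0] both end values equal [G x - D / 2], so for [|e * h| < D / 2] the maximum stays
   inside. It must sit at [e0], where [no_max_value] yields this equation; two values of [e] cannot
   both satisfy it. *)
have key e : `|e * h| < D / 2 -> gamma + (A * (e0 - x) - (l0 + e)) = 0.
  move=> eh.
  have cve : {within `[x - h, x + h], continuous (v (l0 + e))}.
    exact: continuous_subspaceT.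
  have xhh : x - h <= x + h by lin.
  have [ys ysI hys] := EVT_max xhh cve.
  rewrite in_itv/= in ysI; case/andP: ysI => ys1 ys2.
  have vx : G x <= v (l0 + e) ys.
    have -> : G x = v (l0 + e) x by rewrite /v subrr; ring.
    by apply: hys; rewrite in_itv/=; apply/andP; split; lin.
  move: eh; rewrite ltr_norml => /andP[eh1 eh2].
  have ve1 : v (l0 + e) (x + h) < G x.
    rewrite /v (_ : x + h - x = h); last by ring.
    rewrite (_ : - (l0 + e) * h = - (l0 * h) - e * h); last by ring.
    rewrite l0h; move: D0 eh1 eh2; rewrite /D; lin.
  have ve2 : v (l0 + e) (x - h) < G x.
    rewrite /v (_ : x - h - x = - h); last by ring.
    rewrite (_ : - (l0 + e) * - h = (l0 * h) + e * h); last by ring.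
    rewrite sqrrN l0h; move: D0 eh1 eh2; rewrite /D; lin.
  have yn1 : ys != x - h by apply: contraTneq vx => ->; rewrite -ltNge.
  have yn2 : ys != x + h by apply: contraTneq vx => ->; rewrite -ltNge.
  have ys1' : x - h < ys by rewrite lt_neqAle eq_sym yn1.
  have ys2' : ys < x + h by rewrite lt_neqAle yn2.
  pose r := Num.min (ys - (x - h)) (x + h - ys).
  have r0 : 0 < r by rewrite lt_min !subr_gt0 ys1' ys2'.
  have r1 : r <= ys - (x - h) by rewrite ge_min lexx.
  have r2 : r <= x + h - ys by rewrite ge_min lexx orbT.
  have loc k : `|k| < r -> G (ys + k) + (A * (ys - x) - (l0 + e)) * k + A / 2 * k ^+ 2 <= G ys.
    rewrite ltr_norml => /andP[k1 k2].
    have : v (l0 + e) (ys + k) <= v (l0 + e) ys.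
      by apply: hys; rewrite in_itv/=; apply/andP; split; lin.
    rewrite /v => hh.
    rewrite (_ : _ + _ + _ = G (ys + k) + (A / 2 * (ys + k - x) ^+ 2 + - (l0 + e) * (ys + k - x))
      - (A / 2 * (ys - x) ^+ 2 + - (l0 + e) * (ys - x))); last by field.
    by rewrite lerBlDr.
  have b1 : x0 - H <= ys - r by lin.
  have b2 : ys + r <= x0 + H by lin.
  have yI : x0 - H < ys < x0 + H by apply/andP; split; lin.
  have [ye|ye] := eqVneq ys e0.
    apply/eqP; apply/negPn/negP => nz; rewrite -ye in nz.
    have hval' := hval; rewrite -ye in hval'.
    by apply: (no_max_value r0 b1 b2 _ hval' nz loc); have := n0; lin.
  have [s0 s00 hs] := hreg yI ye.
  by exfalso; exact: (no_max_regular r0 b1 b2 nA s00 hs loc).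
have k1 : gamma + (A * (e0 - x) - (l0 + 0)) = 0.
  by apply: key => //; rewrite mul0r normr0 divr_gt0.
have k2 : gamma + (A * (e0 - x) - (l0 + D / 4 / h)) = 0.
  apply: key => //; rewrite divfK ?gt_eqF// gtr0_norm ?divr_gt0//; lin.
have : D / 4 / h = 0 by lin.
by apply/eqP; rewrite gt_eqF// !divr_gt0.
Qed.

Lemma second_difference_taylor psi D3 y h : smooth psi -> 0 <= D3 ->
  (forall x, `|psi^`(3)%classic x| <= D3) -> 0 < h ->
  `|psi (1 * y + h) + psi (1 * y + - h) - 2 * psi y - h ^+ 2 * psi^`(2)%classic y|
    <= 2 * D3 * h ^+ 3.
Proof.
move=> spsi D30 hD3 h0.
pose k s := psi (1 * s + y) + psi (-1 * s + y) - s ^+ 2 * psi^`(2)%classic y.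
pose k' s := psi^`()%classic (1 * s + y) - psi^`()%classic (-1 * s + y) -
  2 * s * psi^`(2)%classic y.
have dk s : is_derive s (1 : R) k (k' s).
  have e1 := is_derive_affine (smooth_is_derive (1 * s + y) spsi).
  have e2 := is_derive_affine (smooth_is_derive (-1 * s + y) spsi).
  have e3 := is_deriveZf (psi^`(2)%classic y)
    (is_deriveMf (is_derive_id s (1 : R)) (is_derive_id s (1 : R))).
  have e := is_deriveB (is_deriveD e1 e2) e3.
  have -> : k = ((fun y0 => psi (1 * y0 + y)) \+ (fun y0 => psi (-1 * y0 + y))) \-
     (fun y0 => psi^`(2)%classic y * (id y0 * id y0)).
    by apply/funext => z; rewrite /k /=; ring.
  by apply: (is_derive_eq e); rewrite /k'; ring.
have := @MVT_le R k k' (2 * D3 * h ^+ 2) 0 h (fun z _ => dk z).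
have -> : k 0 = 2 * psi y by rewrite /k !mulr0 add0r expr0n /=; ring.
have -> : k h - 2 * psi y = psi (1 * y + h) + psi (1 * y + - h) - 2 * psi y - h ^+ 2 * psi^`(2)%classic y.
  rewrite /k (_ : 1 * h + y = 1 * y + h); last by ring.
  by rewrite (_ : -1 * h + y = 1 * y + - h); ring.
rewrite subr0 (gtr0_norm h0) (_ : 2 * D3 * h ^+ 3 = 2 * D3 * h ^+ 2 * h); last by ring.
apply => z zI.
have [z1 z2] : 0 <= z /\ z <= h by case/orP: zI => /andP[]; split; lin.
have t1 := @taylor2_le R psi^`()%classic psi^`(2)%classic psi^`(3)%classic D3 (h + 1) y z.
have t2 := @taylor2_le R psi^`()%classic psi^`(2)%classic psi^`(3)%classic D3 (h + 1) y (- z).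
have zn : `|z| < h + 1 by rewrite ger0_norm//; lin.
have {}t1 := t1 zn (fun v _ => smooth_derivn_is_derive 1 v spsi)
  (fun v _ => smooth_derivn_is_derive 2 v spsi) (fun v _ => hD3 v).
have zn' : `|- z| < h + 1 by rewrite normrN.
have {}t2 := t2 zn' (fun v _ => smooth_derivn_is_derive 1 v spsi)
  (fun v _ => smooth_derivn_is_derive 2 v spsi) (fun v _ => hD3 v).
rewrite /k' (_ : _ - _ = (psi^`()%classic (y + z) - psi^`()%classic y - z * psi^`(2)%classic y) -
  (psi^`()%classic (y - z) - psi^`()%classic y - (- z) * psi^`(2)%classic y)); last first.
  by rewrite mul1r (addrC z) mulN1r (addrC (- z)); ring.
apply: le_trans (ler_normB _ _) _.
apply: le_trans (lerD t1 t2) _; rewrite normrN (ger0_norm z1).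
have zz : z ^+ 2 <= h ^+ 2 by rewrite lerXn2r// ?nnegrE// ltW.
have := ler_wpM2l D30 zz; lin.
Qed.

(** [f psi] is the integral of [G] against the second derivative of [psi]. That derivative is
    replaced by a second difference, which is shifted onto [G] and bounded below by [- A h^2]; the
    error is O(h) after division by [h^2]. *)
Lemma bounded_below_of_primitive A a b : n < A -> x0 - H < a -> a <= b -> b < x0 + H ->
  bounded_below f A a b.
Proof.
move=> nA ha ab hb psi tp psi0.
have [spsi vpsi] := tp.
have cpsi := smooth_continuous spsi.
have cd2 : continuous psi^`(2)%classic by apply/smooth_continuous/smooth_derivn.
have -> : f psi = Int (x0 - H) (x0 + H) (fun x => G x * psi^`(2)%classic x).
  rewrite (fF (testf_test tp)) (FG ha hb (testf_deriv tp)) opprK.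
  by congr Int; apply/funext => x; rewrite derive1nS derive1n1.
have Hp : 0 < H by lin.
have HH : x0 - H <= x0 + H by lin.
have [D3 D30 hD3] := testf_bounded_derivn 3 tp.
have [MG MG0 hMG] := @bounded_on_itv R (x0 - H) (x0 + H) G cG.
pose C := MG * (2 * D3) * (2 * H).
have C0 : 0 <= C by rewrite !mulr_ge0// ltW.
pose I0 := Int a b psi.
set I2 := Int (x0 - H) (x0 + H) _; rewrite -/I0.
(* The conditions on [h] keep the support of the shifted test functions inside the interval where
   [G] represents [F]. *)
have key h : 0 < h -> x0 - H < a - h -> b + h < x0 + H -> - A * I0 <= I2 + C * h.
  move=> h0 h1 h2.
  have cs : continuous (fun y => psi (1 * y + h)) by exact: continuous_affine.
  have cs' : continuous (fun y => psi (1 * y + - h)) by exact: continuous_affine.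
  pose dl y := psi (1 * y + h) + psi (1 * y + - h) - 2 * psi y.
  have cdl : continuous dl.
    move=> y; apply: cvgB; first by apply: cvgD; [exact: cs|exact: cs'].
    by apply: cvgM; [exact: cvg_cst|exact: cpsi].
  have shift k : `|k| <= h -> Int (x0 - H) (x0 + H) (fun y => G y * psi (1 * y + k)) =
     Int (x0 - H) (x0 + H) (fun y => G (1 * y + - k) * psi y).
    rewrite ler_norml => /andP[k1 k2].
    have cGk : continuous (fun y => G (1 * y + - k) * psi y).
      by apply: continuousMf => //; exact: continuous_affine.
    have cGs : continuous (fun y => G y * psi (1 * y + k)).
      by apply: continuousMf => //; exact: continuous_affine.
    rewrite [LHS](@Int_widen _ _ (a - k) (b - k))//; try lin; last first.
      move=> y yo; rewrite (vpsi (1 * y + k)) ?mulr0//.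
      by case/orP: yo => yo; apply/orP; [left|right]; lin.
    rewrite [RHS](@Int_widen _ _ a b)//; try lin; last first.
      by move=> y yo; rewrite vpsi ?mulr0.
    have := @Int_affine R _ (a - k) (b - k) 1 k cGk.
    rewrite mul1r (_ : 1 * (a - k) + k = a); last by ring.
    rewrite (_ : 1 * (b - k) + k = b); last by ring.
    by move=> <-; congr Int; apply/funext => y; congr (G _ * _); ring.
  have S1 : Int (x0 - H) (x0 + H) (fun y => G y * dl y) =
     Int (x0 - H) (x0 + H) (fun y => (G (1 * y + - h) + G (1 * y + h) - 2 * G y) * psi y).
    have cc1 : continuous (fun y => G y * psi (1 * y + h)) by exact: continuousMf.
    have cc2 : continuous (fun y => G y * psi (1 * y + - h)) by exact: continuousMf.
    have cc3 : continuous (fun y => G y * psi y) by exact: continuousMf.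
    have cc4 : continuous (fun y => G (1 * y + - h) * psi y).
      by apply: continuousMf => //; exact: continuous_affine.
    have cc5 : continuous (fun y => G (1 * y + h) * psi y).
      by apply: continuousMf => //; exact: continuous_affine.
    have -> : (fun y => G y * dl y) = (fun y => -2 * (G y * psi y) +
       (G y * psi (1 * y + h) + G y * psi (1 * y + - h))).
      by apply/funext => y; rewrite /dl; ring.
    have -> : (fun y => (G (1 * y + - h) + G (1 * y + h) - 2 * G y) * psi y) =
      (fun y => -2 * (G y * psi y) + (G (1 * y + - h) * psi y + G (1 * y + h) * psi y)).
      by apply/funext => y; ring.
    rewrite !Int_lin//; try by move=> y; apply: cvgD; [exact: cc1|exact: cc2].
      rewrite !IntD// (shift h) ?gtr0_norm// (shift (- h)) ?normrN ?gtr0_norm//.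
      by rewrite opprK.
    by move=> y; apply: cvgD; [exact: cc4|exact: cc5].
  have S2 : - (A * h ^+ 2) * I0 <= Int (x0 - H) (x0 + H) (fun y => G y * dl y).
    rewrite S1 [leRHS](@Int_widen _ _ a b)//; try lin; last 2 first.
    - apply: continuousMf => // y; apply: cvgB.
        by apply: cvgD; apply: continuous_affine.
      by apply: cvgM; [exact: cvg_cst|exact: cG].
    - by move=> y yo; rewrite vpsi ?mulr0.
    rewrite -IntZ//; apply: Int_le => //.
    - by apply: continuousMf => //; exact: cst_continuous.
    - apply: continuousMf => // y; apply: cvgB.
        by apply: cvgD; apply: continuous_affine.
      by apply: cvgM; [exact: cvg_cst|exact: cG].
    move=> y /andP[y1 y2]; apply: ler_wpM2r => //.
    have := @second_difference_ge A y h nA h0; rewrite !mul1r => sd.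
    by rewrite (addrC (G (y - h))); apply: sd; lin.
  have T y : `|dl y - h ^+ 2 * psi^`(2)%classic y| <= 2 * D3 * h ^+ 3.
    exact: second_difference_taylor.
  have S3 : `|Int (x0 - H) (x0 + H) (fun y => G y * (dl y - h ^+ 2 * psi^`(2)%classic y))| <=
      C * h ^+ 3.
    have -> : C * h ^+ 3 = (MG * (2 * D3 * h ^+ 3)) * (x0 + H - (x0 - H)) by rewrite /C; ring.
    apply: Int_norm_le => //.
      apply: continuousMf => // y; apply: cvgB; first exact: cdl.
      by apply: cvgM; [exact: cvg_cst|exact: cd2].
    move=> y yI; rewrite normrM; apply: ler_pM => //; exact: hMG.
  have S4 : Int (x0 - H) (x0 + H) (fun y => G y * (dl y - h ^+ 2 * psi^`(2)%classic y)) =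
     Int (x0 - H) (x0 + H) (fun y => G y * dl y) - h ^+ 2 * I2.
    have -> : (fun y => G y * (dl y - h ^+ 2 * psi^`(2)%classic y)) =
      (fun y => - h ^+ 2 * (G y * psi^`(2)%classic y) + G y * dl y).
      by apply/funext => y; ring.
    by rewrite Int_lin; [rewrite /I2; ring|exact: continuousMf..].
  move: S3; rewrite S4 ler_norml => /andP[_ S3].
  have h20 : 0 < h ^+ 2 by rewrite exprn_gt0.
  rewrite -(ler_pM2l h20).
  have -> : h ^+ 2 * (I2 + C * h) = h ^+ 2 * I2 + C * h ^+ 3 by ring.
  have -> : h ^+ 2 * (- A * I0) = - (A * h ^+ 2) * I0 by ring.
  lin.
apply/ler_addgt0Pr => e e_0.
pose h := Num.min (Num.min ((a - (x0 - H)) / 2) ((x0 + H - b) / 2)) (e / (C + 1)).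
have C1 : 0 < C + 1 by lin.
have h0 : 0 < h.
  rewrite !lt_min; apply/andP; split; last by rewrite divr_gt0.
  by apply/andP; split; lin.
have h1 : h <= (a - (x0 - H)) / 2 by rewrite /h !ge_min lexx.
have h2 : h <= (x0 + H - b) / 2 by rewrite /h !ge_min lexx orbT.
have h3 : h * (C + 1) <= e by rewrite -ler_pdivlMr// /h ge_min lexx orbT.
apply: le_trans (key h h0 _ _) _; lin.
Qed.

End lower_bound_from_primitive.

(** * Vitali coverings and contraction *)

Section covering.
Variable R : realType.
Implicit Types (x y a b e : R) (N : set R).
Local Notation mu := (@lebesgue_measure R).

(** Off an open set of small measure containing [N], a compact set of measure at least [(b - a) / 2]
    remains. The finite Vitali lemma covers it by tripled disjoint balls, so the radii satisfy
    [6 * sum >= (b - a) / 2], whence 12. *)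
Lemma vitali_disjoint_balls N (t : R -> R) a b : a < b -> mu.-negligible N ->
  (forall x, 0 < t x) -> exists s : seq R, [/\ uniq s,
    (forall x, x \in s -> a <= x <= b /\ ~ N x),
    trivIset [set` s] (fun x => ball x (t x)) & (b - a) / 12 <= \sum_(x <- s) t x].
Proof.
move=> ab [A [mA A0 NA]] t0.
pose L := (b - a) / 2; have L0 : 0 < L by rewrite divr_gt0// subr_gt0.
have Afin : (mu A < +oo)%E by rewrite A0 ltry.
have [U [oU AU UA]] := lebesgue_regularity_outer mA Afin L0.
have mU : measurable U by exact: open_measurable.
pose K := [set` `[a, b]%R] `\` U.
have cK : compact K.
  apply: (subclosed_compact _ (@segment_compact R a b)); last by move=> x [].
  by apply: closedI; [exact: itv_closed|exact: open_closedC].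
have mK : measurable K.
  by apply: closed_measurable; apply: compact_closed => //; exact: Rhausdorff.
have muK : (L%:E <= mu K)%E.
  have h : (mu [set` `[a, b]%R] <= mu K + (mu (U `\` A) + mu A))%E.
    have s1 : [set` `[a, b]%R] `<=` K `|` ((U `\` A) `|` A).
      by move=> x xab; have [Ux|Ux] := pselect (U x); [right|left];
         [have [Ax|Ax] := pselect (A x); [right|left]|].
    have mUA : measurable (U `\` A) by exact: measurableD.
    apply: (@le_trans _ _ (mu (K `|` (U `\` A `|` A)))).
      by apply: le_measure => //; rewrite inE; [exact: measurable_itv|
        apply: measurableU => //; exact: measurableU].
    apply: (@le_trans _ _ (mu K + mu (U `\` A `|` A))%E).
      by apply: measureU2 => //; exact: measurableU.
    by apply: leeD => //; exact: measureU2.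
  have h2 : (mu K + (mu (U `\` A) + mu A) <= mu K + L%:E)%E.
    by rewrite A0 adde0; apply: leeD => //; exact: ltW.
  have := le_trans h h2; rewrite lebesgue_measure_itv/= lte_fin ab -EFinD.
  case: (mu K) => [r| |]; rewrite ?leey// -?EFinD ?lee_fin /L; lra.
pose B := fun x => ball x (t x).
have Kcov : K `<=` cover [set x | a <= x <= b /\ ~ N x] B.
  move=> x [/= xab Ux]; exists x; last exact: ballxx.
  by split; [move: xab; rewrite in_itv|move=> /NA/AU].
have [D Dsub Kcover] : finite_subset_cover [set x | a <= x <= b /\ ~ N x] B K.
  move: cK; rewrite compact_cover => /(_ _ _ _ _ Kcov); apply.
  by move=> /= x _; exact: ball_open.
have is_ballB i : is_ball (B i) by exact: is_ball_ball.
have Bset0 i : B i !=set0 by exists i; exact: ballxx.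
have [E [uE ED tEB DE]] := @vitali_lemma_finite_cover _ _ B is_ballB Bset0 (finmap.enum_fset D).
exists E; split => //.
  by move=> x /ED /Dsub; rewrite inE.
have h : (mu K <= \sum_(i < size E) mu (3 *` B (nth 0%R E i)))%E.
  apply: (@content_subadditive _ _ _ mu K (fun i => 3 *` B (nth 0%R E i)) (size E)) => //.
  - by move=> k ?; rewrite scale_ballE//; exact: measurable_ball.
  - move=> x /Kcover [i Di Bi]; have : cover [set` finmap.enum_fset D] B x by exists i.
    by move=> /DE; rewrite /cover bigcup_seq (big_nth 0%R)//= big_mkord.
have : (L%:E <= (\sum_(x <- E) 6 * t x)%:E)%E.
  apply: le_trans muK (le_trans h _).
  rewrite (big_nth 0%R) big_mkord -sumEFin; apply: lee_sum => i _.
  rewrite scale_ballE// lebesgue_measure_ball; last by rewrite mulr_ge0// ltW.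
  by rewrite lee_fin; lra.
by rewrite lee_fin -mulr_sumr /L; lra.
Qed.
End covering.

Section contraction.
Variable R : realType.
Implicit Types (x y a b c e t p q C P : R) (psi theta g : R -> R).

Lemma vanish_out_closed a b g x : continuous g -> vanish_out a b g ->
  (x <= a) || (b <= x) -> g x = 0.
Proof.
move=> cg vg xab; apply: (@closed_adherent _ [set y | g y = 0] x).
  by apply: (@closed_comp _ _ g [set 0]); [move=> y _; exact: cg|exact: closed_eq].
move=> e e0; case/orP: xab => h.
  by exists (x - e / 2); [apply: vg; apply/orP; left; lin|
    rewrite (_ : _ - x = - (e / 2)); [rewrite normrN gtr0_norm; lin|ring]].
by exists (x + e / 2); [apply: vg; apply/orP; right; lin|
  rewrite (_ : _ - x = e / 2); [rewrite gtr0_norm; lin|ring]].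
Qed.

Lemma phi_bound : exists2 P, 1 <= P & forall x, @phi R x <= P.
Proof.
have [sp vp] := @testf_phi R.
have [P P0 hP] := vanish_out_bounded (smooth_continuous sp) vp.
by exists (P + 1); [lin|move=> x; have := le_trans (ler_norm _) (hP x); lin].
Qed.

Lemma rescale_phi_ball x y t : 0 < t -> rescale (@phi R) x t y != 0 -> ball x t y.
Proof.
move=> t0; apply: contraNP; rewrite /ball/= => /negP; rewrite -leNgt => h.
have [sp vp] := @testf_phi R; apply/eqP.
apply: (vanish_out_closed (smooth_continuous sp) vp).
rewrite ler_pdivrMr// ler_pdivlMr// mulN1r mul1r.
by move: h; rewrite leNgt ltr_norml negb_and -!leNgt => /orP[h|h]; apply/orP;
  [right|left]; lin.
Qed.

Lemma Int_rescale a b g x t : t != 0 -> continuous g ->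
  Int (x + t * a) (x + t * b) (rescale g x t) = t * Int a b g.
Proof.
move=> t0 cg; have cr : continuous (rescale g x t).
  by rewrite rescaleE; exact: continuous_affine.
rewrite ![x + _]addrC -Int_affine//; congr (_ * Int _ _ _); apply/funext => y.
by rewrite /rescale addrK mulrC mulKf.
Qed.

Variables (f : Dprime R) (N : set R).
Hypothesis negN : (@lebesgue_measure R).-negligible N.
Hypothesis hN : forall x, ~ N x -> forall e d, 0 < e -> 0 < d ->
  exists2 t, 0 < t < d & - e <= mean f (@phi R) x t.

Section bumps.
Variables (P : R) (P1 : 1 <= P) (hP : forall x, @phi R x <= P).

Let P0 : 0 < P. Proof. by apply: lt_le_trans P1. Qed.

(** A sum of copies of [phi] on disjoint balls where the mean of [f] is at least [- e]. Disjointness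
    and division by [P] keep it below 1, and the balls fill a fixed proportion of the interval: a
    twelfth of 3/4 is the 1/16. *)
Lemma cell_minorant a b e : a < b -> 0 < e -> exists theta,
  [/\ testf a b theta, forall x, 0 <= theta x <= 1,
      - e * Int a b theta <= f theta & (16 * P)^-1 * (b - a) <= Int a b theta].
Proof.
move=> ab e0; pose L := (b - a) / 8; have L0 : 0 < L by rewrite /L; lin.
(* Radii at most [L] keep balls centred in [a + L, b - L] inside [a, b]; the radius at points of [N]
   is a filler, since no such point is selected. *)
have /choice[t ht] : forall x, exists t, [/\ 0 < t, t <= L & ~ N x -> - e <= mean f (@phi R) x t].
  move=> x; have [Nx|Nx] := pselect (N x); first by exists L; split.
  have [t /andP[t0 tL] h] := hN Nx e0 L0.
  by exists t; split => //; exact: ltW.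
have t0 x : 0 < t x by case: (ht x).
have abL : a + L < b - L by rewrite /L; lin.
have [s [us hs ts sums]] := vitali_disjoint_balls abL negN t0.
pose th (l : seq R) y := \sum_(x <- l) P^-1 * rescale (@phi R) x (t x) y.
have phi_t (l : seq R) : (forall x, x \in l -> a + L <= x <= b - L /\ ~ N x) ->
    [/\ testf a b (th l), - e * Int a b (th l) <= f (th l) &
        Int a b (th l) = P^-1 * \sum_(x <- l) t x].
  elim: l => [_|x l IHl hl].
    have -> : th [::] = (fun=> 0) by apply/funext => y; rewrite /th big_nil.
    by rewrite Dprime0 Int_cst mul0r mulr0 big_nil mulr0; split => //; exact: testf0.
  have [|tl fl Il] := IHl; first by move=> z zl; apply: hl; rewrite inE zl orbT.
  have [/andP[x1 x2] Nx] : a + L <= x <= b - L /\ ~ N x by apply: hl; rewrite inE eqxx.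
  have [_ tL hm] := ht x; have {}hm := hm Nx; have tx0 := t0 x.
  have tr := rescale_testf x (t0 x) (@testf_phi R).
  have trab : testf a b (rescale (@phi R) x (t x)).
    by apply: testf_sub tr; lin.
  have -> : th (x :: l) = (fun y => P^-1 * rescale (@phi R) x (t x) y + th l y).
    by apply/funext => y; rewrite /th big_cons.
  have cr := smooth_continuous (proj1 trab).
  have ct := smooth_continuous (proj1 tl).
  have Ir : Int a b (rescale (@phi R) x (t x)) = t x.
    rewrite (@Int_widen _ _ (x + t x * -1) (x + t x * 1)) //; [|lin|lin|lin|exact: (proj2 tr)].
    rewrite Int_rescale ?Int_phi ?mulr1 ?gt_eqF//.
    by apply: smooth_continuous; exact: phi_smooth.
  rewrite Int_lin// (Dprime_lin f _ trab tl) big_cons Ir Il; split.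
  - exact: testf_lin.
  - rewrite -Il mulrDr; apply: lerD => //.
    move: hm; rewrite /mean => hm.
    have -> : - e * (P^-1 * t x) = P^-1 * (t x * - e) by ring.
    rewrite ler_pM2l ?invr_gt0//.
    have -> : f (rescale (@phi R) x (t x)) = t x * ((t x)^-1 * f (rescale (@phi R) x (t x))).
      by rewrite mulVKf// gt_eqF.
    by rewrite ler_pM2l.
  - by rewrite mulrDr.
have [ths fth Ith] := phi_t _ hs.
exists (th s); split => //.
  move=> y; have h0 x : 0 <= P^-1 * rescale (@phi R) x (t x) y.
    by rewrite mulr_ge0 ?invr_ge0 ?(ltW P0)//; exact: phi_ge0.
  have h1 x : P^-1 * rescale (@phi R) x (t x) y <= 1.
    by rewrite mulrC ler_pdivrMr// mul1r; exact: hP.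
  apply/andP; split; first by apply: sumr_ge0 => x _.
  have [/hasP[x xs nx]|/hasPn hall] := boolP (has (fun x => rescale (@phi R) x (t x) y != 0) s).
    rewrite /th (bigD1_seq x)//= big1_seq ?addr0// => z /andP[zx zs].
    have [->|nz] := eqVneq (rescale (@phi R) z (t z) y) 0; first by rewrite mulr0.
    have xz : x = z by apply: ts => //; exists y; split; exact: rescale_phi_ball.
    by rewrite xz eqxx in zx.
  rewrite /th big1_seq// => x /andP[_ xs].
  by have := hall _ xs; rewrite negbK => /eqP ->; rewrite mulr0.
rewrite Ith invfM mulrAC mulrC ler_pM2l ?invr_gt0//.
by apply: le_trans sums; rewrite /L; lin.
Qed.

(** On each cell the function [psi] is at least [psi c - w], and that multiple of a cell minorant is
    added. Replacing [psi] by these constants costs at most [2 w] times the length of the cell. *)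
Lemma cells_minorant psi a dlt w e n : 0 < dlt -> 0 < e -> continuous psi ->
  (forall x, 0 <= psi x) -> (forall x y, `|x - y| <= dlt -> `|psi x - psi y| <= w) ->
  exists theta, [/\ testf a (a + n%:R * dlt) theta, forall x, 0 <= theta x <= psi x,
    - e * Int a (a + n%:R * dlt) theta <= f theta &
    (16 * P)^-1 * (Int a (a + n%:R * dlt) psi - 2 * w * (n%:R * dlt)) <=
      Int a (a + n%:R * dlt) theta].
Proof.
move=> dlt0 e0 cpsi psi0 hw; elim: n => [|n [theta [tth th0 fth Ith]]].
  exists (fun=> 0); rewrite Dprime0 (mul0r dlt) addr0 !Intxx !mulr0 subrr mulr0.
  by split => //; [exact: testf0|move=> x; rewrite lexx psi0].
set c := a + n%:R * dlt in tth fth Ith *.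
have ac : a <= c by rewrite /c lerDl mulr_ge0// ltW.
have cd : c < c + dlt by rewrite ltrDl.
have -> : a + n.+1%:R * dlt = c + dlt by rewrite /c -natr1; ring.
have near_psi x : c <= x <= c + dlt -> psi c - w <= psi x <= psi c + w.
  move=> /andP[x1 x2]; have : `|psi x - psi c| <= w by apply: hw; rewrite ler_norml; lin.
  by rewrite ler_norml => /andP[? ?]; apply/andP; split; lin.
have Ipsi : Int c (c + dlt) psi <= (psi c + w) * dlt.
  rewrite [leRHS](_ : _ = Int c (c + dlt) (fun=> psi c + w)); last by rewrite Int_cst; ring.
  by apply: Int_le => //; [exact: cst_continuous|exact: ltW|move=> x /near_psi/andP[]].
have K0 : 0 < (16 * P)^-1 by rewrite invr_gt0 mulr_gt0.
have cth := smooth_continuous (proj1 tth).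
have vth := proj2 tth.
have Ith_c : Int c (c + dlt) theta = 0.
  apply: Int_eq0 => //; first exact: ltW.
  by move=> x /andP[cx _]; apply: (vanish_out_closed cth vth); rewrite cx orbT.
have tth' : testf a (c + dlt) theta by apply: testf_sub tth => //; exact: ltW.
have w0 : 0 <= w by have := hw a a; rewrite subrr normr0 => /(_ (ltW dlt0)); apply: le_trans.
have w0d : 0 <= w * dlt by rewrite mulr_ge0// ltW.
(* When the constant is not positive, nothing is added on this cell, where the integral of [psi] is
   then at most [2 w dlt]. *)
have [m0|m0] := leP (psi c - w) 0.
  exists theta; split => //.
    by rewrite -(Int_split theta a c) Ith_c addr0.
  rewrite -(Int_split theta a c) Ith_c addr0; apply: le_trans Ith.
  rewrite ler_pM2l// -(Int_split psi a c).
  have : (psi c - w) * dlt <= 0 by rewrite mulr_le0_ge0// ltW.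
  rewrite -natr1; move: Ipsi w0d; lin.
have [cell [tcell cell01 fcell Icell]] := cell_minorant cd e0.
have ccell := smooth_continuous (proj1 tcell).
have vcell := proj2 tcell.
have tcell' : testf a (c + dlt) cell by apply: testf_sub tcell.
have Icell_a : Int a (c + dlt) cell = Int c (c + dlt) cell.
  rewrite -(Int_split cell a c) (_ : Int a c cell = 0) ?add0r//.
  apply: Int_eq0 => // x /andP[_ cx].
  by apply: (vanish_out_closed ccell vcell); rewrite cx.
exists (fun x => (psi c - w) * cell x + theta x); split.
- exact: testf_lin.
- move=> x; have /andP[c1 c2] := cell01 x; have /andP[t1 t2] := th0 x.
  rewrite addr_ge0 ?mulr_ge0 ?(ltW m0)//=.
  have [xc|xc] := leP x c.
    by rewrite (vanish_out_closed ccell vcell) ?xc// mulr0 add0r.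
  rewrite (vanish_out_closed cth vth) ?(ltW xc) ?orbT// addr0.
  have [xd|xd] := leP x (c + dlt); last by rewrite vcell ?xd ?orbT// mulr0.
  have /andP[h _] : psi c - w <= psi x <= psi c + w by apply: near_psi; rewrite (ltW xc).
  by apply: le_trans h; rewrite ler_piMr// ltW.
- rewrite Int_lin// (Dprime_lin f _ tcell' tth') Icell_a -(Int_split theta a c) Ith_c addr0.
  rewrite mulrDr; apply: lerD => //.
  by rewrite mulrCA ler_pM2l.
- rewrite Int_lin// Icell_a -(Int_split theta a c) Ith_c addr0 -(Int_split psi a c).
  apply: le_trans (lerD _ Ith); last first.
    by rewrite -(ler_pM2l m0) in Icell; exact: Icell.
  rewrite addrC -subr_ge0; set I1 := Int a c psi; set I2 := Int c (c + dlt) psi.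
  have : 0 <= (16 * P)^-1 * ((psi c + w) * dlt - I2) by rewrite mulr_ge0 ?(ltW K0)// subr_ge0.
  by congr (_ <= _); rewrite -natr1; ring.
Qed.

(** Write [psi] as [theta] plus a nonnegative rest. The rest obeys the bound [- C], the minorant the
    better bound [- C / 2], and [theta] carries the proportion [1 / (16 P)] of the integral; half of
    that is gained. *)
Lemma contraction C p q : p < q -> 0 < C -> bounded_below f C p q ->
  bounded_below f ((1 - (32 * P)^-1) * C) p q.
Proof.
move=> pq C0 hC psi tpsi psi0.
have cpsi := smooth_continuous (proj1 tpsi).
have [B B0 hB] := testf_bounded_derivn 1 tpsi.
have lip x y : `|psi x - psi y| <= B * `|x - y|.
  apply: (@MVT_le _ _ psi^`()%classic) => z _; last exact: hB.
  exact: (smooth_is_derive _ (proj1 tpsi)).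
have K0 : 0 < (16 * P)^-1 by rewrite invr_gt0 mulr_gt0.
apply: (@le_of_geometric _ _ _ (C / 2 * (16 * P)^-1 * (2 * B * (q - p) ^+ 2))) => k.
(* With [3^k] equal cells the oscillation of [psi] on a cell is O(3^-k), so the discretisation error
   is dropped by [le_of_geometric]. *)
pose n := (3 ^ k)%N; pose dlt := (q - p) * 3^-1 ^+ k.
have g0 : 0 < 3^-1 ^+ k :> R by rewrite exprn_gt0// invr_gt0.
have dlt0 : 0 < dlt by rewrite mulr_gt0// subr_gt0.
have ndlt : n%:R * dlt = q - p.
  by rewrite /n /dlt natrX mulrCA -exprMn mulfV ?pnatr_eq0// expr1n mulr1.
have hw x y : `|x - y| <= dlt -> `|psi x - psi y| <= B * dlt.
  by move=> h; apply: le_trans (lip x y) _; exact: ler_wpM2l.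
have C20 : 0 < C / 2 by rewrite divr_gt0.
have [theta] := cells_minorant p n dlt0 C20 cpsi psi0 hw.
rewrite ndlt (addrC p) subrK => -[tth th0 fth Ith].
have cth := smooth_continuous (proj1 tth).
have tB := testfB tpsi tth.
have h1 := hC _ tB; rewrite IntB// (DprimeB f tpsi tth) in h1.
have {h1} h1 : - C * (Int p q psi - Int p q theta) <= f psi - f theta.
  by apply: h1 => x; rewrite subr_ge0; case/andP: (th0 x).
have : C / 2 * ((16 * P)^-1 * (Int p q psi - 2 * (B * dlt) * (q - p))) <= C / 2 * Int p q theta.
  by rewrite ler_pM2l.
have -> : (32 * P)^-1 = (16 * P)^-1 / 2 by field; rewrite gt_eqF.
rewrite /dlt; move: h1 fth; move: (Int p q psi) (Int p q theta) => I J; lin.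
Qed.

End bumps.

Lemma nonneg_of_bounded_below C p q : p < q -> 0 < C -> bounded_below f C p q ->
  nonneg_on f p q.
Proof.
move=> pq C0 hC psi tpsi psi0.
have [P P1 hP] := phi_bound.
pose k := 1 - (32 * P)^-1.
have P32 : 1 < 32 * P by lin.
have k0 : 0 < k by rewrite /k subr_gt0 invf_lt1// (lt_trans ltr01).
have k1 : k < 1 by rewrite /k gtrBl invr_gt0 (lt_trans ltr01).
have hn n : bounded_below f (k ^+ n * C) p q.
  elim: n => [|n IHn]; first by rewrite expr0 mul1r.
  by rewrite exprS -mulrA; apply: contraction => //; rewrite mulr_gt0// exprn_gt0.
have I0 : 0 <= Int p q psi.
  apply: Int_ge0 => //; [exact: smooth_continuous (proj1 tpsi)|exact: ltW].
rewrite leNgt; apply/negP => fneg.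
have cv : k ^+ n @[n --> \oo] --> (0 : R) by apply: cvg_expr; rewrite gtr0_norm.
have e0 : 0 < - f psi / (C * Int p q psi + 1).
  by rewrite divr_gt0 ?oppr_gt0// ltr_wpDl// mulr_ge0// ltW.
have [n _ /(_ n (leqnn n))] := @cvgr0_norm_lt _ _ _ _ _ _ cv _ e0.
rewrite gtr0_norm ?exprn_gt0// ltr_pdivlMr; last by rewrite ltr_wpDl// mulr_ge0// ltW.
have := hn n psi tpsi psi0.
have : 0 < k ^+ n by rewrite exprn_gt0.
move: (k ^+ n) => g; move: (Int p q psi) => I; lin.
Qed.
End contraction.

(** * Positivity *)

Section positivity.
Variable R : realType.
Variables (f F : Dprime R) (gamma : R -> R) (E N : set R).
Hypothesis fF : is_derivative_of f F.
Hypothesis hgamma : forall x, has_point_value F x (gamma x).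
Hypothesis cE : countable E.
Hypothesis hlow : forall x, ~ E x -> exists M : R, exists2 d : R, 0 < d &
  forall t, 0 < t < d -> - M <= mean f (@phi R) x t.
Hypothesis negN : (@lebesgue_measure R).-negligible N.
Hypothesis hN : forall x, ~ N x -> forall e d : R, 0 < e -> 0 < d ->
  exists2 t, 0 < t < d & - e <= mean f (@phi R) x t.
Implicit Types (x y t c r p q : R) (n m : nat).

Let K : set R := [set x : R | forall r, 0 < r -> ~ nonneg_on f (x - r) (x + r)].

Let closedK : closed K.
Proof.
move=> x clx r r0 fr; have r20 : 0 < r / 2 by rewrite divr_gt0.
have [y [Ky /= xy]] := clx _ (nbhsx_ballx x _ r20).
apply: (Ky _ r20); apply: nonneg_on_sub fr;
  by move: xy; rewrite /ball/= ltr_norml => /andP[? ?]; lin.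
Qed.

Let notK x : ~ K x -> exists2 r, 0 < r & nonneg_on f (x - r) (x + r).
Proof.
move=> nK; apply: contrapT => h; apply: nK => r r0 fr.
by apply: h; exists r.
Qed.

(** For fixed [t] and [c] both conditions are closed in [x], because means at a fixed scale depend
    continuously on the centre. One integer serves as bound and as inverse scale, so countably many
    such sets exhaust the complement of [E]. *)
Let regular n : set R := [set x : R | forall t c, 0 < t < n.+1%:R^-1 -> `|c| <= 1 ->
  `|mean F (@eta R) (x + c * t) t| <= n.+1%:R /\ - n.+1%:R <= mean f (@phi R) x t].

Let closed_regular n : closed (regular n).
Proof.
move=> x clx t c tn c1; have t0 : 0 < t by case/andP: tn.
have ceta : continuous (fun y => `|mean F (@eta R) (y + c * t) t|).
  apply: continuous_normf => y.
  apply: (@continuous_comp _ _ _ (fun y => y + c * t) (fun y => mean F (@eta R) y t)).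
    by apply: cvgD; [exact: cvg_id|exact: cvg_cst].
  exact: (mean_continuous t0 (@testf_eta R)).
have cphi : continuous (fun y => mean f (@phi R) y t).
  exact: (mean_continuous t0 (@testf_phi R)).
split.
  apply: (closed_comp (f := fun y => `|mean F (@eta R) (y + c * t) t|)
    (fun y _ => ceta y) (@closed_le R n.+1%:R)).
  by move=> V /clx[y [ry Vy]]; exists y; split => //; case: (ry t c tn c1).
apply: (closed_comp (f := fun y => mean f (@phi R) y t)
  (fun y _ => cphi y) (@closed_ge R (- n.+1%:R))).
by move=> V /clx[y [ry Vy]]; exists y; split => //; case: (ry t c tn c1).
Qed.

Let regularI x : ~ E x -> exists n, regular n x.
Proof.
move=> /hlow[M [d d0 hM]].
have [k hk] := cone_bound (@hgamma x) (@testf_eta R).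
have [n [kn Mn dn]] : exists n, [/\ (k <= n)%N, M <= n.+1%:R & n.+1%:R^-1 <= d].
  pose a := `|M| + d^-1; have a0 : 0 <= a by rewrite addr_ge0// invr_ge0 ltW.
  exists (maxn k (Num.truncn a)); split; first exact: leq_maxl.
    apply: le_trans (ler_norm M) _.
    apply: (@le_trans _ _ a); first by rewrite lerDl invr_ge0 ltW.
    apply/ltW/(lt_le_trans (truncnS_gt a)).
    by rewrite ler_nat ltnS leq_maxr.
  rewrite -[leRHS]invrK lef_pV2 ?posrE ?invr_gt0//.
  apply: (@le_trans _ _ a); first by rewrite lerDr.
  apply/ltW/(lt_le_trans (truncnS_gt a)).
  by rewrite ler_nat ltnS leq_maxr.
have kn1 : k.+1%:R <= n.+1%:R :> R by rewrite ler_nat.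
exists n => t c /andP[t0 tn] c1; split.
  apply: le_trans (hk t c _ c1) (kn1); rewrite t0/=.
  by apply: lt_le_trans tn _; rewrite lef_pV2 ?posrE ?ltr0n.
apply: le_trans (hM t _); first by rewrite lerN2.
by rewrite t0/=; exact: lt_le_trans tn dn.
Qed.

Let portion : (K !=set0) -> exists n x0 r, [/\ 0 < r, K x0,
  forall k, K k -> `|k - x0| < r -> forall t c, 0 < t < n.+1%:R^-1 -> `|c| <= 1 ->
    `|mean F (@eta R) (k + c * t) t| <= n.+1%:R &
  forall k, K k -> `|k - x0| < r -> k != x0 -> forall t, 0 < t < n.+1%:R^-1 ->
    - n.+1%:R <= mean f (@phi R) k t].
Proof.
move=> K0; have /countable_injP[idx inj] := cE.
(* Even indices carry the regular sets, odd indices the points of [E] one at a time. If a single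
   point of [E] prevails, then [K] reduces to [x0] nearby and only the cone bound at [x0] is needed;
   this is the source of the one exceptional point. *)
pose C n : set R := if odd n then [set x | E x /\ idx x = n./2] else regular n./2.
have [|x Kx|m [x0 [r [r0 Kx0 hr]]]] := baire_closed closedK K0 (C := C).
- move=> n; rewrite /C; case: ifP => _; last exact: closed_regular.
  set S := [set _ | _]; have [[x Sx]|S0] := pselect (S !=set0).
    suff -> : S = [set x] by exact: closed_eq.
    apply/seteqP; split => [y [Ey iy]|_ -> //].
    by case: Sx => Ex ix; apply: inj; rewrite ?inE// iy ix.
  suff -> : S = set0 by exact: closed0.
  by apply/seteqP; split => // y Sy; apply: S0; exists y.
- have [Ex|nE] := pselect (E x).
    exists (idx x).*2.+1; rewrite /C /= odd_double /= uphalf_double; split => //.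
  have [n rn] := regularI nE.
  by exists n.*2; rewrite /C odd_double doubleK.
have Cx0 : C m x0 by apply: hr => //; rewrite subrr normr0.
move: hr Cx0; rewrite /C; case: ifP => _ hr Cx0.
  have [n hn] := cone_bound (@hgamma x0) (@testf_eta R).
  have eqx0 k : K k -> `|k - x0| < r -> k = x0.
    move=> Kk kr; have [Ek ik] := hr k Kk kr; have [Ex0 ix0] := Cx0.
    by apply: inj; rewrite ?inE// ik ix0.
  exists n, x0, r; split => // k Kk kr; first by rewrite (eqx0 k Kk kr).
  by rewrite (eqx0 k Kk kr) eqxx.
exists m./2, x0, r; split => // k Kk kr.
  by move=> t c tm c1; case: (hr k Kk kr t c tm c1).
move=> _ t tm; have c1 : `|0 : R| <= 1 by rewrite normr0.
by case: (hr k Kk kr t 0 tm c1).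
Qed.

Let K_empty : ~ (K !=set0).
Proof.
move=> /portion[n [x0 [r [r0 Kx0 hcone hreg]]]].
have [M [t0 [M0 t00 hM]]] := local_mean_bound fF closedK notK hgamma r0 (ltr0Sn R n) hcone.
have r20 : 0 < r / 2 by rewrite divr_gt0.
have [G GL FG] := primitive_function_exists r20 M0 t00 hM.
have n0 : 0 <= n.+1%:R :> R by [].
have n1 : 0 < n.+1%:R^-1 :> R by rewrite invr_gt0 ltr0n.
(* At points off [K] positivity near the point gives nonnegative means at small scales, so the bound
   of the regular set extends to all points except [x0]. *)
have reg xs : x0 - r / 2 / 2 < xs < x0 + r / 2 / 2 -> xs != x0 ->
    exists2 s0, 0 < s0 & forall s, 0 < s < s0 -> - n.+1%:R <= mean f (@phi R) xs s.
  move=> /andP[x1 x2] xx0; have [Kxs|nK] := pselect (K xs).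
    exists n.+1%:R^-1 => // s; apply: hreg => //.
    by rewrite ltr_norml; apply/andP; split; lin.
  have [d d0 fd] := notK nK; exists d => // s /andP[s0 sd].
  apply: (@le_trans _ _ 0); first by rewrite oppr_le0.
  rewrite mulr_ge0 ?invr_ge0 ?(ltW s0)//; apply: fd.
    by apply: testf_sub (rescale_testf xs s0 (@testf_phi R)); lin.
  by move=> y; exact: phi_ge0.
have nn : n.+1%:R < n.+1%:R + 1 :> R by rewrite ltrDl.
have b1 : x0 - r / 2 / 2 < x0 - r / 8 by lin.
have b2 : x0 - r / 8 <= x0 + r / 8 by lin.
have b3 : x0 + r / 8 < x0 + r / 2 / 2 by lin.
have bb := bounded_below_of_primitive fF M0 GL FG n0 reg (@hgamma x0) nn b1 b2 b3.
have r80 : 0 < r / 8 by rewrite divr_gt0.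
apply: (Kx0 _ r80); apply: (nonneg_of_bounded_below negN hN _ _ bb); first by lin.
by rewrite ltr_wpDl.
Qed.

Lemma derivative_nonneg p q : nonneg_on f p q.
Proof.
apply: (nonneg_gap notK) => x _ Kx; apply: K_empty; by exists x.
Qed.

End positivity.

(** * The representing measure *)

Section values.
Variable R : realType.
Variables (f F : Dprime R) (gamma : R -> R).
Hypothesis fF : is_derivative_of f F.
Hypothesis hgamma : forall x, has_point_value F x (gamma x).
Hypothesis fpos : forall p q : R, nonneg_on f p q.
Implicit Types (x y t e : R).

Lemma mean_le_gamma x y t : 0 < t -> x + t < y -> mean F (@eta R) x t <= gamma y.
Proof. by move=> t0 xy; apply: (mean_le_value fF t0 (lexx (x - t)) xy). Qed.

Lemma gamma_le_mean x y t : 0 < t -> y < x - t -> gamma y <= mean F (@eta R) x t.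
Proof. by move=> t0 xy; apply: (value_le_mean fF t0 xy (lexx (x + t))). Qed.

Lemma gamma_homo x y : x <= y -> gamma x <= gamma y.
Proof.
rewrite le_eqVlt => /predU1P[->//|xy].
by apply: (@le_trans _ _ (mean F (@eta R) ((x + y) / 2) ((y - x) / 4)));
  [apply: gamma_le_mean|apply: mean_le_gamma]; lra.
Qed.

(** By monotonicity, the values within [t] of [x] lie between the means over the balls of radius [t]
    centred at [x - 2 t] and [x + 2 t], and both means tend to the value at [x]. *)
Lemma gamma_continuous : continuous gamma.
Proof.
move=> x; apply/cvgrPdist_le => e e0.
have [d1 d10 h1] := mean_eta_value (-2) (@hgamma x) e0.
have [d2 d20 h2] := mean_eta_value 2 (@hgamma x) e0.
pose t := Num.min d1 d2 / 2.
have t0 : 0 < t by rewrite divr_gt0// lt_min d10.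
have td1 : 0 < t < d1.
  rewrite t0/=; have : Num.min d1 d2 <= d1 by rewrite ge_min lexx.
  by rewrite /t; lra.
have td2 : 0 < t < d2.
  rewrite t0/=; have : Num.min d1 d2 <= d2 by rewrite ge_min lexx orbT.
  by rewrite /t; lra.
exists t => // y; rewrite /ball_ /= ltr_norml => /andP[y1 y2].
have g1 : mean F (@eta R) (x + -2 * t) t <= gamma y by apply: mean_le_gamma; lra.
have g2 : gamma y <= mean F (@eta R) (x + 2 * t) t by apply: gamma_le_mean; lra.
have := h1 t td1; have := h2 t td2; rewrite !ler_norml => /andP[? ?] /andP[? ?].
by apply/andP; split; lra.
Qed.

Lemma mean_eta_cvg x : mean F (@eta R) x (3^-1 ^+ k) @[k --> \oo] --> gamma x.
Proof.
apply/cvgrPdist_le => e e0.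
have [d d0 hd] := mean_eta_value 0 (@hgamma x) e0.
have cv : (3^-1 : R) ^+ k @[k --> \oo] --> (0 : R).
  by apply: cvg_expr; rewrite gtr0_norm ?invr_gt0// invf_lt1// ltr1n.
have := @cvgr0_norm_lt _ _ _ _ _ _ cv _ d0 => -[n _ hn]; exists n => // k /hn kd.
have k0 : 0 < (3^-1 : R) ^+ k by rewrite exprn_gt0// invr_gt0.
rewrite distrC; have := hd (3^-1 ^+ k); rewrite mul0r addr0; apply.
by rewrite k0 /= -(gtr0_norm k0).
Qed.

End values.

(** * Inner regularity of locally finite Borel measures on the line *)

Section regularity.
Variable R : realType.
Implicit Types (A B C U : set R) (e : R).

Section finite_measure.
Variable mu : {measure set (measurableTypeR R) -> \bar R}.
Hypothesis mufin : (mu setT < +oo)%E.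

(** Approximation from inside and outside at once, so that the class of such sets is stable under
    complements. *)
Let approx A := forall e, 0 < e -> exists C U, [/\ closed C, open U, C `<=` A, A `<=` U &
  (mu (U `\` C) <= e%:E)%E].

Let mC C : closed C -> measurable (C : set (measurableTypeR R)).
Proof. exact: closed_measurable. Qed.

Let mO U : open U -> measurable (U : set (measurableTypeR R)).
Proof. exact: open_measurable. Qed.

Let approxC A : approx A -> approx (~` A).
Proof.
move=> hA e e0; have [C [U [cC oU CA AU h]]] := hA e e0.
exists (~` U), (~` C); split; [exact: open_closedC|exact: closed_openC|
  exact: subsetC|exact: subsetC|].
by rewrite setDE setCK setIC -setDE.
Qed.

Let decr_small (D : nat -> set R) : (forall n, measurable (D n : set (measurableTypeR R))) ->
  nonincreasing_seq D -> \bigcap_n D n = set0 -> forall e, 0 < e ->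
  exists n, (mu (D n) <= e%:E)%E.
Proof.
move=> mD ndD D0 e e0.
have mu0 : (mu (D 0%N) < +oo)%E.
  by apply: le_lt_trans mufin; apply: le_measure; rewrite ?inE//; exact: measurableT.
have := @nonincreasing_cvg_mu _ _ _ mu D mu0 mD; rewrite D0 measure0.
move=> /(_ measurable0 ndD) cv.
have : \forall n \near \oo, (mu (D n) < e%:E)%E.
  by apply: (cv [set x | (x < e%:E)%E]); apply: open_nbhs_nbhs; split; [exact: open_ereal_lt_ereal|rewrite /= lte_fin].
by move=> [n _ /(_ n (leqnn n)) /= /ltW h]; exists n.
Qed.

Let approx_open U : open U -> approx U.
Proof.
move=> oU e e0.
(* The points at distance at least [1 / (n + 1)] from the complement of [U]: closed sets increasing
   to [U]. *)
pose Cn n : set R := [set x | forall y, `|y - x| < n.+1%:R^-1 -> U y].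
have cCn n : closed (Cn n).
  have n0 : 0 < n.+1%:R^-1 :> R by rewrite invr_gt0.
  move=> x clx y; rewrite -subr_gt0 => yx.
  have [z [Cz /= xz]] := clx _ (nbhsx_ballx x _ yx).
  apply: Cz; rewrite (_ : y - z = (y - x) + (x - z)); last by ring.
  by apply: le_lt_trans (ler_normD _ _) _; rewrite addrC -ltrBrDr.
have [n hn] : exists n, (mu (U `\` Cn n) <= e%:E)%E.
  apply: decr_small => //.
  - by move=> n; apply: measurableD; [exact: mO|exact: mC].
  - apply/nonincreasing_seqP => n; apply/subsetPset => x [Ux nC]; split => // hC.
    apply: nC => y yx; apply: hC; apply: lt_le_trans yx _.
    by rewrite lef_pV2 ?posrE// ler_nat.
  - apply/seteqP; split => // x hx; have [Ux _] := hx 0%N I.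
    have [r /= r0 rU] := oU x Ux.
    have rn : (Num.truncn r^-1).+1%:R^-1 < r.
      by rewrite -[ltRHS]invrK ltf_pV2 ?posrE ?invr_gt0// truncnS_gt.
    have [_] := hx (Num.truncn r^-1) I; apply => y yx; apply: rU.
    by rewrite /= distrC; exact: lt_trans rn.
exists (Cn n), U; split => //.
by move=> x; apply; rewrite subrr normr0.
Qed.

Let approx_bigcup (A : nat -> set R) : (forall n, approx (A n)) -> approx (\bigcup_n A n).
Proof.
move=> hA e e0; have e20 : 0 < e / 2 by rewrite divr_gt0.
have /choice[C hC] : forall n, exists C, exists U,
    [/\ closed C, open U, C `<=` A n, A n `<=` U &
    (mu (U `\` C) <= (e / 2 / (2 ^ n.+1)%:R)%:E)%E].
  by move=> n; apply: hA; rewrite divr_gt0// ltr0n expn_gt0.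
have /choice[U hU] := hC.
have cC n : closed (C n) by case: (hU n).
have oU n : open (U n) by case: (hU n).
(* A countable union of closed sets need not be closed; finite unions are, and the rest has small
   measure by continuity from above. *)
pose Cn n := \big[setU/set0]_(i < n) C i.
have cCn n : closed (Cn n) by apply: closed_bigsetU.
have oUU : open (\bigcup_n U n) by exact: bigcup_open.
have mCC : measurable (\bigcup_n C n : set (measurableTypeR R)).
  by apply: bigcup_measurable => n _; exact: mC.
have mUU : measurable (\bigcup_n U n : set (measurableTypeR R)) by exact: mO.
have [n hn] : exists n, (mu (\bigcup_n C n `\` Cn n) <= (e / 2)%:E)%E.
  apply: decr_small => //.
  - by move=> n; apply: measurableD => //; exact: mC.
  - apply/nonincreasing_seqP => n; apply/subsetPset => x [Ux nC]; split => // hc.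
    by apply: nC; rewrite /Cn big_ord_recr; left.
  - apply/seteqP; split => // x hx; have [[k _ Ck] _] := hx 0%N I.
    have [_] := hx k.+1 I; apply; rewrite /Cn big_ord_recr; right; exact: Ck.
have hUC : (mu (\bigcup_n U n `\` \bigcup_n C n) <= (e / 2)%:E)%E.
  have sub : \bigcup_n U n `\` \bigcup_n C n `<=` \bigcup_n (U n `\` C n).
    by move=> x [[k _ Uk] nC]; exists k => //; split => // Ck; apply: nC; exists k.
  apply: (@le_trans _ _ (\sum_(n <oo) mu (U n `\` C n))%E).
    apply: measure_sigma_subadditive => //.
    - by move=> k; apply: measurableD; [exact: mO|exact: mC].
    - exact: measurableD.
  apply: le_trans (epsilon_trick0 xpredT (ltW e20)).
  by apply: lee_nneseries => // k _; case: (hU k).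
exists (Cn n), (\bigcup_n U n); split => //.
- move=> x; rewrite /Cn -bigcup_mkord => -[k _ Ck]; exists k => //.
  by case: (hU k) => _ _ h _ _; exact: h.
- by move=> x [k _ Ak]; exists k => //; case: (hU k) => _ _ _ h _; exact: h.
have sub : \bigcup_n U n `\` Cn n `<=`
    (\bigcup_n U n `\` \bigcup_n C n) `|` (\bigcup_n C n `\` Cn n).
  move=> x [Ux nC]; have [Cx|nCx] := pselect ((\bigcup_n C n) x); [right|left]; by split.
have m1 : measurable (\bigcup_n U n `\` \bigcup_n C n : set (measurableTypeR R)).
  exact: measurableD.
have m2 : measurable (\bigcup_n C n `\` Cn n : set (measurableTypeR R)).
  by apply: measurableD => //; exact: mC.
apply: (@le_trans _ _ (mu ((\bigcup_n U n `\` \bigcup_n C n) `|` (\bigcup_n C n `\` Cn n)))).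
  apply: le_measure => //; rewrite inE; last exact: measurableU.
  by apply: measurableD => //; exact: mC.
apply: (@le_trans _ _ (mu (\bigcup_n U n `\` \bigcup_n C n) + mu (\bigcup_n C n `\` Cn n))%E).
  exact: measureU2.
by rewrite [e]splitr EFinD; apply: leeD.
Qed.

Lemma closed_inner_approx A e : measurable (A : set (measurableTypeR R)) -> 0 < e ->
  exists C, [/\ closed C, C `<=` A & (mu (A `\` C) <= e%:E)%E].
Proof.
move=> mA e0; suff : approx A.
  move=> /(_ e e0) [C [U [cC oU CA AU h]]]; exists C; split => //.
  apply: le_trans h; apply: le_measure; rewrite ?inE.
  - by apply: measurableD => //; exact: mC.
  - by apply: measurableD; [exact: mO|exact: mC].
  - by move=> x [Ax nC]; split => //; exact: AU.
move: A mA; apply: smallest_sub.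
- split.
  + by apply: approx_open; exact: open0.
  + by move=> A hA; rewrite setTD; exact: approxC.
  + exact: approx_bigcup.
- move=> _ [[a b] _ <-] /=.
  have -> : `]a, b]%classic = ~` (~` `]a, +oo[%classic `|` `]b, +oo[%classic).
    apply/seteqP; split => x /=; rewrite !in_itv /= !andbT.
      by move=> /andP[ax xb] [|]; [apply|rewrite ltNge xb].
    move=> h; apply/andP; split; first by apply/negP => /negP ax; apply: h; left; exact/negP.
    by rewrite leNgt; apply/negP => bx; apply: h; right.
  apply: approxC; rewrite -bigcup2E; apply: approx_bigcup => -[|[|n]] /=.
  + by apply: approxC; apply: approx_open; exact: interval_open.
  + by apply: approx_open; exact: interval_open.
  + by apply: approx_open; exact: open0.
Qed.

End finite_measure.
(** The finite case applies to the restrictions of [mu] to [-n, n]; cutting the closed sets down to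
    that interval makes them compact, and continuity from below finishes. *)
Lemma radon_of_locally_finite (mu : {measure set (measurableTypeR R) -> \bar R}) :
  (forall M : R, (mu [set` `[- M, M]%R] < +oo)%E) -> radon mu.
Proof.
move=> muI; have mI (M : R) : measurable ([set` `[- M, M]%R] : set (measurableTypeR R)).
  exact: measurable_itv.
split=> [K cK|A mA].
  have mK : measurable (K : set (measurableTypeR R)).
    by apply: closed_measurable; apply: compact_closed => //; exact: Rhausdorff.
  have [M [Mr HM]] := compact_bounded cK.
  apply: le_lt_trans (muI (`|M| + 1)); apply: le_measure; rewrite ?inE//.
  move=> x Kx; rewrite /= in_itv/= -ler_norml; apply: (HM (`|M| + 1)) => //.
  by rewrite (le_lt_trans (ler_norm _))// ltrDl.
apply/eqP; rewrite eq_le; apply/andP; split; last first.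
  apply: ge_ereal_sup => _ [K [cK KA] <-]; apply: le_measure; rewrite ?inE//.
  by apply: closed_measurable; apply: compact_closed => //; exact: Rhausdorff.
set S := ereal_sup _.
pose Fn (n : nat) : set R := A `&` [set` `[- n%:R, n%:R]%R].
have mFn n : measurable (Fn n : set (measurableTypeR R)) by exact: measurableI.
have UF : \bigcup_n Fn n = A.
  apply/seteqP; split => [x [n _ []]//|x Ax].
  exists (Num.truncn `|x|).+1 => //; split => //.
  by rewrite /= in_itv/= -ler_norml; exact/ltW/truncnS_gt.
have ndF : nondecreasing_seq Fn.
  apply/nondecreasing_seqP => n; apply/subsetPset => x [Ax].
  rewrite /= in_itv/= -ler_norml => xn; split => //.
  by rewrite /= in_itv/= -ler_norml (le_trans xn)// ler_nat.
have FS n : (mu (Fn n) <= S)%E.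
  apply/lee_addgt0Pr => e e0.
  have fin : (mrestr mu (mI n%:R) setT < +oo)%E by rewrite /mrestr setTI.
  have [C [cC CA hC]] := closed_inner_approx fin mA e0.
  have mC : measurable (C : set (measurableTypeR R)) by exact: closed_measurable.
  pose K := C `&` [set` `[- n%:R, n%:R]%R].
  have cK : compact K.
    apply: (subclosed_compact _ (@segment_compact R (- n%:R) n%:R)); last by move=> x [].
    by apply: closedI; [|exact: itv_closed].
  have KS : (mu K <= S)%E.
    by apply: ereal_sup_ubound; exists K => //; split => // x [/CA].
  have mK : measurable (K : set (measurableTypeR R)) by exact: measurableI.
  have mD : measurable ((A `\` C) `&` [set` `[- n%:R, n%:R]%R] : set (measurableTypeR R)).
    by apply: measurableI => //; exact: measurableD.
  apply: (@le_trans _ _ (mu (K `|` ((A `\` C) `&` [set` `[- n%:R, n%:R]%R])))).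
    apply: le_measure; rewrite ?inE//; first exact: measurableU.
    by move=> x [Ax xI]; have [Cx|Cx] := pselect (C x); [left|right].
  apply: (@le_trans _ _ (mu K + mu ((A `\` C) `&` [set` `[- n%:R, n%:R]%R]))%E).
    exact: measureU2.
  exact: leeD.
have mU : measurable (\bigcup_n Fn n : set (measurableTypeR R)) by rewrite UF.
have cv := nondecreasing_cvg_mu (mu := mu) mFn mU ndF; rewrite UF in cv.
rewrite -(cvg_lim _ cv)//; apply: lime_le; first exact: cvgP cv.
by exists 0%N => // n _; exact: FS.
Qed.

End regularity.

(** * Stieltjes sums for the measure and for the distribution *)

Section representation.
Variable R : realType.
Implicit Types (a b c d p q k w t x y dlt : R) (g psi : R -> R) (n : nat).

Lemma stieltjes_measure_exists g : {homo g : x y / x <= y} -> continuous g ->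
  exists mu : {measure set (measurableTypeR R) -> \bar R},
    forall a b, a <= b -> mu [set` `]a, b]%R] = (g b - g a)%:E.
Proof.
move=> hg cg.
pose G : cumulative R R :=
  HB.pack g (isCumulative.Build R _ R g hg (right_continuousW cg)).
exists (lebesgue_stieltjes_measure G) => a b ab.
rewrite -(@wlength_itv_bnd R g a b false false ab).
have mab : measurable ([set` `]a, b]%R] : set (ocitv_type R)) by exact: is_ocitv.
exact: (measurable_mu_extE (wlength G) mab).
Qed.

Section stieltjes_sums.
Variables (mu : {measure set (measurableTypeR R) -> \bar R}) (g : R -> R).
Hypothesis hmu : forall a b, a <= b -> mu [set` `]a, b]%R] = (g b - g a)%:E.

Let moc a b : measurable ([set` `]a, b]%R] : set (measurableTypeR R)).
Proof. exact: measurable_itv. Qed.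

Lemma integrable_oc psi a b : continuous psi -> a <= b ->
  mu.-integrable [set` `]a, b]%R] (EFin \o psi).
Proof.
move=> cpsi ab; apply: measurable_bounded_integrable => //.
- by rewrite hmu// ltry.
- by apply: measurable_funTS; exact: continuous_measurable_fun.
have [M M0 hM] := @bounded_on_itv R a b psi cpsi.
exists M; split; first exact: num_real.
move=> N MN x /=; rewrite in_itv/= => /andP[ax xb].
by apply: le_trans (ltW MN); apply: hM; rewrite xb (ltW ax).
Qed.

Lemma Rintegral_cell psi k w a b : continuous psi -> a <= b ->
  (forall x, a < x <= b -> `|psi x - k| <= w) ->
  `|(\int[mu]_(x in [set` `]a, b]%R]) psi x)%R - k * (g b - g a)| <= w * (g b - g a).
Proof.
move=> cpsi ab hk; have fab : fine (mu [set` `]a, b]%R]) = g b - g a by rewrite hmu.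
have cB : continuous (fun x => psi x - k).
  by move=> x; apply: cvgB; [exact: cpsi|exact: cvg_cst].
rewrite -fab -!(Rintegral_cst mu (moc a b)) -RintegralB//; last 2 first.
- exact: integrable_oc.
- by apply: (integrable_oc (psi := fun=> k)) => //; exact: cst_continuous.
apply: le_trans (le_normr_Rintegral _ _) _ => //; first exact: integrable_oc.
apply: le_Rintegral => //.
- by apply: (integrable_oc (psi := fun x => `|psi x - k|)) => //; exact: continuous_normf.
- by apply: (integrable_oc (psi := fun=> w)) => //; exact: cst_continuous.
Qed.

Lemma Rintegral_sums psi a dlt w n : continuous psi -> 0 < dlt ->
  (forall x y, `|x - y| <= dlt -> `|psi x - psi y| <= w) ->
  `|(\int[mu]_(x in [set` `]a, (a + n%:R * dlt)]%R]) psi x)%R -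
    \sum_(i < n) psi (a + i%:R * dlt) * (g (a + i.+1%:R * dlt) - g (a + i%:R * dlt))|
  <= w * (g (a + n%:R * dlt) - g a).
Proof.
move=> cpsi dlt0 hw; elim: n => [|n IHn].
  by rewrite mul0r addr0 set_itvoc0 Rintegral_set0 big_ord0 !subrr normr0 mulr0.
rewrite big_ord_recr /=.
set c := a + n%:R * dlt in IHn *; set d := a + n.+1%:R * dlt.
have dE : d = c + dlt by rewrite /d /c -natr1; ring.
have ac : a <= c by rewrite /c lerDl mulr_ge0// ltW.
have cd : c <= d by rewrite dE lerDl ltW.
have cell := @Rintegral_cell psi (psi c) w c d cpsi cd.
have Usplit : [set` `]a, d]%R] = [set` `]a, c]%R] `|` [set` `]c, d]%R].
  apply/seteqP; split => x /=; rewrite !in_itv/=.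
    move=> /andP[ax xd]; have [xc|xc] := leP x c; [left|right]; exact/andP.
  by move=> [] /andP[h1 h2]; apply/andP; split => //; lin.
have -> : (\int[mu]_(x in [set` `]a, d]%R]) psi x)%R =
   (\int[mu]_(x in [set` `]a, c]%R]) psi x)%R + (\int[mu]_(x in [set` `]c, d]%R]) psi x)%R.
  rewrite Usplit Rintegral_setU//.
    by rewrite -Usplit; apply: integrable_oc => //; exact: le_trans cd.
  apply/disj_setPS => x /= []; rewrite !in_itv/= => /andP[_ xc] /andP[cx _].
  by move: (le_lt_trans xc cx); rewrite ltxx.
have {}cell : `|(\int[mu]_(x in [set` `]c, d]%R]) psi x)%R - psi c * (g d - g c)| <= w * (g d - g c).
  apply: cell => x /andP[cx xd]; apply: hw; rewrite gtr0_norm ?subr_gt0//.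
  by rewrite lerBlDl -dE.
rewrite opprD addrACA; apply: le_trans (ler_normD _ _) _.
by apply: le_trans (lerD IHn cell) _; rewrite le_eqVlt; apply/orP; left; apply/eqP; ring.
Qed.

End stieltjes_sums.
Section distribution_sums.
Variables f F : Dprime R.
Hypothesis fF : is_derivative_of f F.
Hypothesis fpos : forall p q, nonneg_on f p q.

(** The counterpart for [f] of [Rintegral_sums]: differences of consecutive steps play the role of
    indicators of the cells, [f] maps them to increments of means of [F], and positivity of [f]
    replaces monotonicity of the integral. *)
Lemma Dprime_sums psi p q a dlt t w n : testf p q psi -> 0 < dlt -> 0 < t ->
  a + t <= p -> q <= a + n%:R * dlt - t ->
  (forall x y, `|x - y| <= dlt + t -> `|psi x - psi y| <= w) ->
  `|f psi - \sum_(i < n) psi (a + i%:R * dlt) *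
     (mean F (@eta R) (a + i.+1%:R * dlt) t - mean F (@eta R) (a + i%:R * dlt) t)|
  <= w * (mean F (@eta R) (a + n%:R * dlt) t - mean F (@eta R) a t).
Proof.
move=> tpsi dlt0 t0 ap qb hw.
pose X (k : nat) := a + k%:R * dlt.
have XS (k : nat) : X k.+1 = X k + dlt by rewrite /X -natr1; ring.
have X0 : X 0%N = a by rewrite /X mul0r addr0.
have Xm (k : nat) : a <= X k by rewrite lerDl mulr_ge0// ltW.
pose st (k : nat) := rescale (@step R) (X k) t.
(* These functions are nonnegative and telescope to [Th], which equals 1 on the support of [psi]. *)
pose th (k : nat) y := st k y - st k.+1 y.
pose m (k : nat) := mean F (@eta R) (X k) t.
have tth (k : nat) : testf (X k - t) (X k.+1 + t) (th k).
  by apply: testf_step_difference => //; rewrite XS; lin.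
have fth (k : nat) : f (th k) = m k.+1 - m k.
  by apply: (Dprime_step_difference fF t0 t0); rewrite XS; lin.
have th0 (k : nat) y : 0 <= th k y.
  rewrite subr_ge0 /st /rescale; apply: step_homo.
  by rewrite ler_pM2r ?invr_gt0// XS; lin.
have key j : exists2 Psi, testf (a - t) (X j + t) Psi &
    f Psi = \sum_(i < j) psi (X i) * (m i.+1 - m i) /\
    forall y, `|psi y * (st 0%N y - st j y) - Psi y| <= w * (st 0%N y - st j y).
  elim: j => [|j [Psi tPsi [fPsi hPsi]]].
    exists (fun=> 0); first exact: testf0.
    by rewrite Dprime0 big_ord0; split => // y; rewrite subrr !mulr0 subrr normr0.
  have tP : testf (a - t) (X j.+1 + t) Psi by apply: testf_sub tPsi; rewrite ?XS; lin.
  have tt : testf (a - t) (X j.+1 + t) (th j).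
    by apply: testf_sub (tth j); have := Xm j; rewrite ?lexx//; lin.
  exists (fun y => psi (X j) * th j y + Psi y); first exact: testf_lin.
  split; first by rewrite (Dprime_lin f _ tt tP) fPsi fth big_ord_recr /= addrC.
  move=> y.
  have -> : psi y * (st 0%N y - st j.+1 y) - (psi (X j) * th j y + Psi y) =
    (psi y * (st 0%N y - st j y) - Psi y) + (psi y - psi (X j)) * th j y.
    by rewrite /th; ring.
  have -> : w * (st 0%N y - st j.+1 y) = w * (st 0%N y - st j y) + w * th j y.
    by rewrite /th; ring.
  apply: le_trans (ler_normD _ _) (lerD (hPsi y) _).
  rewrite normrM (ger0_norm (th0 j y)).
  have [->|nz] := eqVneq (th j y) 0; first by rewrite !mulr0.
  apply: ler_wpM2r => //; apply: hw; rewrite ler_norml; move: nz.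
  have [/andP[y1 y2] _|vy] := boolP (X j - t <= y <= X j.+1 + t).
    by move: y1 y2; rewrite XS => y1 y2; apply/andP; split; lin.
  move: vy; rewrite negb_and -!ltNge => vy.
  by rewrite (proj2 (tth j) y vy) eqxx.
have [Psi tPsi [fPsi hPsi]] := key n.
have an : a <= X n := Xm n.
pose Th y := st 0%N y - st n y.
have h1 : X 0%N - t <= X n - t by rewrite X0; lin.
have h2 : X 0%N + t <= X n + t by rewrite X0; lin.
have tTh : testf (a - t) (X n + t) Th.
  by have := testf_step_difference t0 t0 h1 h2; rewrite {1}X0; exact.
have fTh : f Th = m n - m 0%N by apply: (Dprime_step_difference fF t0 t0 h1 h2).
have psiTh y : psi y * Th y = psi y.
  have [py|py] := boolP (p <= y <= q); last first.
    by move: py; rewrite negb_and -!ltNge => py; rewrite (proj2 tpsi y py) mul0r.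
  case/andP: py => py yq; rewrite /Th /st /rescale.
  rewrite (@step1 _ ((y - X 0%N) / t)) ?(@step0 _ ((y - X n) / t)) ?subr0 ?mulr1//.
    by rewrite ler_pdivrMr// mulN1r; move: qb; rewrite -/(X n); lin.
  by rewrite ler_pdivlMr// mul1r X0; lin.
have tpsi' : testf (a - t) (X n + t) psi.
  by apply: testf_sub tpsi; move: qb; rewrite -/(X n); lin.
have tD : testf (a - t) (X n + t) (fun y => psi y - Psi y) by exact: testfB.
(* Positivity is applied to [w * Th + s * (psi - Psi)], nonnegative for either sign [s]; no absolute
   value has to be smooth. *)
have bound s : `|s| = 1 -> 0 <= w * (m n - m 0%N) + s * (f psi - f Psi).
  move=> s1; have tw := testfZ w tTh.
  have := fpos (testf_lin s tD tw).
  rewrite (Dprime_lin f s tD tw) (DprimeZ f w tTh) (DprimeB f tpsi' tPsi) fTh addrC.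
  apply => y; have := hPsi y; rewrite -/(Th y) psiTh => h.
  have : `|s * (psi y - Psi y)| <= w * Th y by rewrite normrM s1 mul1r.
  by rewrite ler_norml => /andP[? _]; lin.
rewrite -/(X n) -[in X in _ <= X]X0 -/(m n) -/(m 0%N) -fPsi ler_norml.
have := bound 1 (normr1 _); have := bound (-1) (normrN1 _).
by move=> b1 b2; apply/andP; split; lin.
Qed.

End distribution_sums.
End representation.

Section measure_from_positivity.
Variable R : realType.
Variables (f F : Dprime R) (gamma : R -> R).
Hypothesis fF : is_derivative_of f F.
Hypothesis hgamma : forall x, has_point_value F x (gamma x).
Hypothesis fpos : forall p q : R, nonneg_on f p q.
Implicit Types (a b p q dlt w x y : R) (n k : nat) (psi : R -> R).

(** The means of [F] tend to the values [gamma], so the smoothing scale disappears in the limit;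
    scales below [dlt] explain the modulus at [2 * dlt]. *)
Lemma gamma_sums psi p q a dlt w n : testf p q psi -> 0 < dlt ->
  a < p -> q < a + n%:R * dlt ->
  (forall x y, `|x - y| <= 2 * dlt -> `|psi x - psi y| <= w) ->
  `|f psi - \sum_(i < n) psi (a + i%:R * dlt) *
     (gamma (a + i.+1%:R * dlt) - gamma (a + i%:R * dlt))|
  <= w * (gamma (a + n%:R * dlt) - gamma a).
Proof.
move=> tpsi dlt0 ap qb hw.
pose m j x := mean F (@eta R) x (3^-1 ^+ j).
have cm x : m j x @[j --> \oo] --> gamma x by exact: mean_eta_cvg.
have cS l : \sum_(i < l) psi (a + i%:R * dlt) *
      (m j (a + i.+1%:R * dlt) - m j (a + i%:R * dlt)) @[j --> \oo] -->
    \sum_(i < l) psi (a + i%:R * dlt) *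
      (gamma (a + i.+1%:R * dlt) - gamma (a + i%:R * dlt)).
  elim: l => [|l IHl].
    by under eq_fun do rewrite big_ord0; rewrite big_ord0; exact: cvg_cst.
  under eq_fun do rewrite big_ord_recr; rewrite big_ord_recr /=.
  by apply: cvgD => //; apply: cvgM; [exact: cvg_cst|exact: cvgB].
rewrite -subr_ge0.
have cv : w * (m j (a + n%:R * dlt) - m j a) - `|f psi - \sum_(i < n) psi (a + i%:R * dlt) *
      (m j (a + i.+1%:R * dlt) - m j (a + i%:R * dlt))| @[j --> \oo] -->
   w * (gamma (a + n%:R * dlt) - gamma a) - `|f psi - \sum_(i < n) psi (a + i%:R * dlt) *
     (gamma (a + i.+1%:R * dlt) - gamma (a + i%:R * dlt))|.
  apply: cvgB; first by apply: cvgM; [exact: cvg_cst|exact: cvgB].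
  by apply: cvg_norm; apply: cvgB; [exact: cvg_cst|exact: cS].
apply: (cvgr_to_ge cv).
pose e := Num.min (Num.min dlt (p - a)) (a + n%:R * dlt - q).
have e0 : 0 < e by rewrite !lt_min !subr_gt0 dlt0 ap.
have ce : (3^-1 : R) ^+ k @[k --> \oo] --> (0 : R).
  by apply: cvg_expr; rewrite gtr0_norm ?invr_gt0// invf_lt1// ltr1n.
have [N _ hN] := @cvgr0_norm_lt _ _ _ _ _ _ ce _ e0.
exists N => // j /hN; have j0 : 0 < (3^-1 : R) ^+ j by rewrite exprn_gt0// invr_gt0.
rewrite /= gtr0_norm// !lt_min -andbA => /and3P[h1 h2 h3].
rewrite subr_ge0; apply: (Dprime_sums fF fpos tpsi dlt0 j0); [lra|lra|].
by move=> x y xy; apply: hw; lra.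
Qed.

(** [f psi] and the Stieltjes integral of [psi] are close to the same sum, with an error
    proportional to the mesh. *)
Lemma measure_of_nonneg : is_measure f.
Proof.
have hg := gamma_homo fF hgamma fpos.
have cg := gamma_continuous fF hgamma fpos.
have [mu hmu] := stieltjes_measure_exists hg cg.
have muI a b : a <= b -> (mu [set` `]a, b]%R] < +oo)%E by move=> ab; rewrite hmu// ltry.
exists mu.
  apply: radon_of_locally_finite => M.
  have ab : - `|M| - 1 <= `|M| by have := normr_ge0 M; lra.
  apply: le_lt_trans (muI _ _ ab); apply: le_measure; rewrite ?inE; try exact: measurable_itv.
  move=> x; rewrite /= !in_itv/= => /andP[x1 x2]; have := ler_norm M.
  by move=> hM; apply/andP; split; lra.
move=> psi tpsi; have [B B0 vB] := test_function_vanish_out tpsi.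
have tB : testf (- B) B psi by case: tpsi.
have [spsi _] := tB; have cpsi := smooth_continuous spsi.
pose a := - B - 1; pose b := B + 1; have ab : a < b by rewrite /a /b; lra.
have Ipsi := integrable_oc hmu cpsi (ltW ab).
have -> : (\int[mu]_x (psi x)%:E = \int[mu]_(x in [set` `]a, b]%R]) (psi x)%:E)%E.
  rewrite [RHS]integral_mkcond; apply: eq_integral => x _.
  rewrite /patch; case: ifPn => //; rewrite notin_setE /= in_itv/= => /negP.
  rewrite negb_and -leNgt -ltNge => h; rewrite vB//.
  by move: h; rewrite /a /b => /orP[h|h]; apply/orP; [left|right]; lra.
rewrite -[RHS]fineK; last exact: integrable_fin_num.
congr (_%:E); set I := fine _.
apply/eqP; rewrite -subr_eq0 -normr_le0.
have [L L0 hL] := testf_bounded_derivn 1 tB.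
have lip x y : `|psi x - psi y| <= L * `|x - y|.
  apply: (@MVT_le _ _ psi^`()%classic) => z _; last exact: hL.
  exact: (smooth_is_derive _ spsi).
(* Each of the two comparisons contributes [2 * L * dlt] times the increment of [gamma], where [L]
   is a Lipschitz constant of [psi]. *)
apply: (@le_of_geometric _ _ _ (4 * L * (b - a) * (gamma b - gamma a))) => k; rewrite add0r.
pose n := (3 ^ k)%N; pose dlt := (b - a) * 3^-1 ^+ k.
have g0 : 0 < 3^-1 ^+ k :> R by rewrite exprn_gt0// invr_gt0.
have dlt0 : 0 < dlt by rewrite mulr_gt0// subr_gt0.
have ndlt : a + n%:R * dlt = b.
  by rewrite /n /dlt natrX mulrCA -exprMn mulfV ?pnatr_eq0// expr1n mulr1 addrC subrK.
have hw2 x y : `|x - y| <= 2 * dlt -> `|psi x - psi y| <= L * (2 * dlt).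
  by move=> h; apply: le_trans (lip x y) _; exact: ler_wpM2l.
have hw1 x y : `|x - y| <= dlt -> `|psi x - psi y| <= L * (2 * dlt).
  by move=> h; apply: hw2; lra.
have ha : a < - B by rewrite /a; lra.
have hb : B < a + n%:R * dlt by rewrite ndlt /b; lra.
have s1 := gamma_sums tB dlt0 ha hb hw2.
have s2 := Rintegral_sums hmu a n cpsi dlt0 hw1.
rewrite ndlt in s1 s2.
rewrite -/I in s2.
set S := \sum_(i < n) _ in s1 s2.
have -> : f psi - I = (f psi - S) - (I - S) by ring.
apply: le_trans (ler_normB _ _) _; apply: le_trans (lerD s1 s2) _.
by rewrite /dlt le_eqVlt; apply/orP; left; apply/eqP; ring.
Qed.

End measure_from_positivity.

Theorem theorem3p7 (R : realType) (f F : Dprime R) (E : set R)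
  (hf : compactly_supported f)
  (hF : lojasiewicz F)
  (hfF : is_derivative_of f F)
  (hE : countable E)
  (hphi : forall phi : R -> R, class_T1 phi ->
     {ae lebesgue_measure, forall x : R, (0 <= radial_upper f phi x)%E} /\
     exists M : R -> R,
       forall x : R, ~ E x -> ((- M x)%:E <= radial_lower f phi x)%E) :
  is_measure f.
Proof.
have [gamma hgamma] := choice hF.
have [hae [M hM]] := hphi _ (@class_T1_phi R).
apply: (measure_of_nonneg hfF hgamma) => p q.
(* The null set is the set where the upper limit for [phi] fails to be nonnegative; [hae] is its
   negligibility. *)
apply: (derivative_nonneg hfF hgamma hE _ hae).
- move=> x /hM /(radial_lower_bound hf (@testf_phi R))[d d0 hd].
  by exists (M x + 1), d => // t td; rewrite opprD; exact: hd.
- move=> x; rewrite /= => /contrapT h e d e0 d0.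
  exact: (radial_upper_ge0 hf (@testf_phi R) h).
Qed.
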